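(* Let $\alpha\geq0$ and, for a real-valued initial datum $u_0$ on $\mathbb{R}$, let $$u^*(x)=\sup_{\substack{t>0\\ |y-x|\leq\alpha t}}P(\cdot,t)*|u_0|(y),\qquad P(x,t)=\frac{1}{\pi}\frac{t}{x^2+t^2}.$$ Then: (i) If $1<p\leq\infty$ and $u_0\in W^{1,p}(\mathbb{R})$, then $u^*\in W^{1,p}(\mathbb{R})$ and $\|(u^* )'\|_{L^p(\mathbb{R})}\leq\|u_0'\|_{L^p(\mathbb{R})}$. (ii) If $u_0\in W^{1,1}(\mathbb{R})$, then $u^*\in L^\infty(\mathbb{R})$ and $u^*$ has a weak derivative $(u^* )'$ satisfying $\|(u^* )'\|_{L^1(\mathbb{R})}\leq\|u_0'\|_{L^1(\mathbb{R})}$. (iii) If $u_0$ is of bounded variation on $\mathbb{R}$, then $u^*$ is of bounded variation on $\mathbb{R}$ and $V(u^* )\leq V(u_0)$.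
   Context: $V(f)$ denotes the total variation of $f:\mathbb{R}\to\mathbb{R}$ (supremum over finite partitions of sums of absolute increments). *)

(* Defs.v *)
From HB Require Import structures.
From mathcomp Require Import all_boot all_order all_algebra.
From mathcomp Require Import all_classical all_reals all_analysis.
Set Implicit Arguments. Unset Strict Implicit. Unset Printing Implicit Defensive.
Import Order.TTheory GRing.Theory Num.Theory.
Import numFieldNormedType.Exports.
Local Open Scope classical_set_scope.
Local Open Scope ring_scope.

Section Defs.
Context {R : realType}.
Local Notation leb := (@lebesgue_measure R).

Definition poisson (x t : R) : R := pi^-1 * (t / (x ^+ 2 + t ^+ 2)).

Definition poisson_abs (u0 : R -> R) (t y : R) : \bar R :=
  (\int[leb]_z (poisson (y - z) t * `|u0 z|)%:E)%E.

Definition ustar (alpha : R) (u0 : R -> R) (x : R) : \bar R :=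
  ereal_sup [set z | exists t y : R,
     [/\ 0 < t, `|y - x| <= alpha * t & z = poisson_abs u0 t y]].

Definition inLp (p : \bar R) (f : R -> R) : Prop :=
  measurable_fun setT f /\ (Lnorm leb p (EFin \o f) < +oo)%E.

Definition Lpnorm (p : \bar R) (f : R -> R) : \bar R := Lnorm leb p (EFin \o f).

Definition test_function (phi : R -> R) : Prop :=
  (forall (n : nat) (x : R), derivable (derive1n n phi) x 1) /\
  exists a b : R, forall x, (x < a \/ b < x) -> phi x = 0.

Definition locally_integrable (f : R -> R) : Prop :=
  measurable_fun setT f /\
  forall a b : R, leb.-integrable `[a, b] (EFin \o f).

Definition weak_derivative (f g : R -> R) : Prop :=
  locally_integrable f /\ locally_integrable g /\
  forall phi, test_function phi ->
    (\int[leb]_x (f x * derive1 phi x)%:E = - \int[leb]_x (g x * phi x)%:E)%E.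

Definition TV (f : R -> R) : \bar R :=
  ereal_sup [set z | exists a b : R, a <= b /\ z = total_variation a b f].

Definition bounded_variation_R (f : R -> R) : Prop := (TV f < +oo)%E.

End Defs.

(* Main.v *)
Require Import Defs.
From HB Require Import structures.
From mathcomp Require Import all_boot all_order all_algebra.
From mathcomp Require Import all_classical all_reals all_analysis.
From mathcomp Require Import measurable_realfun ess_sup_inf.
From mathcomp Require Import ring lra.
Set Implicit Arguments. Unset Strict Implicit. Unset Printing Implicit Defensive.
Import Order.TTheory GRing.Theory Num.Theory.
Import numFieldNormedType.Exports.
Local Open Scope classical_set_scope.
Local Open Scope ring_scope.

(* For a convex even Phi, the energy of F over a partition is the sum of
   Phi (difference quotient of F) * length; it increases under refinement, and
   its supremum is the integral of Phi (F').  All the bounds come from one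
   comparison: the energies of the maximal function are at most those of u0.
   Restrict the supremum to t >= eps and |y - x| <= alpha (t - eps): the result
   is Lipschitz, lies above the Poisson extension at height eps, and lies below
   its chords wherever it is strictly above that extension, by the maximum
   principle (harmonicity enters only as a four-point mean inequality with an
   O(h^4) error).  Such a function has no more energy than its obstacle, whose
   energy is at most that of |u0| by Jensen; then eps -> 0.
   Phi = |r| gives the variation and Phi = |r|^p the L^p norm of the derivative.
   Phi = (|r| - K)^+ settles p = oo, and since these energies tend to 0 as
   K -> oo, it also forces the Stieltjes measure of the maximal function to be
   absolutely continuous.  Membership of the maximal function in L^p comes from
   the weak type inequality of the Hardy-Littlewood maximal function. *)

(** Nothing is known in advance about the regularity of the maximal function, so derivatives are
    replaced by difference quotients over finite partitions; energies make sense for every function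
    and survive pointwise limits. Why an obstacle problem loses energy: by convexity, the energy of
    M is at most that of the obstacle b plus a sum of subgradients at the slopes of M times
    increments of M - b. After Abel summation, a point with M = b contributes nothing, and at a
    point with M > b the slopes of M increase, so the coefficient of M - b has the right sign. The
    two ends of the line are settled by boundedness: a bounded function that is convex on a
    half-line is monotone there. Boundedness is therefore indispensable, and Sobolev data are first
    replaced by a bounded continuous representative. The hypothesis in L^p enters the derivative
    bounds through two facts common to all p >= 1: the means over unit intervals of the datum and of
    its derivative are bounded, and the excess energies of the derivative become small. Only the
    membership of the maximal function in L^p separates p = 1 from p > 1. *)

Section PathSums.
Context {R : realType}.
Implicit Types (phi psi : R -> R -> R) (F : R -> R) (x y z : R) (l : seq R).

Fixpoint psum phi x l : R :=
  if l is y :: l' then phi x y + psum phi y l' else 0.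

Lemma psum_cat phi x l1 l2 :
  psum phi x (l1 ++ l2) = psum phi x l1 + psum phi (last x l1) l2.
Proof. by elim: l1 x => [|y l1 IH] x /=; rewrite ?add0r// IH addrA. Qed.

Lemma psum_ge0 phi x l : (forall a b, a < b -> 0 <= phi a b) ->
  path <%R x l -> 0 <= psum phi x l.
Proof.
move=> h; elim: l x => [|y l IH] x //= /andP[xy yl].
by rewrite addr_ge0 ?h ?IH.
Qed.

Lemma ler_psum phi psi x l : (forall a b, a < b -> phi a b <= psi a b) ->
  path <%R x l -> psum phi x l <= psum psi x l.
Proof.
move=> h; elim: l x => [|y l IH] x //= /andP[xy yl].
by rewrite lerD ?h ?IH.
Qed.

Lemma path_lt_mem x l z : path <%R x l -> z \in l -> x < z.
Proof. by move=> /(order_path_min lt_trans)/allP/[apply]. Qed.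

Lemma psum_refine phi x l l' : (forall a b, a < b -> 0 <= phi a b) ->
  (forall a b c, a < b -> b < c -> phi a c <= phi a b + phi b c) ->
  path <%R x l' -> subseq l l' -> psum phi x l <= psum phi x l'.
Proof.
move=> phi0 phiD; elim: l' x l => [|y t IH] x l.
  by move=> _; rewrite subseq0 => /eqP ->.
move=> /= /andP[xy yt].
case: l => [_|z t0 /=]; first by rewrite addr_ge0 ?phi0 ?psum_ge0.
case: eqP => [->|_] st; first by rewrite lerD2l IH.
(* [l'] starts with a point [y] that [l] skips: the first interval of [l] is cut at [y] and the
   induction continues from there. *)
have yz : y < z.
  by apply: (path_lt_mem yt); apply: (mem_subseq st); rewrite inE eqxx.
have /= := IH y (z :: t0) yt st.
have := phiD x y z xy yz; lra.
Qed.

Lemma psum_linear (c : R) x l : psum (fun a b => c * (b - a)) x l = c * (last x l - x).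
Proof. by elim: l x => [|y l IH] x /=; rewrite ?subrr ?mulr0// IH; ring. Qed.

Lemma psumD phi psi x l :
  psum (fun a b => phi a b + psi a b) x l = psum phi x l + psum psi x l.
Proof. by elim: l x => [|y l IH] x /=; rewrite ?addr0// IH; ring. Qed.

End PathSums.

(** * Convex gauges and partition energies *)

Section Energy.
Context {R : realType}.
Implicit Types (Phi s : R -> R) (F : R -> R) (x y z : R) (l : seq R).

(* [s r] is a subgradient of [Phi] at [r]; convexity is used in no other form. *)
Definition gauge Phi s :=
  [/\ forall r r', Phi r + s r * (r' - r) <= Phi r', Phi 0 = 0,
      forall r r', `|r| <= `|r'| -> Phi r <= Phi r' & s 0 = 0].

Definition energy_term Phi F x y := Phi ((F y - F x) / (y - x)) * (y - x).
Definition energy Phi F x l := psum (energy_term Phi F) x l.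
(** Comparisons are stated as implications between real upper bounds [E]; a supremum over all
    partitions need not be formed for them. *)
Definition energy_le Phi F (E : R) :=
  forall x l, path <%R x l -> energy Phi F x l <= E.

Section gauge.
Variables (Phi s : R -> R).
Hypothesis gPhi : gauge Phi s.

Lemma gauge_ge0 r : 0 <= Phi r.
Proof. by case: gPhi => _ P0 Pm _; rewrite -P0 Pm// normr0. Qed.

Lemma gauge_sub_homo r r' : r <= r' -> s r <= s r'.
Proof.
case: gPhi => Ps _ _ _; rewrite le_eqVlt => /predU1P[->//|rr'].
have h1 := Ps r r'; have h2 := Ps r' r.
have : (s r - s r') * (r' - r) <= 0 by nra.
by rewrite pmulr_lle0 ?subr_gt0// subr_le0.
Qed.

Lemma gauge_sub_ge0 r : 0 <= r -> 0 <= s r.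
Proof. by case: (gPhi) => _ _ _ s0 /gauge_sub_homo; rewrite s0. Qed.

Lemma gauge_sub_le0 r : r <= 0 -> s r <= 0.
Proof. by case: (gPhi) => _ _ _ s0 /gauge_sub_homo; rewrite s0. Qed.

Lemma energy_term_ge0 F x y : x < y -> 0 <= energy_term Phi F x y.
Proof. by move=> xy; rewrite mulr_ge0 ?gauge_ge0// subr_ge0 ltW. Qed.

(** Two-point Jensen inequality: the tangent to [Phi] at the slope [r] over the whole interval is
    evaluated at the two partial slopes. Their length-weighted mean is [r], so the linear
    corrections cancel. *)
Lemma energy_termD F x y z : x < y -> y < z ->
  energy_term Phi F x z <= energy_term Phi F x y + energy_term Phi F y z.
Proof.
case: gPhi => Ps _ _ _ xy yz; rewrite /energy_term.
set r := (F z - F x) / (z - x).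
have yx0 : 0 < y - x by lra.
have zy0 : 0 < z - y by lra.
have zx0 : 0 < z - x by lra.
have h1 := Ps r ((F y - F x) / (y - x)).
have h2 := Ps r ((F z - F y) / (z - y)).
move: h1; rewrite -(ler_pM2r yx0) => h1.
move: h2; rewrite -(ler_pM2r zy0) => h2.
have e1 : (Phi r + s r * ((F y - F x) / (y - x) - r)) * (y - x) =
  Phi r * (y - x) + s r * ((F y - F x) - r * (y - x)) by field; lra.
have e2 : (Phi r + s r * ((F z - F y) / (z - y) - r)) * (z - y) =
  Phi r * (z - y) + s r * ((F z - F y) - r * (z - y)) by field; lra.
have e3 : r * (z - x) = F z - F x by rewrite /r mulfVK// gt_eqF.
rewrite e1 in h1; rewrite e2 in h2.
have -> : Phi r * (z - x) = Phi r * (y - x) + s r * (F y - F x - r * (y - x)) +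
  (Phi r * (z - y) + s r * (F z - F y - r * (z - y))).
  have -> : F y - F x = r * (z - x) - (F z - F y) by rewrite e3; ring.
  by ring.
exact: lerD.
Qed.

Lemma energy_refine F x l l' :
  path <%R x l' -> subseq l l' -> energy Phi F x l <= energy Phi F x l'.
Proof.
apply: psum_refine; first by move=> a b; exact: energy_term_ge0.
by move=> a b c; exact: energy_termD.
Qed.

End gauge.
End Energy.

(** * Comparison with an obstacle *)

Section Detachment.
Context {R : realType}.
Implicit Types (x y z w : R) (l : seq R).

Lemma closed_last_le (C : set R) x : closed C -> (exists2 w, w <= x & C w) ->
  exists w, [/\ w <= x, C w & forall v, v <= x -> C v -> v <= w].
Proof.
move=> clC [w0 w0x hw0]; pose D := C `&` [set w | w <= x].
have clD : closed D by apply: closedI => //; exact: closed_le.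
have hs : has_sup D by split; [exists w0|exists x => w []].
have [h1 h2] : D (sup D) by rewrite {1}(closure_id D).1//; apply: closure_sup => //; case: hs.
by exists (sup D); split => // v vx hv; apply: ub_le_sup => //; exact: hs.2.
Qed.

Lemma closed_first_ge (C : set R) x : closed C -> (exists2 w, x <= w & C w) ->
  exists w, [/\ x <= w, C w & forall v, x <= v -> C v -> w <= v].
Proof.
move=> clC [w0 w0x hw0].
have clD : closed (-%R @^-1` C).
  by apply: preimage_closed => // w _; exact: cvgN.
have [|w [wx Cw wl]] := @closed_last_le (-%R @^-1` C) (- x) clD.
  by exists (- w0); rewrite /= ?lerN2 ?opprK.
exists (- w); split => [||v xv Cv]; [by rewrite lerNr|by []|].
by rewrite lerNl; apply: wl; rewrite /= ?lerN2// opprK.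
Qed.

Lemma sorted_subset_subseq (s1 s2 : seq R) :
  sorted <%R s1 -> sorted <%R s2 -> {subset s1 <= s2} -> subseq s1 s2.
Proof.
move=> h1 h2 h12; rewrite (_ : s1 = [seq z <- s2 | z \in s1]) ?filter_subseq//.
apply: lt_sorted_eq => //; first exact: (sorted_filter lt_trans).
by move=> z; rewrite mem_filter /=; have [/h12 ->|] := boolP (z \in s1).
Qed.

Variables (M b : R -> R) (B : R).
Hypothesis bM : forall x, b x <= M x.
Hypothesis M_bounded : forall x, `|M x| <= B.
Hypothesis cM : continuous M.
Hypothesis cb : continuous b.
Hypothesis M_convex : forall c d, c < d ->
  (forall x, c < x -> x < d -> b x < M x) ->
  forall x, c < x -> x < d -> M x * (d - c) <= M c * (d - x) + M d * (x - c).

Lemma closed_contact : closed [set w | M w <= b w].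
Proof.
rewrite (_ : [set w | _] = (fun w => M w - b w) @^-1` [set r | r <= 0]); last first.
  by apply/seteqP; split => w /=; rewrite subr_le0.
apply: preimage_closed; first by move=> w _; apply: cvgB; [exact: cM|exact: cb].
exact: closed_le.
Qed.

Definition contact w := M w <= b w.

(* A bounded function which is convex on a half-line is monotone there. *)
Lemma detached_ray_right x y : x < y -> (forall w, x < w -> ~~ contact w) -> M y <= M x.
Proof.
move=> xy hd; rewrite leNgt; apply/negP => Mxy.
(* At distance [(1 + k) * (y - x)] to the right of [x], the chord inequality forces [M d >= M y + k
   * (M y - M x) = M y + 2 * B + 1], which exceeds [B]. *)
pose k := (2 * B + 1) / (M y - M x).
have B0 : 0 <= B by exact: le_trans (M_bounded 0).
have k0 : 0 < k by rewrite divr_gt0 ?subr_gt0//; lra.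
pose d := x + (y - x) * (1 + k).
have yd : y < d by rewrite /d; nra.
have hd' w : x < w -> b w < M w by move=> xw; rewrite ltNge; exact: hd.
have := M_convex (lt_trans xy yd) (fun w xw _ => hd' w xw) xy yd.
apply/negP; rewrite -ltNge.
have -> : d - x = (y - x) * (1 + k) by rewrite /d; ring.
have -> : d - y = (y - x) * k by rewrite /d; ring.
have kE : k * (M y - M x) = 2 * B + 1 by rewrite /k divfK// subr_eq0 gt_eqF.
have := M_bounded d; have := M_bounded y; rewrite !ler_norml => /andP[? ?] /andP[? ?].
suff : M x * k + M d < M y * (1 + k) by nra.
have : k * M y - k * M x = 2 * B + 1 by rewrite -kE; ring.
nra.
Qed.

Lemma detached_ray_left x y : x < y -> (forall w, w < y -> ~~ contact w) -> M x <= M y.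
Proof.
move=> xy hd; rewrite leNgt; apply/negP => Mxy.
pose k := (2 * B + 1) / (M x - M y).
have B0 : 0 <= B by exact: le_trans (M_bounded 0).
have k0 : 0 < k by rewrite divr_gt0 ?subr_gt0//; lra.
pose d := y - (y - x) * (1 + k).
have yd : d < x by rewrite /d; nra.
have hd' w : w < y -> b w < M w by move=> wy; rewrite ltNge; exact: hd.
have := M_convex (lt_trans yd xy) (fun w _ wy => hd' w wy) yd xy.
apply/negP; rewrite -ltNge.
have -> : y - d = (y - x) * (1 + k) by rewrite /d; ring.
have -> : x - d = (y - x) * k by rewrite /d; ring.
have kE : k * (M x - M y) = 2 * B + 1 by rewrite /k divfK// subr_eq0 gt_eqF.
have := M_bounded d; have := M_bounded x; rewrite !ler_norml => /andP[? ?] /andP[? ?].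
suff : M y * k + M d < M x * (1 + k) by nra.
have : k * M x - k * M y = 2 * B + 1 by rewrite -kE; ring.
nra.
Qed.

Definition slope F x y : R := (F y - F x) / (y - x).

Lemma detached_slope x y z : x < y -> y < z ->
  (forall w, x < w -> w < z -> ~~ contact w) -> slope M x y <= slope M y z.
Proof.
move=> xy yz hd.
have hd' w : x < w -> w < z -> b w < M w by move=> xw wz; rewrite ltNge; exact: hd.
have h := M_convex (lt_trans xy yz) hd' xy yz.
rewrite /slope ler_pdivrMr ?subr_gt0// mulrAC ler_pdivlMr ?subr_gt0//; nra.
Qed.

Section comparison.
Variables (Phi s : R -> R).
Hypothesis gPhi : gauge Phi s.

(** What is needed to compare the slopes of [M] on the two sides of a partition point: unless it is
    a contact point, the whole open interval between its neighbours is detached. Behind the last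
    point this interval is a half-line. The first point carries no condition, and its contribution
    survives as the boundary term in [adapted_energy]. *)
Fixpoint adapted x l : Prop :=
  if l is y :: l' then
    (contact y \/ if l' is z :: _ then forall w, x < w -> w < z -> ~~ contact w
                  else forall w, x < w -> ~~ contact w) /\ adapted y l'
  else True.

(** Abel summation. On each interval the tangent to [Phi] at the slope of [M] gives the energy of
    [b] plus [s] times the increment of [M - b]. At an inner point the coefficient of [M - b] is the
    difference of [s] at two consecutive slopes, which is at most 0 where the point is detached. At
    a detached last point [M] is nonincreasing on a half-line, so [s <= 0] there. *)
Lemma adapted_energy x y l : path <%R x (y :: l) -> adapted x (y :: l) ->
  energy Phi M x (y :: l) <= energy Phi b x (y :: l) - s (slope M x y) * (M x - b x).
Proof.
have step u v : u < v -> energy_term Phi M u v <=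
    energy_term Phi b u v + s (slope M u v) * ((M v - b v) - (M u - b u)).
  move=> uv; rewrite /energy_term.
  have vu0 : 0 < v - u by lra.
  case: (gPhi) => Ps _ _ _; have := Ps (slope M u v) (slope b u v).
  rewrite -(ler_pM2r vu0) mulrDl -mulrA mulrBl /slope !divfK ?gt_eqF//; lra.
elim: l x y => [|z l IH] x y.
  move=> /= /andP[xy _] [hy _]; rewrite /energy /= !addr0.
  apply: le_trans (step _ _ xy) _; rewrite mulrBr addrA lerD2r gerDl.
  case: hy => [cy|hd]; first by rewrite (_ : M y - b y = 0) ?mulr0//; apply/eqP; rewrite subr_eq0 eq_le bM andbT.
  apply: mulr_le0_ge0; last by rewrite subr_ge0.
  apply: (gauge_sub_le0 gPhi); apply: mulr_le0_ge0; last by rewrite invr_ge0; lra.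
  by rewrite subr_le0; exact: detached_ray_right.
move=> /= /andP[xy /andP[yz zl]] [hy had].
have := IH y z; rewrite /= yz zl => /(_ isT had) {}IH.
rewrite /energy /= in IH *.
apply: le_trans (lerD (step _ _ xy) IH) _.
suff : s (slope M x y) * (M y - b y) <= s (slope M y z) * (M y - b y) by lra.
case: hy => [cy|hd]; first by rewrite (_ : M y - b y = 0) ?mulr0//; apply/eqP; rewrite subr_eq0 eq_le bM andbT.
rewrite ler_wpM2r ?subr_ge0//; apply: (gauge_sub_homo gPhi).
exact: detached_slope.
Qed.

(* The partition is enlarged by the endpoints of the detached components that it meets. *)
Lemma adapted_refinement (x0 : R) (l0 : seq R) : exists x l,
  [/\ path <%R x l, {subset x0 :: l0 <= x :: l} &
      forall y, y \in x :: l -> ~~ contact y ->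
        (forall w, contact w -> w < y -> exists2 v, v \in x :: l & w <= v < y) /\
        (forall w, contact w -> y < w -> exists2 v, v \in x :: l & y < v <= w)].
Proof.
(* Closedness of the contact set provides a last contact point at or before [y]; the list is empty
   when there is none, and then the component of [y] is unbounded on that side. *)
have left y : exists L : seq R, (forall v, v \in L -> contact v) /\
    (~~ contact y -> forall w, contact w -> w < y -> exists2 v, v \in L & w <= v < y).
  have [[w wy cw]|hn] := pselect (exists2 w, w <= y & contact w); last first.
    by exists [::]; split => // _ w cw wy; exfalso; apply: hn; exists w => //; exact: ltW.
  have [v [vy cv vmax]] := closed_last_le closed_contact (ex_intro2 _ _ w wy cw).
  exists [:: v]; split=> [u|ncy u cu uy]; first by rewrite inE => /eqP ->.
  exists v; rewrite ?inE// vmax ?ltW//= lt_neqAle vy andbT.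
  by apply: contra ncy => /eqP <-.
have right y : exists L : seq R, (forall v, v \in L -> contact v) /\
    (~~ contact y -> forall w, contact w -> y < w -> exists2 v, v \in L & y < v <= w).
  have [[w wy cw]|hn] := pselect (exists2 w, y <= w & contact w); last first.
    by exists [::]; split => // _ w cw wy; exfalso; apply: hn; exists w => //; exact: ltW.
  have [v [vy cv vmin]] := closed_first_ge closed_contact (ex_intro2 _ _ w wy cw).
  exists [:: v]; split=> [u|ncy u cu uy]; first by rewrite inE => /eqP ->.
  exists v; rewrite ?inE// vmin ?ltW//= lt_neqAle vy andbT.
  by rewrite andbT; apply: contra ncy => /eqP ->.
have [fl hfl] := choice left; have [fr hfr] := choice right.
pose L := flatten [seq y :: fl y ++ fr y | y <- x0 :: l0].
pose S := sort <=%R (undup L).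
have memS z : (z \in S) = (z \in L) by rewrite mem_sort mem_undup.
have SL y : y \in x0 :: l0 -> forall v, v \in fl y ++ fr y -> v \in S.
  by move=> yl v vf; rewrite memS; apply/flatten_mapP; exists y => //; rewrite inE vf orbT.
have subS : {subset x0 :: l0 <= S}.
  by move=> z zl; rewrite memS; apply/flatten_mapP; exists z => //; rewrite inE eqxx.
have sS : sorted <%R S by rewrite sort_lt_sorted undup_uniq.
have hS y : y \in S -> ~~ contact y ->
    (forall w, contact w -> w < y -> exists2 v, v \in S & w <= v < y) /\
    (forall w, contact w -> y < w -> exists2 v, v \in S & y < v <= w).
  rewrite memS => /flatten_mapP[u ul]; rewrite inE => /orP[/eqP ->{y}|].
    move=> ncu; split => w cw wu.
    - have [v vl hv] := (hfl u).2 ncu w cw wu; exists v => //.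
      by apply: (SL u) => //; rewrite mem_cat vl.
    - have [v vl hv] := (hfr u).2 ncu w cw wu; exists v => //.
      by apply: (SL u) => //; rewrite mem_cat vl orbT.
  by rewrite mem_cat => /orP[/(hfl u).1 ->|/(hfr u).1 ->].
case: S sS hS subS {memS SL} => [_ _ /(_ x0)|x l /= pl hS subS]; first by rewrite inE eqxx => /(_ isT).
by exists x, l; split.
Qed.

(** [S] is the full set of partition points and stays fixed during the induction, hence the
    alternative [v <= x] for points already passed. A contact point in the gap around a detached [y]
    would produce, by the hypothesis on [S], a partition point strictly between [y] and one of its
    neighbours. *)
Lemma adapted_of_set (S : pred R) x l :
  (forall y, S y -> ~~ contact y ->
        (forall w, contact w -> w < y -> exists2 v, S v & w <= v < y) /\
        (forall w, contact w -> y < w -> exists2 v, S v & y < v <= w)) ->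
  path <%R x l -> S x -> (forall y, y \in l -> S y) ->
  (forall v, S v -> v <= x \/ v \in l) -> adapted x l.
Proof.
move=> hS; elim: l x => [//|y l IH] x /= /andP[xy yl] Sx Sl Sv; split; last first.
  apply: IH => //; first by apply: Sl; rewrite inE eqxx.
    by move=> z zl; apply: Sl; rewrite inE zl orbT.
  move=> v /Sv [vx|]; first by left; lra.
  by rewrite inE => /orP[/eqP ->|]; [left|right].
have [|ncy] := boolP (contact y); [by left|right].
have [hl hr] := hS y (Sl y (mem_head _ _)) ncy.
have leftp w : x < w -> w < y -> ~~ contact w.
  move=> xw wy; apply/negP => cw; have [v /Sv [vx|]] := hl w cw wy.
    by move=> /andP[wv _]; lra.
  rewrite inE => /orP[/eqP ->|/(path_lt_mem yl) yv]; first by rewrite ltxx andbF.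
  by move=> /andP[_ ?]; lra.
case: l yl Sl Sv {IH} => [|z l] yl Sl Sv.
  move=> w xw; have [wy|wy|->//] := ltgtP w y; first exact: leftp.
  apply/negP => cw; have [v /Sv [vx|]] := hr w cw wy; first by move=> /andP[? _]; lra.
  by rewrite inE => /eqP ->; rewrite ltxx.
move=> w xw wz; have [wy|wy|->//] := ltgtP w y; first exact: leftp.
apply/negP => cw; have [v /Sv [vx|]] := hr w cw wy; first by move=> /andP[? _]; lra.
rewrite !inE => /or3P[/eqP ->|/eqP ->|]; rewrite ?ltxx//; first by move=> /andP[_ ?]; lra.
move: yl => /= /andP[yz zl] /(path_lt_mem zl) zv /andP[_ ?]; lra.
Qed.

Lemma detachment_energy_le (E : R) : energy_le Phi b E -> energy_le Phi M E.
Proof.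
move=> hE x0 l0 p0.
have [x [l [pl sub hS]]] := adapted_refinement x0 l0.
have ss : subseq (x0 :: l0) (x :: l).
  exact: sorted_subset_subseq.
have hle : energy Phi M x0 l0 <= energy Phi M x l.
  move: ss => /=; case: eqP => [->|_] ss; first exact: energy_refine gPhi _ _ _ _ pl ss.
  apply: le_trans (energy_refine gPhi M pl ss).
  rewrite /energy /= lerDr (energy_term_ge0 gPhi)//.
  by apply: (path_lt_mem pl); apply: (mem_subseq ss); rewrite inE eqxx.
apply: le_trans hle _.
case: l pl sub hS {ss} => [pl _ _|y l pl sub hS].
  by rewrite /energy /=; have := hE x [::] pl.
have had : adapted x (y :: l).
  apply: (adapted_of_set (S := mem (x :: y :: l)) hS pl).
  - exact: mem_head.
  - by move=> z zl; rewrite /= inE zl orbT.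
  - by move=> v /=; rewrite inE => /orP[/eqP ->|]; [left|right].
apply: le_trans (adapted_energy pl had) _.
apply: le_trans (hE x (y :: l) pl); rewrite gerDl oppr_le0.
(* Sign of the boundary term. If the first point is detached, a contact point to its left, or
   between it and the second point [y], would force a further partition point; so all of the
   half-line before [y] is detached, [M] is nondecreasing there, and [s] is nonnegative at the first
   slope. *)
have [cx|ncx] := boolP (contact x).
  by rewrite (_ : M x - b x = 0) ?mulr0//; apply/eqP; rewrite subr_eq0 eq_le bM andbT.
rewrite mulr_ge0 ?subr_ge0//; apply: (gauge_sub_ge0 gPhi).
move: (pl) => /= /andP[xy yl].
apply: divr_ge0; last lra.
rewrite subr_ge0; apply: detached_ray_left => // w wy.
have [hl hr] := hS x (mem_head _ _) ncx.
have [wx|wx|->//] := ltgtP w x; apply/negP => cw.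
  have [v vS /andP[_ vx]] := hl w cw wx.
  by move: vS vx; rewrite inE => /orP[/eqP ->|/(path_lt_mem pl)]; [rewrite ltxx|lra].
have [v vS /andP[xv vw]] := hr w cw wx.
move: vS xv vw; rewrite !inE => /or3P[/eqP ->|/eqP ->|/(path_lt_mem yl)]; [by rewrite ltxx|lra|lra].
Qed.

End comparison.
End Detachment.

Lemma lipschitz_continuousT {R : realType} (f : R -> R) (L : R) :
  (forall x y, `|f x - f y| <= L * `|x - y|) -> continuous f.
Proof.
move=> fL x; apply/cvgrPdist_lt => e e0.
have L1 : 0 < `|L| + 1 by rewrite ltr_pwDr.
near=> y.
apply: le_lt_trans (fL x y) _.
have : `|x - y| < e / (`|L| + 1).
  by near: y; apply: cvgr_dist_lt => //; rewrite divr_gt0.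
rewrite ltr_pdivlMr// => h; apply: le_lt_trans h.
rewrite mulrC ler_wpM2l//; have := ler_norm L; lra.
Unshelve. all: by end_near. Qed.

(** * The maximal function over cones with lifted apex *)

Section RegularizedMaximal.
Context {R : realType}.
Variables (U : R -> R -> R) (eps alpha B L C : R).
Hypothesis eps0 : 0 < eps.
Hypothesis alpha0 : 0 <= alpha.
Hypothesis L0 : 0 <= L.
Hypothesis C0 : 0 <= C.
Hypothesis U_bounded : forall t y, 0 < t -> 0 <= U t y <= B.
Hypothesis U_lipschitz : forall t t' y y', eps <= t -> eps <= t' ->
  `|U t y - U t' y'| <= L * (`|t - t'| + `|y - y'|).
Hypothesis U_discrete_subharmonic : forall t y h, eps <= t -> 0 < h -> h <= eps / 2 ->
  4 * U t y <= U t (y + h) + U t (y - h) + U (t + h) y + U (t - h) y + C * h ^+ 4.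

(* The apex of the cone is lifted to height [eps], so that the supremum at [x]
   dominates [U eps x]. *)
Definition cone_values x : set R :=
  [set r | exists t y, [/\ eps <= t, `|y - x| <= alpha * (t - eps) & r = U t y]].

Definition regmax x := sup (cone_values x).

Lemma has_sup_cone_values x : has_sup (cone_values x).
Proof.
split.
  by exists (U eps x), eps, x; split; rewrite ?subrr ?normr0 ?mulr0.
exists B => r [t [y [et _ ->]]].
by have /andP[] := U_bounded y (lt_le_trans eps0 et).
Qed.

Lemma regmax_ge x t y : eps <= t -> `|y - x| <= alpha * (t - eps) -> U t y <= regmax x.
Proof.
by move=> et yx; apply: ub_le_sup; [case: (has_sup_cone_values x)|exists t, y].
Qed.

Lemma regmax_le x c : (forall t y, eps <= t -> `|y - x| <= alpha * (t - eps) -> U t y <= c) ->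
  regmax x <= c.
Proof.
move=> h; apply: ge_sup; first by case: (has_sup_cone_values x).
by move=> r [t [y [et yx ->]]]; exact: h.
Qed.

Lemma regmax_gt x c : c < regmax x ->
  exists t y, [/\ eps <= t, `|y - x| <= alpha * (t - eps) & c < U t y].
Proof.
move=> /(sup_gt (has_sup_cone_values x).1)[r [t [y [? ? ->]]] ?].
by exists t, y.
Qed.

Lemma regmax_bounded x : 0 <= regmax x <= B.
Proof.
apply/andP; split.
  apply: (@le_trans _ _ (U eps x)); first by have /andP[] := U_bounded x eps0.
  by apply: regmax_ge; rewrite // !subrr mulr0 normr0.
by apply: regmax_le => t y et _; have /andP[] := U_bounded y (lt_le_trans eps0 et).
Qed.

(** Cones at different points are translates of each other, and [U] is [L]-Lipschitz at heights at
    least [eps]. The resulting continuity is what makes the contact set closed. *)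
Lemma regmax_lipschitz x x' : `|regmax x - regmax x'| <= L * `|x - x'|.
Proof.
suff h z z' : regmax z <= regmax z' + L * `|z - z'|.
  by rewrite ler_norml; have := h x x'; have := h x' x; rewrite (distrC x'); lra.
apply: regmax_le => t y et yz.
have h1 : U t (y + z' - z) <= regmax z'.
  by apply: regmax_ge => //; rewrite (_ : _ - z' = y - z) //; ring.
have := U_lipschitz y (y + z' - z) et et.
rewrite subrr normr0 add0r (_ : y - _ = z - z'); last by ring.
rewrite ler_norml; lra.
Qed.

Lemma continuous_regmax : continuous regmax.
Proof. exact: lipschitz_continuousT regmax_lipschitz. Qed.

Lemma continuous_trace : continuous (U eps).
Proof.
apply: (@lipschitz_continuousT _ _ L) => x y.
by have := U_lipschitz x y (lexx eps) (lexx eps); rewrite subrr normr0 add0r.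
Qed.

Lemma trace_le_regmax x : U eps x <= regmax x.
Proof. by apply: regmax_ge; rewrite // !subrr mulr0 normr0. Qed.

Lemma ex_small (a b c d e : R) : 0 < a -> 0 < b -> 0 < c -> 0 < d -> 0 < e ->
  exists h, [/\ 0 < h, h <= a, h <= b & [/\ h <= c, h <= d & h <= e]].
Proof.
move=> a0 b0 c0 d0 e0.
exists (Num.min a (Num.min b (Num.min c (Num.min d e)))).
by rewrite !lt_min a0 b0 c0 d0 e0; split=> //; last split; rewrite !ge_min lexx ?orbT.
Qed.

(* Maximum principle: at an interior maximum x0 of the excess of [regmax] over a
   chord, bent slightly by a parabola, the four discrete neighbours of a
   near-optimal (t, y) are admissible for x0 + h, x0 - h, x0 - beta h and
   x0 + beta h respectively, where y = x0 + beta (t - eps). *)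
Lemma regmax_convex c d : c < d ->
  (forall x, c < x -> x < d -> U eps x < regmax x) ->
  forall x, c < x -> x < d ->
    regmax x * (d - c) <= regmax c * (d - x) + regmax d * (x - c).
Proof.
move=> cd det x cx xd; rewrite leNgt; apply/negP => hx.
pose r := (regmax d - regmax c) / (d - c).
pose l w := regmax c + r * (w - c).
have dc0 : 0 < d - c by lra.
have rdc : r * (d - c) = regmax d - regmax c by rewrite /r divfK// gt_eqF.
pose m := regmax x - l x.
have m0 : 0 < m.
  rewrite -(pmulr_rgt0 _ dc0) /m /l.
  have -> : (d - c) * (regmax x - (regmax c + r * (x - c))) =
    regmax x * (d - c) - regmax c * (d - c) - (r * (d - c)) * (x - c) by ring.
  by rewrite rdc; lra.
have p0 : 0 < (x - c) * (d - x) by rewrite mulr_gt0// subr_gt0.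
(* The parabola takes away half of the excess [m] at [x], so [q x = m / 2 > 0] while [q] still
   vanishes at [c] and [d]: its maximum is interior. *)
pose k := m / (2 * ((x - c) * (d - x))).
have k0 : 0 < k by rewrite divr_gt0// mulr_gt0.
have kE : k * ((x - c) * (d - x)) = m / 2 by rewrite /k; field; rewrite !subr_eq0 !gt_eqF.
pose q w := regmax w - l w - k * ((w - c) * (d - w)).
have cq : continuous q.
  have cid : continuous (fun w : R => w : R) by move=> w; exact: cvg_id.
  have cc (e : R) : continuous (cst e : R -> R) by exact: cst_continuous.
  move=> w; apply: cvgB; [apply: cvgB|].
  - exact: continuous_regmax.
  - by apply: cvgD; [exact: cc|apply: cvgM; [exact: cc|apply: cvgB; [exact: cid|exact: cc]]].
  - apply: cvgM; [exact: cc|apply: cvgM].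
      by apply: cvgB; [exact: cid|exact: cc].
    by apply: cvgB; [exact: cc|exact: cid].
have [x0 x0cd qmax] := @EVT_max _ q c d (ltW cd) (continuous_subspaceT cq).
have qx : q x = m / 2 by rewrite /q kE -/m; field.
have q0 : 0 < q x0.
  by apply: (@lt_le_trans _ _ (q x)); [rewrite qx; lra|apply: qmax; rewrite in_itv /= !ltW].
have qc : q c = 0 by rewrite /q /l; ring.
have qd : q d = 0 by rewrite /q /l rdc; ring.
have /andP[cx0 x0d] : c < x0 < d.
  move: x0cd; rewrite in_itv /= => /andP[h1 h2]; rewrite !lt_neqAle h1 h2 !andbT.
  by apply/andP; split;
    [apply: contraTneq q0 => <-|apply: contraTneq q0 => ->]; rewrite ?qc ?qd ltxx.
(* Strict detachment keeps near-optimal points away from the bottom: at a height below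
   [eps + delta], the Lipschitz bound would give [U t y < U eps x0 + D / 2 = regmax x0 - D / 2]. *)
pose D := regmax x0 - U eps x0.
have D0 : 0 < D by rewrite subr_gt0 det.
pose L1 := L * (1 + alpha) + 1.
have L10 : 0 < L1 by rewrite /L1 ltr_wpDl ?mulr_ge0 ?addr_ge0.
pose delta := D / (2 * L1).
have delta0 : 0 < delta by rewrite divr_gt0// mulr_gt0.
have a1 : 0 < 1 + alpha by rewrite ltr_pwDl.
have C1 : 0 < C + 1 by rewrite ltr_wpDl.
(* The bound [eps / 2] is required by the mean inequality, [delta] keeps [t - h] above [eps], the
   next two keep the four shifted points in [[c, d]], and the last one absorbs [C * h ^+ 4] into
   [k * h ^+ 2]. *)
have [h [h0 heps hdelta [hc hd hk]]] : exists h, [/\ 0 < h, h <= eps / 2, h <= delta &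
    [/\ h <= (x0 - c) / (1 + alpha), h <= (d - x0) / (1 + alpha) &
        h <= Num.min 1 (k / (C + 1))]].
  apply: ex_small => //; first exact: divr_gt0.
  - by rewrite divr_gt0 ?subr_gt0.
  - by rewrite divr_gt0 ?subr_gt0.
  - by rewrite lt_min ltr01 divr_gt0.
move: hc hd hk; rewrite !ler_pdivlMr// le_min ler_pdivlMr// => hc hd /andP[h1 hk].
have Ch4 : C * h ^+ 4 <= k * h ^+ 2.
  have : 0 <= (k - h * (C + 1)) * h ^+ 2 + h ^+ 2 * (h * (C + 1 - C * h)).
    by rewrite addr_ge0 ?mulr_ge0 ?sqr_ge0 ?subr_ge0 ?(ltW h0)//; nra.
  by move=> ?; nra.
(* The first bound makes [4 * eta] smaller than the gain [k * h ^+ 2] left by the parabola; the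
   second one yields [t - eps >= delta]. *)
pose eta := Num.min (k * h ^+ 2 / 8) (D / 2).
have eta0 : 0 < eta by rewrite lt_min !divr_gt0// mulr_gt0// exprn_gt0.
have [t [y [et yx Uty]]] : exists t y, [/\ eps <= t, `|y - x0| <= alpha * (t - eps) &
    regmax x0 - eta < U t y].
  by apply: regmax_gt; rewrite gtrDl oppr_lt0.
have etak : eta <= k * h ^+ 2 / 8 by rewrite /eta ge_min lexx.
have etaD : eta <= D / 2 by rewrite /eta ge_min lexx orbT.
have tdelta : delta <= t - eps.
  rewrite leNgt; apply/negP => td.
  have := U_lipschitz y x0 et (lexx eps).
  rewrite ler_norml (ger0_norm (_ : 0 <= t - eps)) ?subr_ge0// => /andP[_ hU].
  have : L * (t - eps + `|y - x0|) <= L1 * (t - eps).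
    have : L * (t - eps + `|y - x0|) <= L * (t - eps + alpha * (t - eps)).
      by rewrite ler_wpM2l// lerD2l.
    rewrite /L1; have : 0 <= t - eps by rewrite subr_ge0.
    by nra.
  have : L1 * (t - eps) < L1 * delta by rewrite ltr_pM2l.
  have -> : L1 * delta = D / 2 by rewrite /delta; field; lra.
  rewrite /D in etaD *; lra.
pose beta := (y - x0) / (t - eps).
have te0 : 0 < t - eps by lra.
have bE : beta * (t - eps) = y - x0 by rewrite /beta divfK// gt_eqF.
have bal : `|beta| <= alpha by rewrite /beta normrM normfV (gtr0_norm te0) ler_pdivrMr.
have := bal; rewrite ler_norml => /andP[ba1 ba2].
have qle w : c <= w -> w <= d -> regmax w <= q x0 + l w + k * ((w - c) * (d - w)).
  by move=> cw wd; have := qmax w; rewrite in_itv /= cw wd => /(_ isT); rewrite {1}/q; lra.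
have n1 : U t (y + h) <= regmax (x0 + h).
  by apply: regmax_ge => //; rewrite (_ : _ - _ = y - x0)//; ring.
have n2 : U t (y - h) <= regmax (x0 - h).
  by apply: regmax_ge => //; rewrite (_ : _ - _ = y - x0)//; ring.
have n3 : U (t + h) y <= regmax (x0 - beta * h).
  apply: regmax_ge; first lra.
  rewrite (_ : y - _ = beta * (t + h - eps)); last first.
    by transitivity (beta * (t - eps) + beta * h); [rewrite bE; ring|ring].
  by rewrite normrM (@ger0_norm _ (t + h - eps)) ?ler_wpM2r//; lra.
have n4 : U (t - h) y <= regmax (x0 + beta * h).
  apply: regmax_ge; first lra.
  rewrite (_ : y - _ = beta * (t - h - eps)); last first.
    by transitivity (beta * (t - eps) - beta * h); [rewrite bE; ring|ring].
  by rewrite normrM (@ger0_norm _ (t - h - eps)) ?ler_wpM2r//; lra.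
have bh1 : beta * h <= alpha * h by rewrite ler_wpM2r// ltW.
have bh2 : - (alpha * h) <= beta * h by rewrite -mulNr ler_wpM2r// ltW.
have ah0 : 0 <= alpha * h by rewrite mulr_ge0// ltW.
rewrite mulrDr mulr1 (mulrC h) in hc hd.
have q1 := qle (x0 + h); have q2 := qle (x0 - h).
have q3 := qle (x0 - beta * h); have q4 := qle (x0 + beta * h).
have := U_discrete_subharmonic y et h0 heps.
have {}q1 := q1 ltac:(lra) ltac:(lra).
have {}q2 := q2 ltac:(lra) ltac:(lra).
have {}q3 := q3 ltac:(lra) ltac:(lra).
have {}q4 := q4 ltac:(lra) ltac:(lra).
move=> hU.
(* The four points form two pairs symmetric about [x0]: the affine [l] cancels, and the parabola
   leaves its two second differences, with steps [h] and [beta * h]. *)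
have : 4 * U t y <= 4 * (q x0 + l x0 + k * ((x0 - c) * (d - x0)))
    - 2 * (k * h ^+ 2) - 2 * (k * (beta * h) ^+ 2) + C * h ^+ 4.
  apply: le_trans hU _.
  have -> : 4 * (q x0 + l x0 + k * ((x0 - c) * (d - x0)))
    - 2 * (k * h ^+ 2) - 2 * (k * (beta * h) ^+ 2) + C * h ^+ 4 =
   (q x0 + l (x0 + h) + k * (((x0 + h) - c) * (d - (x0 + h)))) +
   (q x0 + l (x0 - h) + k * (((x0 - h) - c) * (d - (x0 - h)))) +
   (q x0 + l (x0 - beta * h) + k * (((x0 - beta * h) - c) * (d - (x0 - beta * h)))) +
   (q x0 + l (x0 + beta * h) + k * (((x0 + beta * h) - c) * (d - (x0 + beta * h)))) + C * h ^+ 4.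
    by rewrite /l; ring.
  by lra.
have -> : q x0 + l x0 + k * ((x0 - c) * (d - x0)) = regmax x0 by rewrite /q; ring.
have : 0 <= k * (beta * h) ^+ 2 by rewrite mulr_ge0 ?sqr_ge0// ltW.
have : 0 < k * h ^+ 2 by rewrite mulr_gt0// exprn_gt0.
lra.
Qed.

Lemma regmax_energy_le (Phi s : R -> R) (E : R) : gauge Phi s ->
  energy_le Phi (U eps) E -> energy_le Phi regmax E.
Proof.
move=> g; apply: (@detachment_energy_le _ regmax (U eps) B _ _ _ _ _ _ s g).
- exact: trace_le_regmax.
- by move=> x; have /andP[h1 h2] := regmax_bounded x; rewrite ger0_norm.
- exact: continuous_regmax.
- exact: continuous_trace.
- exact: regmax_convex.
Qed.

End RegularizedMaximal.

(** * Reflection and translation invariance of Lebesgue measure *)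

Section LebesgueInvariance.
Context {R : realType}.
Local Notation mu := (@lebesgue_measure R).

Lemma lebesgue_measure_reflect (y : R) (A : set R) : measurable A ->
  pushforward mu ((fun z => y - z) : _ -> measurableTypeR R) A = mu A.
Proof.
have mf : measurable_fun setT ((fun z => y - z) : measurableTypeR R -> measurableTypeR R).
  by apply: measurable_funB.
move=> mA; apply/esym.
pose m := pushforward mu ((fun z => y - z) : _ -> measurableTypeR R).
rewrite -[RHS]/(m A).
apply: (@lebesgue_measure_unique R m) => //= _ [[a b]] _ <-.
rewrite /m /pushforward (_ : _ @^-1` _ = `[y - b, y - a[%classic).
  rewrite !lebesgue_measure_itv /= !lte_fin ltrD2l ltrN2.
  by case: ifPn => // _; rewrite -!EFinD; congr EFin; ring.
apply/seteqP; split => z /=; rewrite !in_itv /=; lra.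
Qed.

Lemma lebesgue_measure_shift (y : R) (A : set R) : measurable A ->
  pushforward mu ((fun z => z + y) : _ -> measurableTypeR R) A = mu A.
Proof.
have mf : measurable_fun setT ((fun z => z + y) : measurableTypeR R -> measurableTypeR R).
  by apply: measurable_funD.
move=> mA; apply/esym.
pose m := pushforward mu ((fun z => z + y) : _ -> measurableTypeR R).
rewrite -[RHS]/(m A).
apply: (@lebesgue_measure_unique R m) => //= _ [[a b]] _ <-.
rewrite /m /pushforward (_ : _ @^-1` _ = `]a - y, b - y]%classic).
  rewrite !lebesgue_measure_itv /= !lte_fin ltrD2r.
  by case: ifPn => // _; rewrite -!EFinD; congr EFin; ring.
apply/seteqP; split => z /=; rewrite !in_itv /=; lra.
Qed.

Lemma ge0_integral_reflect (y : R) (f : R -> \bar R) : measurable_fun setT f ->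
  (forall x, 0 <= f x)%E -> (\int[mu]_z f (y - z)%R = \int[mu]_z f z)%E.
Proof.
move=> mf f0.
have mg : measurable_fun setT ((fun z => y - z) : measurableTypeR R -> measurableTypeR R).
  by apply: measurable_funB.
transitivity (\int[pushforward mu ((fun z => y - z)%R : _ -> measurableTypeR R)]_z f z)%E.
  by rewrite ge0_integral_pushforward.
by apply: eq_measure_integral => A mA _; exact: lebesgue_measure_reflect.
Qed.

Lemma ge0_integral_shift (y : R) (D : set R) (f : R -> \bar R) : measurable D ->
  measurable_fun D f -> (forall x, 0 <= f x)%E ->
  (\int[mu]_(z in [set z | D (z + y)%R]) f (z + y)%R = \int[mu]_(z in D) f z)%E.
Proof.
move=> mD mf f0.
have mg : measurable_fun setT ((fun z => z + y) : measurableTypeR R -> measurableTypeR R).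
  by apply: measurable_funD.
transitivity (\int[pushforward mu ((fun z => z + y)%R : _ -> measurableTypeR R)]_(z in D) f z)%E.
  by rewrite ge0_integral_pushforward.
by apply: eq_measure_integral => A mA _; exact: lebesgue_measure_shift.
Qed.

Lemma Rintegral_reflect (y : R) (f : R -> R) : mu.-integrable setT (EFin \o f) ->
  \int[mu]_z f (y - z) = \int[mu]_z f z.
Proof.
move=> intf; rewrite /Rintegral; congr fine.
have mf := measurable_int _ intf.
have mg : measurable_fun setT ((fun z => y - z) : measurableTypeR R -> measurableTypeR R).
  by apply: measurable_funB.
transitivity (\int[pushforward mu ((fun z => y - z)%R : _ -> measurableTypeR R)]_z (f z)%:E)%E.
  rewrite integral_pushforward//=.
  apply/integrableP; split; first exact: (measurableT_comp mf).
  have /integrableP[_] := intf; apply: le_lt_trans.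
  by rewrite -(@ge0_integral_reflect y (fun z => `|(f z)%:E|%E))//; exact: measurableT_comp.
by apply: eq_measure_integral => A mA _; exact: lebesgue_measure_reflect.
Qed.

End LebesgueInvariance.

(** * The Poisson extension *)

Section PoissonKernel.
Context {R : realType}.
Local Notation mu := (@lebesgue_measure R).
Implicit Types (x y z t h : R).

Lemma poisson_ge0 x t : 0 < t -> 0 <= poisson x t.
Proof. by move=> t0; rewrite /poisson mulr_ge0 ?invr_ge0 ?pi_ge0// divr_ge0 ?addr_ge0 ?sqr_ge0// ltW. Qed.

Lemma poissonN x t : poisson (- x) t = poisson x t.
Proof. by rewrite /poisson sqrrN. Qed.

Lemma continuous_poisson t : 0 < t -> continuous (fun x => poisson x t).
Proof.
move=> t0 x; rewrite /poisson; apply: cvgM; first exact: cvg_cst.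
apply: cvgM; first exact: cvg_cst.
apply: cvgV; first by rewrite gt_eqF// ltr_wpDl ?sqr_ge0// exprn_gt0.
by apply: cvgD; [exact: exprn_continuous|exact: cvg_cst].
Qed.

Lemma measurable_poisson t : 0 < t -> measurable_fun setT (fun x => poisson x t).
Proof. by move=> t0; apply: continuous_measurable_fun; exact: continuous_poisson. Qed.

Lemma cvg_atany : atan x @[x --> +oo] --> (pi / 2 : R).
Proof.
apply/cvgrPdist_le => e e0.
pose d := Num.min e (pi / 2).
have pi0 : 0 < pi / 2 :> R by rewrite divr_gt0 ?pi_gt0.
have d0 : 0 < d by rewrite lt_min e0.
near=> x.
have h1 := atan_ltpi2 x.
rewrite ger0_norm ?subr_ge0 1?ltW//.
suff : pi / 2 - d < atan x.
  have : d <= e by rewrite /d ge_min lexx.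
  lra.
have dm : pi / 2 - d \in `](- (pi / 2)), (pi / 2)[.
  have : d <= pi / 2 by rewrite /d ge_min lexx orbT.
  by rewrite in_itv /=; lra.
rewrite -[ltLHS]tanK//; apply: lt_atan.
by near: x; apply: nbhs_pinfty_gt; exact: num_real.
Unshelve. all: by end_near. Qed.

Lemma integral_poisson t : 0 < t -> (\int[mu]_x (poisson x t)%:E = 1)%E.
Proof.
move=> t0.
rewrite ge0_symfun_integralT; last 3 first.
- by move=> x; exact: poisson_ge0.
- exact: continuous_poisson.
- by move=> x; rewrite /= poissonN.
rewrite -set_itvcy.
have pi0 : pi != 0 :> R by rewrite gt_eqF ?pi_gt0.
pose F x := pi^-1 * atan (x / t).
have dF x : is_derive x 1 F (poisson x t).
  have h1 : is_derive x 1 (fun x => x / t) (t^-1).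
    have := @is_deriveZ _ _ _ (@id R) t^-1 x 1 _ (is_derive_id _ _).
    rewrite -[_ *: 1]/(t^-1 * 1) mulr1 (_ : _ \*: _ = (fun x => x / t))//.
    by apply/funext => w /=; rewrite mulrC.
  have h2 := @is_derive1_comp _ atan (fun x => x / t) x _ _ (is_derive1_atan _) h1.
  have h3 := @is_deriveZ _ _ _ _ pi^-1 x 1 _ h2.
  rewrite (_ : poisson x t = pi^-1 *: ((1 + (x / t) ^+ 2)^-1 * t^-1)); first exact: h3.
  rewrite /poisson /GRing.scale /=; congr (_ * _).
  have q1 : x ^+ 2 + t ^+ 2 != 0 by rewrite gt_eqF// ltr_wpDl ?sqr_ge0 ?exprn_gt0.
  have tn0 : t != 0 by rewrite gt_eqF.
  have -> : 1 + (x / t) ^+ 2 = (x ^+ 2 + t ^+ 2) / (t * t) by field.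
  by rewrite invf_div mulrAC mulfK.
rewrite (@ge0_continuous_FTC2y R _ F 0 (2^-1)).
- rewrite /F mul0r atan0 mulr0 sube0 -EFinM mulfV//.
- by move=> x _; exact: poisson_ge0.
- by apply: continuous_subspaceT; exact: continuous_poisson.
- rewrite (_ : 2^-1 = pi^-1 * (pi / 2)); last by rewrite mulrA mulVf// mul1r.
  apply: cvgM; first exact: cvg_cst.
  apply: (@cvg_comp _ _ _ (fun x => x / t) atan _ +oo); last exact: cvg_atany.
  apply/cvgryPge => A; exists (A * t); split; first exact: num_real.
  by move=> w Aw; rewrite ler_pdivlMr// ltW.
- by move=> x _; have [] := dF x.
- have : {for 0, continuous F}.
    by apply: differentiable_continuous; apply/derivable1_diffP; have [] := dF 0.
  by move=> /cvg_at_right_filter.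
- by move=> x _; rewrite derive1E; have [_ ->] := dF x.
Qed.

(** The bound is a multiple of the kernels themselves, so that it integrates to a constant. The
    numerator splits as [(t' - t) * (t * t' - x * x') + (x' - x) * (t * x' + t' * x)], and both
    bilinear factors are at most half of [Q + Q'] in absolute value. *)
Lemma poisson_sub_le (eps x x' t t' : R) : 0 < eps -> eps <= t -> eps <= t' ->
  `|poisson x t - poisson x' t'| <=
  (`|t - t'| + `|x - x'|) / (2 * eps) * (poisson x t + poisson x' t').
Proof.
move=> e0 et et'.
have t0 : 0 < t by lra.
have t'0 : 0 < t' by lra.
rewrite /poisson -mulrBr -mulrDr normrM ger0_norm ?invr_ge0 ?pi_ge0//.
rewrite mulrCA ler_wpM2l ?invr_ge0 ?pi_ge0//.
set Q := x ^+ 2 + t ^+ 2; set Q' := x' ^+ 2 + t' ^+ 2.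
have Q0 : 0 < Q by rewrite /Q ltr_wpDl ?sqr_ge0 ?exprn_gt0.
have Q'0 : 0 < Q' by rewrite /Q' ltr_wpDl ?sqr_ge0 ?exprn_gt0.
have QQ0 : 0 < Q * Q' by rewrite mulr_gt0.
rewrite -(ler_pM2r QQ0) -[X in `|_| * X]gtr0_norm// -normrM.
have -> : (t / Q - t' / Q') * (Q * Q') = t * Q' - t' * Q by field; rewrite !gt_eqF.
have -> : (`|t - t'| + `|x - x'|) / (2 * eps) * (t / Q + t' / Q') * (Q * Q') =
  (`|t - t'| + `|x - x'|) * ((t / eps * Q' + t' / eps * Q) / 2).
  by field; rewrite !gt_eqF.
have -> : t * Q' - t' * Q = (t' - t) * (t * t' - x * x') + (x' - x) * (t * x' + t' * x).
  by rewrite /Q /Q'; ring.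
have ht : 0 < t / eps /\ 0 < t' / eps by rewrite !divr_gt0.
have t1 : 1 <= t / eps by rewrite ler_pdivlMr ?mul1r.
have t'1 : 1 <= t' / eps by rewrite ler_pdivlMr ?mul1r.
have hQ : (Q' + Q) / 2 <= (t / eps * Q' + t' / eps * Q) / 2 by nra.
apply: le_trans (ler_normD _ _) _; rewrite !normrM mulrDl (distrC t') (distrC x').
apply: lerD; apply: ler_wpM2l => //; apply: le_trans hQ; rewrite ler_norml /Q /Q'.
  have := sqr_ge0 (t - t'); have := sqr_ge0 (x + x').
  have := sqr_ge0 (t + t'); have := sqr_ge0 (x - x'); nra.
have := sqr_ge0 (t - x'); have := sqr_ge0 (x + t').
have := sqr_ge0 (t + x'); have := sqr_ge0 (x - t'); nra.
Qed.

(* With z = t + i x, pi * poisson x t is the real part of 1 / z, and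
   1/(z+h) + 1/(z-h) + 1/(z+ih) + 1/(z-ih) - 4/z = 4 h^4 / (z (z^4 - h^4)). *)
Lemma poisson_discrete_laplacian x t h : 0 < h -> h <= t / 2 ->
  4 * poisson x t <= poisson (x + h) t + poisson (x - h) t + poisson x (t + h) +
    poisson x (t - h) + 5 / t ^+ 4 * h ^+ 4 * poisson x t.
Proof.
move=> h0 ht; have t0 : 0 < t by lra.
rewrite /poisson.
set Q := x ^+ 2 + t ^+ 2.
set D1 := (x + h) ^+ 2 + t ^+ 2; set D2 := (x - h) ^+ 2 + t ^+ 2.
set D3 := x ^+ 2 + (t + h) ^+ 2; set D4 := x ^+ 2 + (t - h) ^+ 2.
have Q0 : 0 < Q by rewrite /Q ltr_wpDl ?sqr_ge0 ?exprn_gt0.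
have D10 : 0 < D1 by rewrite /D1 ltr_wpDl ?sqr_ge0 ?exprn_gt0.
have D20 : 0 < D2 by rewrite /D2 ltr_wpDl ?sqr_ge0 ?exprn_gt0.
have D30 : 0 < D3 by rewrite /D3 ltr_wpDl ?sqr_ge0 ?exprn_gt0 //; lra.
have D40 : 0 < D4 by rewrite /D4 ltr_wpDl ?sqr_ge0 ?exprn_gt0 //; lra.
(* With z = t + i x, [A] and [B] are the real and imaginary parts of z^4 - h^4 and [N] is its
   squared modulus. So [t * A - x * B] is the real part of z (z^4 - h^4), whose squared modulus is
   [Q * N]. *)
pose A := t ^+ 4 - 6 * t ^+ 2 * x ^+ 2 + x ^+ 4 - h ^+ 4.
pose B := 4 * t ^+ 3 * x - 4 * t * x ^+ 3.
pose N := A ^+ 2 + B ^+ 2.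
have NE : N = D1 * D2 * (D3 * D4) by rewrite /N /A /B /D1 /D2 /D3 /D4; ring.
have N0 : 0 < N by rewrite NE !mulr_gt0.
have key : t / D1 + t / D2 + (t + h) / D3 + (t - h) / D4 - 4 * (t / Q) =
    4 * h ^+ 4 * (t * A - x * B) / (Q * N).
  rewrite NE.
  have -> : t / D1 + t / D2 = 2 * t * (Q + h ^+ 2) / (D1 * D2).
    rewrite /D1 /D2 /Q; field; rewrite -/D1 -/D2 !gt_eqF//.
  have -> : 2 * t * (Q + h ^+ 2) / (D1 * D2) + (t + h) / D3 =
    (2 * t * (Q + h ^+ 2) * D3 + (t + h) * (D1 * D2)) / (D1 * D2 * D3).
    by field; rewrite !gt_eqF.
  apply/eqP; rewrite -subr_eq0; apply/eqP.
  have -> : (2 * t * (Q + h ^+ 2) * D3 + (t + h) * (D1 * D2)) / (D1 * D2 * D3) + (t - h) / D4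
      - 4 * (t / Q) - 4 * h ^+ 4 * (t * A - x * B) / (Q * (D1 * D2 * (D3 * D4))) =
    ((2 * t * (Q + h ^+ 2) * D3 + (t + h) * (D1 * D2)) * D4 * Q + (t - h) * (D1 * D2 * D3) * Q
      - 4 * t * (D1 * D2 * D3 * D4) - 4 * h ^+ 4 * (t * A - x * B)) / (Q * (D1 * D2 * (D3 * D4))).
    by field; rewrite !gt_eqF.
  rewrite [X in X / _](_ : _ = 0) ?mul0r//.
  by rewrite /A /B /D1 /D2 /D3 /D4 /Q; ring.
have tQ : t ^+ 2 <= Q by rewrite /Q lerDr sqr_ge0.
have h2 : h ^+ 2 <= Q / 4 by nra.
have h4 : h ^+ 4 <= Q ^+ 2 / 16.
  rewrite (_ : h ^+ 4 = (h ^+ 2) ^+ 2); last by ring.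
  rewrite (_ : Q ^+ 2 / 16 = (Q / 4) ^+ 2); last by field.
  by rewrite ler_pXn2r ?nnegrE ?sqr_ge0 ?divr_ge0 ?(ltW Q0).
have NQ : 7 / 8 * Q ^+ 4 <= N.
  have -> : N = Q ^+ 4 - 2 * h ^+ 4 * (t ^+ 4 - 6 * t ^+ 2 * x ^+ 2 + x ^+ 4) + (h ^+ 4) ^+ 2.
    by rewrite /N /A /B /Q; ring.
  have hz : t ^+ 4 - 6 * t ^+ 2 * x ^+ 2 + x ^+ 4 <= Q ^+ 2.
    rewrite /Q (_ : (x ^+ 2 + t ^+ 2) ^+ 2 = t ^+ 4 + 2 * (t ^+ 2 * x ^+ 2) + x ^+ 4); last by ring.
    have : 0 <= t ^+ 2 * x ^+ 2 by rewrite mulr_ge0 ?sqr_ge0.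
    lra.
  have : 2 * h ^+ 4 * (t ^+ 4 - 6 * t ^+ 2 * x ^+ 2 + x ^+ 4) <= 2 * h ^+ 4 * Q ^+ 2.
    by rewrite ler_wpM2l// mulr_ge0// exprn_ge0// ltW.
  have : 2 * h ^+ 4 * Q ^+ 2 <= 2 * (Q ^+ 2 / 16) * Q ^+ 2.
    by rewrite ler_wpM2r ?sqr_ge0// ler_wpM2l.
  rewrite (_ : 2 * (Q ^+ 2 / 16) * Q ^+ 2 = Q ^+ 4 / 8); last by field.
  have := sqr_ge0 (h ^+ 4); lra.
(* A real part is at least minus the modulus, so the square of the left side is at most
   [Q ^+ 4 * N <= 8 / 7 * N ^+ 2], below [(5 / 4 * N) ^+ 2]. The factor 5/4 turns the 4 of the
   identity into the 5 of the error term. *)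
have cs : - (t ^+ 3 * (t * A - x * B)) <= 5 / 4 * N.
  have CS : (t * A - x * B) ^+ 2 <= Q * N.
    have -> : Q * N = (t * A - x * B) ^+ 2 + (t * B + x * A) ^+ 2 by rewrite /N /Q; ring.
    by rewrite lerDl sqr_ge0.
  have t6 : (t ^+ 3) ^+ 2 <= Q ^+ 3.
    rewrite (_ : (t ^+ 3) ^+ 2 = (t ^+ 2) ^+ 3); last by ring.
    by rewrite ler_pXn2r ?nnegrE ?sqr_ge0 ?(ltW Q0).
  have sq : (t ^+ 3 * (t * A - x * B)) ^+ 2 <= (5 / 4 * N) ^+ 2.
    rewrite exprMn; apply: (@le_trans _ _ (Q ^+ 3 * (Q * N))).
      by rewrite ler_pM ?sqr_ge0.
    have -> : Q ^+ 3 * (Q * N) = Q ^+ 4 * N by ring.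
    have -> : (5 / 4 * N) ^+ 2 = 25 / 16 * N * N by field.
    rewrite ler_pM2r//.
    by have : 0 < Q ^+ 4 by [rewrite exprn_gt0]; lra.
  have N5 : 0 <= 5 / 4 * N by rewrite mulr_ge0 ?(ltW N0)//; lra.
  rewrite leNgt; apply/negP => hlt.
  have : (5 / 4 * N) ^+ 2 < (- (t ^+ 3 * (t * A - x * B))) ^+ 2 by rewrite ltr_pXn2r ?nnegrE// ltW// (le_lt_trans N5).
  by rewrite sqrrN ltNge sq.
have fin : 0 <= 4 * h ^+ 4 * (t * A - x * B) / (Q * N) + 5 / t ^+ 4 * h ^+ 4 * (t / Q).
  have -> : 4 * h ^+ 4 * (t * A - x * B) / (Q * N) + 5 / t ^+ 4 * h ^+ 4 * (t / Q) =
    4 * h ^+ 4 / (t ^+ 3 * Q * N) * (5 / 4 * N + t ^+ 3 * (t * A - x * B)).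
    by field; rewrite !gt_eqF.
  rewrite mulr_ge0 ?divr_ge0 ?mulr_ge0 ?exprn_ge0 ?(ltW N0) ?(ltW Q0) ?(ltW t0) ?(ltW h0)//.
  lra.
have pi0 : 0 <= pi^-1 :> R by rewrite invr_ge0 pi_ge0.
rewrite -key in fin.
have := mulr_ge0 pi0 fin; lra.
Qed.

End PoissonKernel.

Section IntegrableEFin.
Context d (T : measurableType d) {R : realType} (mu : {measure set T -> \bar R}).
Implicit Types (D : set T) (G H : T -> R).

Lemma integrableZl_EFin D c G : measurable D ->
  mu.-integrable D (EFin \o G) -> mu.-integrable D (EFin \o (fun x => c * G x)).
Proof. by move=> mD iG; have := integrableZl mD c iG. Qed.

Lemma integrableD_EFin D G H : measurable D ->
  mu.-integrable D (EFin \o G) -> mu.-integrable D (EFin \o H) ->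
  mu.-integrable D (EFin \o (fun x => G x + H x)).
Proof. by move=> mD iG iH; have := integrableD mD iG iH. Qed.

Lemma integrableB_EFin D G H : measurable D ->
  mu.-integrable D (EFin \o G) -> mu.-integrable D (EFin \o H) ->
  mu.-integrable D (EFin \o (fun x => G x - H x)).
Proof. by move=> mD iG iH; have := integrableB mD iG iH. Qed.

Lemma ge0_integrable_EFin D G : measurable_fun D G -> (forall x, 0 <= G x) ->
  (\int[mu]_(x in D) (G x)%:E < +oo)%E -> mu.-integrable D (EFin \o G).
Proof.
move=> mG G0 iG; apply/integrableP; split; first exact/measurable_EFinP.
by under eq_integral do rewrite /= ger0_norm//.
Qed.

End IntegrableEFin.

Section PoissonExtension.
Context {R : realType}.
Local Notation mu := (@lebesgue_measure R).
Implicit Types (x y z t h : R) (G H : R -> R).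

Definition bounded_measurable G :=
  measurable_fun setT G /\ exists B, forall x, `|G x| <= B.

Lemma bounded_measurable_cst (c : R) : bounded_measurable (cst c).
Proof. by split; [exact: measurable_cst|exists `|c|]. Qed.

Lemma bounded_measurableD G H : bounded_measurable G -> bounded_measurable H ->
  bounded_measurable (fun x => G x + H x).
Proof.
move=> [mG [B hB]] [mH [B' hB']]; split; first exact: measurable_funD.
by exists (B + B') => x; rewrite (le_trans (ler_normD _ _))// lerD.
Qed.

Lemma bounded_measurableM (c : R) G : bounded_measurable G ->
  bounded_measurable (fun x => c * G x).
Proof.
move=> [mG [B hB]]; split; first by apply: measurable_funM => //; exact: measurable_cst.
by exists (`|c| * B) => x; rewrite normrM ler_wpM2l.
Qed.

Lemma measurable_reflect G y : measurable_fun setT G ->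
  measurable_fun setT (fun z => G (y - z)).
Proof.
move=> mG; apply: (measurableT_comp mG).
by apply: measurable_funB; [exact: measurable_cst|exact: measurable_id].
Qed.

Lemma bounded_measurable_reflect G y : bounded_measurable G ->
  bounded_measurable (fun z => G (y - z)).
Proof. by move=> [mG [B hB]]; split; [exact: measurable_reflect|exists B]. Qed.

Lemma integrable_poisson t : 0 < t -> mu.-integrable setT (EFin \o (fun x => poisson x t)).
Proof.
move=> t0; apply: ge0_integrable_EFin; first exact: measurable_poisson.
  by move=> x; exact: poisson_ge0.
by rewrite integral_poisson// ltry.
Qed.

Lemma integrable_poissonM t G : 0 < t -> bounded_measurable G ->
  mu.-integrable setT (EFin \o (fun w => poisson w t * G w)).
Proof.
move=> t0 [mG [B hB]].
have hi := integrableZl (@measurableT _ _) `|B| (integrable_poisson t0).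
apply: le_integrable hi => //.
  apply/measurable_EFinP; apply: measurable_funM => //; exact: measurable_poisson.
move=> x _ /=; rewrite lee_fin !normrM normr_id mulrC.
by rewrite ler_wpM2r// (le_trans (hB x))// ler_norm.
Qed.

(** The Poisson average as a normalized, positive and linear functional on bounded measurable
    functions. Bounds and Jensen's inequality for [pext] use these properties alone, through
    [pextE]. *)
Definition pint t G := \int[mu]_w (poisson w t * G w).

Lemma pint_cst t c : 0 < t -> pint t (cst c) = c.
Proof.
move=> t0; rewrite /pint; under eq_Rintegral do rewrite mulrC.
rewrite RintegralZl//; last exact: integrable_poisson.
by rewrite /Rintegral integral_poisson//= mulr1.
Qed.

Lemma pintD t G H : 0 < t -> bounded_measurable G -> bounded_measurable H ->
  pint t (fun x => G x + H x) = pint t G + pint t H.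
Proof.
move=> t0 bG bH; rewrite /pint -RintegralD//; try exact: integrable_poissonM.
by under eq_Rintegral do rewrite mulrDr.
Qed.

Lemma pintM t c G : 0 < t -> bounded_measurable G ->
  pint t (fun x => c * G x) = c * pint t G.
Proof.
move=> t0 bG; rewrite /pint -RintegralZl//; last exact: integrable_poissonM.
by under eq_Rintegral do rewrite mulrCA.
Qed.

Lemma pint_le t G H : 0 < t -> bounded_measurable G -> bounded_measurable H ->
  (forall w, G w <= H w) -> pint t G <= pint t H.
Proof.
move=> t0 bG bH GH; apply: le_Rintegral => //; try exact: integrable_poissonM.
by move=> x _; rewrite ler_wpM2l ?poisson_ge0.
Qed.

Variables (v : R -> R) (B : R).
Hypothesis mv : measurable_fun setT v.
Hypothesis v0 : forall x, 0 <= v x.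
Hypothesis vB : forall x, v x <= B.

Let bv : bounded_measurable v.
Proof. by split => //; exists B => x; rewrite ger0_norm. Qed.

Let B0 : 0 <= B. Proof. exact: le_trans (v0 0) (vB 0). Qed.

Definition pext t y := \int[mu]_z (poisson (y - z) t * v z).

Lemma integrable_pext t y : 0 < t ->
  mu.-integrable setT (EFin \o (fun z => poisson (y - z) t * v z)).
Proof.
move=> t0; apply: ge0_integrable_EFin.
- apply: measurable_funM => //.
  by apply: (@measurable_reflect (fun w => poisson w t)); exact: measurable_poisson.
- by move=> x; rewrite mulr_ge0 ?poisson_ge0.
rewrite -(ge0_integral_reflect y); first last.
- by move=> x; rewrite lee_fin mulr_ge0 ?poisson_ge0.
- apply/measurable_EFinP; apply: measurable_funM => //.
  by apply: (@measurable_reflect (fun w => poisson w t)); exact: measurable_poisson.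
have := integrable_lty (@measurableT _ _) (integrable_poissonM t0 (bounded_measurable_reflect y bv)).
apply: le_lt_trans; rewrite le_eqVlt; apply/orP; left; apply/eqP.
by apply: eq_integral => x _ /=; rewrite (_ : (y - (y - x) = x)%R)//; ring.
Qed.

Lemma pextE t y : 0 < t -> pext t y = pint t (fun w => v (y - w)).
Proof.
move=> t0; rewrite /pext /pint -(Rintegral_reflect y).
  by apply: eq_Rintegral => x _; rewrite (_ : y - (y - x) = x)//; ring.
exact: integrable_pext.
Qed.

Lemma pext_EFin t y : 0 < t -> (pext t y)%:E = (\int[mu]_z (poisson (y - z) t * v z)%:E)%E.
Proof. by move=> t0; rewrite /pext /Rintegral fineK//; apply: integrable_fin_num => //; exact: integrable_pext. Qed.

Lemma pext_bounded t y : 0 < t -> 0 <= pext t y <= B.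
Proof.
move=> t0; rewrite pextE//; apply/andP; split.
  rewrite -[leLHS](@pint_cst t 0)//; apply: pint_le => //.
    exact: bounded_measurable_cst.
  exact: bounded_measurable_reflect.
rewrite -[leRHS](@pint_cst t B)//; apply: pint_le => //.
  exact: bounded_measurable_reflect.
exact: bounded_measurable_cst.
Qed.

Lemma integrable_poisson_reflect t y : 0 < t ->
  mu.-integrable setT (EFin \o (fun z => poisson (y - z) t)).
Proof.
move=> t0; apply: ge0_integrable_EFin.
- by apply: (@measurable_reflect (fun w => poisson w t)); exact: measurable_poisson.
- by move=> x; rewrite poisson_ge0.
rewrite (ge0_integral_reflect y (f := fun x => (poisson x t)%:E)) ?integral_poisson ?ltry//.
  by apply/measurable_EFinP; exact: measurable_poisson.
by move=> x; rewrite lee_fin poisson_ge0.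
Qed.

Lemma Rintegral_poisson_reflect t y : 0 < t -> \int[mu]_z poisson (y - z) t = 1.
Proof.
move=> t0; rewrite (Rintegral_reflect y (f := fun x => poisson x t)).
  by rewrite /Rintegral integral_poisson.
exact: integrable_poisson.
Qed.

Lemma pext_lipschitz eps t t' y y' : 0 < eps -> eps <= t -> eps <= t' ->
  `|pext t y - pext t' y'| <= B / eps * (`|t - t'| + `|y - y'|).
Proof.
move=> e0 et et'.
have t0 : 0 < t by lra.
have t'0 : 0 < t' by lra.
rewrite /pext -RintegralB//; try exact: integrable_pext.
set K := `|t - t'| + `|y - y'|.
apply: le_trans (le_normr_Rintegral _ _) _ => //.
  by apply: integrableB_EFin => //; exact: integrable_pext.
apply: (@le_trans _ _ (\int[mu]_z (B * (K / (2 * eps)) * (poisson (y - z) t + poisson (y' - z) t')))).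
  apply: le_Rintegral => //.
  - apply: integrable_norm.
    by apply: integrableB_EFin => //; exact: integrable_pext.
  - by apply: integrableZl_EFin => //; apply: integrableD_EFin => //;
      exact: integrable_poisson_reflect.
  - move=> z _; rewrite -mulrBl normrM mulrC (ger0_norm (v0 z)) -mulrA.
    apply: ler_pM => //.
    by have := poisson_sub_le (y - z) (y' - z) e0 et et'; rewrite (_ : y - z - (y' - z) = y - y'); last ring.
rewrite RintegralZl//; last first.
  by apply: integrableD_EFin => //; exact: integrable_poisson_reflect.
rewrite RintegralD//; try exact: integrable_poisson_reflect.
rewrite !Rintegral_poisson_reflect//.
by rewrite le_eqVlt; apply/orP; left; apply/eqP; field; rewrite gt_eqF.
Qed.

Lemma pext_discrete_subharmonic eps t y h : 0 < eps -> eps <= t -> 0 < h -> h <= eps / 2 ->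
  4 * pext t y <= pext t (y + h) + pext t (y - h) + pext (t + h) y + pext (t - h) y
    + 5 * B / eps ^+ 4 * h ^+ 4.
Proof.
move=> e0 et h0 he.
have t0 : 0 < t by lra.
have th0 : 0 < t + h by lra.
have th'0 : 0 < t - h by lra.
have hi1 := integrable_pext (y + h) t0.
have hi2 := integrable_pext (y - h) t0.
have hi3 := integrable_pext y th0.
have hi4 := integrable_pext y th'0.
have hi0 := integrable_pext y t0.
pose c := 5 / t ^+ 4 * h ^+ 4.
have hi5 := integrableZl_EFin c (@measurableT _ _) hi0.
have hi12 := integrableD_EFin (@measurableT _ _) hi1 hi2.
have hi123 := integrableD_EFin (@measurableT _ _) hi12 hi3.
have hi1234 := integrableD_EFin (@measurableT _ _) hi123 hi4.
have hi12345 := integrableD_EFin (@measurableT _ _) hi1234 hi5.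
have : 4 * pext t y <= pext t (y + h) + pext t (y - h) + pext (t + h) y + pext (t - h) y
    + c * pext t y.
  rewrite /pext -!RintegralZl//.
  do 4 rewrite -RintegralD//.
  apply: le_Rintegral => //; first exact: (integrableZl_EFin 4 (@measurableT _ _) hi0).
  move=> z _.
  have := @poisson_discrete_laplacian _ (y - z) t h h0 _.
  rewrite (_ : h <= t / 2) => [/(_ isT)|]; last lra.
  rewrite (_ : y - z + h = y + h - z); last ring.
  rewrite (_ : y - z - h = y - h - z); last ring.
  move=> /(ler_wpM2r (v0 z)); rewrite -/c; lra.
move=> /le_trans; apply; rewrite lerD2l.
have /andP[p0 pB] := pext_bounded y t0.
rewrite /c -mulrA (mulrC (h ^+ 4)) mulrA ler_wpM2r ?exprn_ge0 ?(ltW h0)//.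
apply: (@le_trans _ _ (5 / t ^+ 4 * B)).
  by rewrite ler_wpM2l// divr_ge0// exprn_ge0// ltW.
rewrite mulrAC ler_wpM2l ?mulr_ge0// lef_pV2 ?posrE ?exprn_gt0//.
by rewrite ler_pXn2r ?nnegrE// ltW.
Qed.

(* Jensen's inequality for the probability density [poisson _ t]. *)
Lemma pext_energy_le t (Phi s : R -> R) (E : R) : 0 < t -> gauge Phi s ->
  energy_le Phi v E -> energy_le Phi (pext t) E.
Proof.
move=> t0 g hE x l pl.
(* [G] is assembled from the tangents to [Phi] at the slopes of [pext t]. It is affine in the
   translates of [v], so its average can be computed exactly, and by convexity it stays below the
   energy of each translate. *)
suff [G [bG GE Gle]] : exists G, [/\ bounded_measurable G, pint t G = energy Phi (pext t) x l &
    forall w, G w <= energy Phi v (x - w) [seq y - w | y <- l]].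
  rewrite -GE -[leRHS](@pint_cst t E)//; apply: pint_le => //.
    exact: bounded_measurable_cst.
  move=> w; apply: le_trans (Gle w) _; apply: hE.
  by apply: (homo_path (f := fun y => y - w)) pl => a b; rewrite ltrD2r.
elim: l x pl => [|y l IH] x /=.
  move=> _; exists (cst 0); split => //; first exact: bounded_measurable_cst.
  by rewrite pint_cst.
move=> /andP[xy /IH[G [bG GE Gle]]].
pose r := (pext t y - pext t x) / (y - x).
pose K w := (Phi r - s r * r) * (y - x) + s r * (v (y - w) + - 1 * v (x - w)).
have bvy := bounded_measurable_reflect y bv.
have bvx := bounded_measurable_reflect x bv.
have bvx' := bounded_measurableM (-1) bvx.
have bvyx := bounded_measurableD bvy bvx'.
have bsv := bounded_measurableM (s r) bvyx.
have bc := bounded_measurable_cst ((Phi r - s r * r) * (y - x)).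
have bK : bounded_measurable K by exact: bounded_measurableD.
exists (fun w => K w + G w); split.
- exact: bounded_measurableD.
- rewrite pintD// GE /energy /= /energy_term -/r; congr (_ + _).
  rewrite /K (pintD t0 bc bsv) pint_cst// pintM// pintD// pintM// -!pextE//.
  have rE : r * (y - x) = pext t y - pext t x by rewrite /r divfK// subr_eq0 gt_eqF.
  rewrite mulrBl -(mulrA (s r)) rE; ring.
- move=> w; rewrite /energy /= lerD//.
  rewrite /energy_term /K.
  case: (g) => Ps _ _ _.
  have := Ps r ((v (y - w) - v (x - w)) / (y - w - (x - w))).
  rewrite (_ : y - w - (x - w) = y - x); last ring.
  have yx0 : 0 < y - x by lra.
  move=> /(ler_wpM2r (ltW yx0)); rewrite (_ : (Phi r + s r * ((v (y - w) - v (x - w)) / (y - x) - r)) * (y - x) =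
    (Phi r - s r * r) * (y - x) + s r * (v (y - w) + -1 * v (x - w)))//.
  by field; rewrite gt_eqF.
Qed.

End PoissonExtension.

(** * The nontangential maximal function as a limit of regularized ones *)

Section NontangentialMaximal.
Context {R : realType}.
Implicit Types (x y z t h e : R).
Variables (v : R -> R) (B alpha : R).
Hypothesis mv : measurable_fun setT v.
Hypothesis v0 : forall x, 0 <= v x.
Hypothesis vB : forall x, v x <= B.
Hypothesis alpha0 : 0 <= alpha.

Definition nontangential_values x : set R :=
  [set r | exists t y, [/\ 0 < t, `|y - x| <= alpha * t & r = pext v t y]].

Definition nontangential x := sup (nontangential_values x).

Let B0 : 0 <= B. Proof. exact: le_trans (v0 0) (vB 0). Qed.

Lemma has_sup_nontangential x : has_sup (nontangential_values x).
Proof.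
split.
  by exists (pext v 1 x), 1, x; split; rewrite ?ltr01// subrr normr0 mulr1.
exists B => r [t [y [t0 _ ->]]].
by have /andP[] := pext_bounded mv v0 vB y t0.
Qed.

Lemma nontangential_ge x t y : 0 < t -> `|y - x| <= alpha * t ->
  pext v t y <= nontangential x.
Proof.
by move=> et yx; apply: ub_le_sup; [case: (has_sup_nontangential x)|exists t, y].
Qed.

Lemma nontangential_le x c :
  (forall t y, 0 < t -> `|y - x| <= alpha * t -> pext v t y <= c) ->
  nontangential x <= c.
Proof.
move=> h; apply: ge_sup; first by case: (has_sup_nontangential x).
by move=> r [t [y [et yx ->]]]; exact: h.
Qed.

Lemma nontangential_bounded x : 0 <= nontangential x <= B.
Proof.
apply/andP; split.
  apply: (@le_trans _ _ (pext v 1 x)).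
    by have /andP[] := pext_bounded mv v0 vB x (@ltr01 R).
  by apply: nontangential_ge => //; rewrite subrr normr0 mulr1.
by apply: nontangential_le => t y t0 _; have /andP[] := pext_bounded mv v0 vB y t0.
Qed.

Let lip eps (e0 : 0 < eps) t t' y y' : eps <= t -> eps <= t' ->
  `|pext v t y - pext v t' y'| <= B / eps * (`|t - t'| + `|y - y'|).
Proof. exact: pext_lipschitz. Qed.

Lemma regmax_le_nontangential eps x : 0 < eps ->
  regmax (pext v) eps alpha x <= nontangential x.
Proof.
move=> e0; apply: (regmax_le (B := B)) => //.
  by move=> t y; exact: pext_bounded.
move=> t y et yx; apply: nontangential_ge; first lra.
by apply: le_trans yx _; rewrite ler_wpM2l//; lra.
Qed.

(** A near-optimal [(t, y)] for [x] is pulled towards the axis by the factor [(t - eps) / t], which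
    makes it admissible for the lifted cone. The displacement is at most [alpha * eps], and at
    height [t] the extension is Lipschitz with constant [B / (t / 2)]. The threshold [d] depends on
    [x], which is enough for finite partitions. *)
Lemma nontangential_approx x e : 0 < e -> exists2 d, 0 < d &
  forall eps, 0 < eps -> eps <= d -> nontangential x - e <= regmax (pext v) eps alpha x.
Proof.
move=> e0.
have [r [t [y [t0 yx ->]]] hr] : exists2 r, nontangential_values x r & nontangential x - e / 2 < r.
  have e20 : 0 < e / 2 by rewrite divr_gt0.
  by have [r hr1 hr2] := sup_adherent e20 (has_sup_nontangential x); exists r.
have t20 : 0 < t / 2 by rewrite divr_gt0.
pose L := B / (t / 2).
have L0 : 0 <= L by rewrite divr_ge0// ltW.
have La0 : 0 < 2 * (L * alpha + 1) by rewrite mulr_gt0// ltr_wpDl// mulr_ge0.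
exists (Num.min (t / 2) (e / (2 * (L * alpha + 1)))).
  by rewrite lt_min t20 divr_gt0.
move=> eps eps0; rewrite le_min => /andP[et]; rewrite ler_pdivlMr// => hL.
pose y' := x + (y - x) * ((t - eps) / t).
have k0 : 0 <= (t - eps) / t by rewrite divr_ge0//; lra.
have y'x : `|y' - x| <= alpha * (t - eps).
  rewrite /y' (addrC x) addrK normrM (ger0_norm k0).
  apply: le_trans (ler_wpM2r k0 yx) _.
  by rewrite -mulrA (mulrCA t) mulfV ?gt_eqF// mulr1.
have yy' : `|y - y'| <= alpha * eps.
  have -> : y - y' = (y - x) * (eps / t) by rewrite /y'; field; rewrite gt_eqF.
  have k1 : 0 <= eps / t by rewrite divr_ge0 ?ltW.
  rewrite normrM (ger0_norm k1).
  apply: le_trans (ler_wpM2r k1 yx) _.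
  by rewrite -mulrA (mulrCA t) mulfV ?gt_eqF// mulr1.
have h1 : pext v t y' <= regmax (pext v) eps alpha x.
  apply: (regmax_ge (B := B)) => //; last lra.
  by move=> ? ?; exact: pext_bounded.
have tt : t / 2 <= t by lra.
have := lip t20 y y' tt tt; rewrite subrr normr0 add0r -/L => h2.
have h3 : L * `|y - y'| <= e / 2.
  apply: le_trans (ler_wpM2l L0 yy') _; rewrite mulrA.
  have hL' : eps * (2 * (L * alpha + 1)) = 2 * (L * alpha * eps) + 2 * eps by ring.
  rewrite hL' in hL; move: (L * alpha * eps) hL => w; lra.
move: h2; rewrite ler_norml; lra.
Qed.

(** The Lipschitz and error constants at height [eps] blow up as [eps] tends to 0, but the energy
    bound [E] is the same for every [eps]. On a fixed partition the values converge, and the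
    tangents to [Phi] at the limiting slopes give the semicontinuity that is required. *)
Lemma nontangential_energy_le (Phi s : R -> R) (E : R) : gauge Phi s ->
  energy_le Phi v E -> energy_le Phi nontangential E.
Proof.
move=> g hE.
have hreg eps : 0 < eps -> energy_le Phi (regmax (pext v) eps alpha) E.
  move=> eps0.
  apply: (@regmax_energy_le R (pext v) eps alpha B (B / eps) (5 * B / eps ^+ 4)
    eps0 alpha0 _ _ _ _ _ Phi s) => //.
  - by rewrite divr_ge0// ltW.
  - by apply: divr_ge0; [exact: mulr_ge0|rewrite exprn_ge0// ltW].
  - by move=> t y t0; exact: pext_bounded.
  - by move=> *; exact: lip.
  - by move=> *; exact: pext_discrete_subharmonic.
  - exact: (pext_energy_le mv v0 vB eps0 g hE).
move=> x l pl; apply/ler_addgt0Pr => e e0.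
suff [d d0 hd] : exists2 d, 0 < d & forall eps, 0 < eps -> eps <= d ->
    energy Phi nontangential x l <= energy Phi (regmax (pext v) eps alpha) x l + e.
  by apply: le_trans (hd d d0 (lexx _)) _; rewrite lerD2r hreg.
elim: l x pl e e0 => [|y l IH] x /=.
  by move=> _ e e0; exists 1 => // eps _ _; rewrite /energy /= add0r ltW.
move=> /andP[xy yl] e e0.
have e20 : 0 < e / 2 by rewrite divr_gt0.
have [d1 d10 h1] := IH y yl _ e20.
pose r := (nontangential y - nontangential x) / (y - x).
have s1 : 0 < 2 * (`|s r| + 1) by rewrite mulr_gt0// ltr_wpDl.
(* At both endpoints the error lies in [[0, e']], so the difference of the errors, multiplied by the
   subgradient [s r], costs at most [e / 2]. *)
pose e' := e / (2 * (`|s r| + 1)).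
have e'0 : 0 < e' by rewrite divr_gt0.
have [d2 d20 h2] := nontangential_approx x e'0.
have [d3 d30 h3] := nontangential_approx y e'0.
exists (Num.min d1 (Num.min d2 d3)); first by rewrite !lt_min d10 d20 d30.
move=> eps eps0; rewrite !le_min => /and3P[ed1 ed2 ed3].
have {}h1 := h1 _ eps0 ed1.
have {}h2 := h2 _ eps0 ed2.
have {}h3 := h3 _ eps0 ed3.
have h4 := regmax_le_nontangential x eps0.
have h5 := regmax_le_nontangential y eps0.
rewrite /energy /= in h1 *.
suff : energy_term Phi nontangential x y <=
    energy_term Phi (regmax (pext v) eps alpha) x y + e / 2 by lra.
rewrite /energy_term -/r.
set my := regmax _ _ _ y in h3 h5 *; set mx := regmax _ _ _ x in h2 h4 *.
case: (g) => Ps _ _ _.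
have yx0 : 0 < y - x by lra.
have := Ps r ((my - mx) / (y - x)) => /(ler_wpM2r (ltW yx0)).
have -> : (Phi r + s r * ((my - mx) / (y - x) - r)) * (y - x) =
    Phi r * (y - x) + s r * ((my - nontangential y) - (mx - nontangential x)).
  by rewrite /r; field; rewrite gt_eqF.
suff : `|s r * ((my - nontangential y) - (mx - nontangential x))| <= e / 2.
  by rewrite ler_norml; lra.
rewrite normrM; apply: (@le_trans _ _ ((`|s r| + 1) * e')).
  apply: ler_pM => //; first by rewrite lerDl.
  by rewrite ler_norml; lra.
by rewrite /e' le_eqVlt; apply/orP; left; apply/eqP; field; rewrite gt_eqF// ltr_wpDl.
Qed.

(** The datum enters only through its Poisson averages, so [v] may be a good representative of its
    absolute value instead of the absolute value itself. *)
Lemma ustar_nontangential (u0 : R -> R) :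
  (forall t y, 0 < t -> poisson_abs u0 t y = (pext v t y)%:E) ->
  forall x, ustar alpha u0 x = (nontangential x)%:E.
Proof.
move=> h x; rewrite /ustar -ereal_sup_EFin; last 2 first.
- by case: (has_sup_nontangential x).
- by case: (has_sup_nontangential x).
congr ereal_sup; apply/seteqP; split => z /=.
  by move=> [t [y [t0 yx ->]]]; rewrite h//; exists (pext v t y) => //; exists t, y.
by move=> [_ [t [y [t0 yx ->]]] <-]; exists t, y; rewrite h.
Qed.

End NontangentialMaximal.

(** * Bounded variation *)

Section CumulativeEnergy.
Context {R : realType}.
Implicit Types (x y a : R) (l : seq R).
Variables (Phi s F : R -> R) (E : R).
Hypothesis gPhi : gauge Phi s.
Hypothesis hE : energy_le Phi F E.

Definition energies_before x : set R :=
  [set r | exists a l, [/\ path <%R a l, last a l <= x & r = energy Phi F a l]].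

(** Stands for the distribution function of the measure with density [Phi (F')]: bounded by [E],
    nondecreasing, and available before any derivative of [F] exists. Partitions may start
    arbitrarily far to the left. *)
Definition cumulative_energy x := sup (energies_before x).

Lemma has_sup_energies_before x : has_sup (energies_before x).
Proof.
split; first by exists 0, x, [::].
by exists E => r [a [l [pl _ ->]]]; exact: hE.
Qed.

Lemma cumulative_energy_ge x a l : path <%R a l -> last a l <= x ->
  energy Phi F a l <= cumulative_energy x.
Proof.
by move=> pl lx; apply: ub_le_sup; [case: (has_sup_energies_before x)|exists a, l].
Qed.

Lemma cumulative_energy_le x c :
  (forall a l, path <%R a l -> last a l <= x -> energy Phi F a l <= c) ->
  cumulative_energy x <= c.
Proof.
move=> h; apply: ge_sup; first by case: (has_sup_energies_before x).
by move=> r [a [l [pl lx ->]]]; exact: h.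
Qed.

Lemma cumulative_energy_bounded x : 0 <= cumulative_energy x <= E.
Proof.
apply/andP; split; first exact: (@cumulative_energy_ge x x [::]).
by apply: cumulative_energy_le => a l pl _; exact: hE.
Qed.

Lemma cumulative_energyD x y : x < y ->
  cumulative_energy x + energy_term Phi F x y <= cumulative_energy y.
Proof.
move=> xy; rewrite -lerBrDr; apply: cumulative_energy_le => a l pl lx; rewrite lerBrDr.
move: lx; rewrite le_eqVlt => /predU1P[lx|lx].
  apply: le_trans (@cumulative_energy_ge y a (l ++ [:: y]) _ _).
  - by rewrite /energy psum_cat /= lx addr0.
  - by rewrite cat_path pl /= lx xy.
  - by rewrite last_cat.
apply: le_trans (@cumulative_energy_ge y a (l ++ [:: x; y]) _ _).
- rewrite /energy psum_cat /= addr0 addrA lerD2r lerDl.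
  exact: (energy_term_ge0 gPhi).
- by rewrite cat_path pl /= lx xy.
- by rewrite last_cat.
Qed.

Lemma cumulative_energy_homo : {homo cumulative_energy : x y / x <= y}.
Proof.
move=> x y; rewrite (le_eqVlt x) => /predU1P[->//|xy].
by apply: le_trans (cumulative_energyD xy); rewrite lerDl (energy_term_ge0 gPhi).
Qed.

Lemma cumulative_energy_path x l : path <%R x l ->
  cumulative_energy x + energy Phi F x l <= cumulative_energy (last x l).
Proof.
elim: l x => [|y l IH] x /=; first by rewrite addr0.
move=> /andP[xy /IH]; apply: le_trans; rewrite /energy /= addrA lerD2r.
exact: cumulative_energyD.
Qed.

End CumulativeEnergy.

Section Variation.
Context {R : realType}.
Implicit Types (x y a b : R) (l : seq R) (F : R -> R).

Lemma gauge_normr : gauge (fun r : R => `|r|) Num.sg.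
Proof.
split; [|exact: normr0|by []|exact: sgr0].
move=> r r'; rewrite mulrBr -[X in X - _]/_ normrEsg.
have -> : Num.sg r * r + (Num.sg r * r' - Num.sg r * r) = Num.sg r * r' by ring.
apply: le_trans (ler_norm _) _; rewrite normrM normr_sg.
by case: eqP; rewrite ?mul1r// mul0r.
Qed.

Lemma energy_norm F x l : path <%R x l ->
  energy (fun r : R => `|r|) F x l = psum (fun a b => `|F b - F a|) x l.
Proof.
elim: l x => [//|y l IH] x /= /andP[xy /IH h]; rewrite /energy /= in h *; rewrite h.
congr (_ + _); rewrite /energy_term normrM normfV.
by rewrite (@gtr0_norm _ (y - x)) ?subr_gt0// divfK// subr_eq0 gt_eqF.
Qed.

Lemma variation_psum a b F l : variation a b F l = psum (fun a b => `|F b - F a|) a l.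
Proof.
elim: l a => [|y l IH] a; first by rewrite variation_nil.
rewrite /variation /= big_nat_recl//=; congr (_ + _).
by rewrite -IH.
Qed.

Lemma energy_norm_le_total_variation F x l : path <%R x l ->
  ((energy (fun r : R => `|r|) F x l)%:E <= total_variation x (last x l) F)%E.
Proof.
move=> pl; rewrite energy_norm//; apply: ereal_sup_ubound.
exists (psum (fun a b => `|F b - F a|) x l) => //.
exists l; first by split.
by rewrite variation_psum.
Qed.

Lemma energy_norm_TV F : bounded_variation_R F ->
  energy_le (fun r : R => `|r|) F (fine (TV F)).
Proof.
move=> bF x l pl.
have TV0 : (0 <= TV F)%E.
  apply: (@le_trans _ _ (total_variation 0 0 F)); first exact: total_variation_ge0.
  by apply: ereal_sup_ubound; exists 0, 0.
rewrite -lee_fin fineK; last by rewrite ge0_fin_numE.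
apply: le_trans (energy_norm_le_total_variation F pl) _.
apply: ereal_sup_ubound; exists x, (last x l); split => //.
by by case: l pl => [//|y l] pl; apply: ltW; apply: (path_lt_mem pl); rewrite /= mem_last.
Qed.

Lemma TV_le_energy F E : energy_le (fun r : R => `|r|) F E -> (TV F <= E%:E)%E.
Proof.
move=> hE; apply: ub_ereal_sup => z [a [b [ab ->]]].
apply: ub_ereal_sup => w [v [l [pl _] <-] <-].
by rewrite lee_fin variation_psum -energy_norm//; exact: hE.
Qed.

Lemma energy_le_norm Phi s F E : gauge Phi s -> energy_le Phi F E ->
  energy_le Phi (fun x => `|F x|) E.
Proof.
move=> g hE x l pl; apply: le_trans (hE x l pl).
apply: ler_psum pl => a b ab; rewrite /energy_term ler_wpM2r ?subr_ge0 ?(ltW ab)//.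
by case: g => _ _ Pm _; apply: Pm; rewrite !normrM ler_wpM2r// ler_dist_dist.
Qed.

Lemma energy_norm_dist F E x y : energy_le (fun r : R => `|r|) F E -> `|F x - F y| <= E.
Proof.
move=> hE; wlog xy : x y / x <= y.
  by move=> h; have [/h//|/ltW/h] := leP x y; rewrite distrC.
move: xy; rewrite le_eqVlt => /predU1P[->|xy].
  by rewrite subrr normr0; have := hE y [::] isT.
have pl : path <%R x [:: y] by rewrite /= xy.
by have := hE x [:: y] pl; rewrite energy_norm// /= addr0 distrC.
Qed.

(** Jordan decomposition: with [T] the cumulative variation, [F + T] and [T] are both nondecreasing.
    A datum of bounded variation comes without a measurability assumption, and its Poisson extension
    needs one. *)
Lemma bounded_energy_measurable F E : energy_le (fun r : R => `|r|) F E ->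
  measurable_fun setT F.
Proof.
move=> hE; pose T := cumulative_energy (fun r : R => `|r|) F.
have hT := cumulative_energy_homo gauge_normr hE.
have hF : {homo (fun x => F x + T x) : x y / x <= y}.
  move=> x y; rewrite (le_eqVlt x) => /predU1P[->//|xy].
  have := cumulative_energyD gauge_normr hE xy.
  rewrite /energy_term normrM normfV (@gtr0_norm _ (y - x)) ?subr_gt0//.
  rewrite divfK ?subr_eq0 ?gt_eqF// -/T.
  have := ler_norm (- (F y - F x)); rewrite normrN; lra.
rewrite (_ : F = (fun x => (F x + T x) - T x)); last by apply/funext => x; rewrite addrK.
by apply: measurable_funB; apply: nondecreasing_measurable.
Qed.

Lemma maximal_bounded_variation (alpha : R) (u0 : R -> R) : 0 <= alpha ->
  bounded_variation_R u0 ->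
  [/\ forall x, (ustar alpha u0 x < +oo)%E,
      bounded_variation_R (fun x => fine (ustar alpha u0 x)) &
      (TV (fun x => fine (ustar alpha u0 x)) <= TV u0)%E].
Proof.
move=> alpha0 bu; have hE := energy_norm_TV bu.
have mu0 := bounded_energy_measurable hE.
pose v x := `|u0 x|.
pose B := `|u0 0| + fine (TV u0).
have mv : measurable_fun setT v by exact: measurableT_comp.
have v0 x : 0 <= v x by rewrite /v.
have vB x : v x <= B.
  by rewrite /v /B -lerBlDl; apply: le_trans (lerB_dist _ _) (energy_norm_dist _ _ hE).
have us x : ustar alpha u0 x = (nontangential v alpha x)%:E.
  apply: (ustar_nontangential mv v0 vB alpha0) => t y t0.
  by rewrite (pext_EFin mv v0 vB).
have -> : (fun x => fine (ustar alpha u0 x)) = nontangential v alpha.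
  by apply/funext => x; rewrite us.
have hn := nontangential_energy_le mv v0 vB alpha0 gauge_normr (energy_le_norm gauge_normr hE).
have hTV : (TV (nontangential v alpha) <= TV u0)%E.
  apply: le_trans (TV_le_energy hn) _; rewrite fineK// ge0_fin_numE//.
  apply: (@le_trans _ _ (total_variation 0 0 u0)); first exact: total_variation_ge0.
  by apply: ereal_sup_ubound; exists 0, 0.
split => //; first by move=> x; rewrite us ltry.
exact: le_lt_trans hTV bu.
Qed.

End Variation.

(** * Absolute continuity *)

Section StieltjesDensity.
Context {R : realType}.
Local Notation mu := (@lebesgue_measure R).
Local Notation stieltjes := (@lebesgue_stieltjes_measure R).

Lemma stieltjes_itv (A : cumulative R R) a b : a <= b ->
  stieltjes A `]a, b] = (A b - A a)%:E.
Proof.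
move=> ab; rewrite /lebesgue_stieltjes_measure /measure_extension/=.
by rewrite measurable_mu_extE/= ?wlength_itv_bnd//; exact: is_ocitv.
Qed.

Lemma stieltjes_add (A H W : cumulative R R) (S : set (measurableTypeR R)) :
  (forall x, W x = A x + H x) -> measurable S ->
  stieltjes W S = (stieltjes A S + stieltjes H S)%E.
Proof.
move=> WAH mS; rewrite -measure_addE.
apply: (@lebesgue_stieltjes_measure_unique _ W
  (measure_add (stieltjes A) (stieltjes H))) => // _ [[a b]] _ <-.
rewrite [RHS]measure_addE /=.
have [ab|ba] := leP a b; last first.
  by rewrite set_itv_ge ?measure0 ?adde0// bnd_simp -leNgt ltW.
by rewrite !stieltjes_itv// !WAH -EFinD; congr EFin; ring.
Qed.

Lemma stieltjes_scale (C : cumulative R R) (k : {nonneg R}) (S : set (measurableTypeR R)) :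
  (forall x, C x = k%:num * x) -> measurable S -> stieltjes C S = (k%:num%:E * mu S)%E.
Proof.
move=> Ck mS; rewrite -[RHS]/(mscale k mu S).
apply: (@lebesgue_stieltjes_measure_unique _ C (mscale k mu)) => // _ [[a b]] _ <-.
have [ab|ba] := leP a b; last first.
  by rewrite set_itv_ge ?measure0// bnd_simp -leNgt ltW.
rewrite stieltjes_itv//.
change ((C b - C a)%:E = (k%:num%:E * mu `]a, b]%classic)%E).
have -> : mu `]a, b]%classic = (b - a)%:E by rewrite -[RHS](@stieltjes_itv idfun).
by rewrite !Ck -EFinM; congr EFin; ring.
Qed.

Definition to_cumulative (A : R -> R) (nA : nondecreasing A)
  (cA : forall x, A t @[t --> x^'+] --> A x) : cumulative R R :=
  HB.pack A (isCumulative.Build R _ R A nA cA).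

(** Replaces the usual condition on small families of disjoint intervals: slopes up to [K] go to the
    linear part, the remainder to [T], of total mass at most [e]. Right continuity of [T] makes it a
    Stieltjes function, so that the bound on increments transfers to measures. *)
Definition absolutely_continuous (A : R -> R) := forall e : R, 0 < e -> exists (K : R) (T : R -> R),
  [/\ 0 <= K, nondecreasing T, (forall x, T t @[t --> x^'+] --> T x),
      (forall x, 0 <= T x <= e) &
      forall x y, x < y -> A y - A x <= K * (y - x) + (T y - T x)].

(* For every e, the Stieltjes measure of A is dominated by K times the Lebesgue
   measure plus the Stieltjes measure of T, whose total mass is at most e; hence it
   is null on Lebesgue null sets. *)
Lemma density_nondecreasing (A : R -> R) (N : R) : 0 <= N -> nondecreasing A ->
  (forall x, A t @[t --> x^'+] --> A x) -> absolutely_continuous A ->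
  exists f : R -> R, mu.-integrable setT (EFin \o f) /\
    forall x y, - N <= x -> x <= y -> y <= N ->
      ((A y - A x)%:E = \int[mu]_(z in `]x, y]) (f z)%:E)%E.
Proof.
move=> N0 nA cA acA.
pose cAA := to_cumulative nA cA.
pose D := (`]- N, N]%classic : set (measurableTypeR R)).
have mD : measurable D by exact: measurable_itv.
have NN : - N <= N by lra.
have muD : (stieltjes cAA D < +oo)%E by rewrite stieltjes_itv// ltry.
pose nu := mfrestr mD muD.
have dom : nu `<< mu.
  apply/null_content_dominatesP => S mS muS.
  suff h e : 0 < e -> (nu S <= e%:E)%E.
    apply/eqP; rewrite eq_le measure_ge0 andbT; apply/lee_addgt0Pr => e e0.
    by rewrite add0e h.
  move=> e0; have [K [T [K0 nT cT Te AT]]] := acA e e0.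
  pose cTT := to_cumulative nT cT.
  have nC : nondecreasing (fun x => K * x) by move=> x y xy; rewrite ler_wpM2l.
  have cC : forall x, K * t @[t --> x^'+] --> K * x.
    apply: right_continuousW => x; apply: cvgM; [exact: cvg_cst|exact: cvg_id].
  pose cCC := to_cumulative nC cC.
  have nW : nondecreasing (fun x => K * x + T x) by move=> x y xy; rewrite lerD ?nC ?nT.
  have cW : forall x, K * t + T t @[t --> x^'+] --> K * x + T x.
    by move=> x; apply: cvgD; [exact: cC|exact: cT].
  pose cWW := to_cumulative nW cW.
  (* The gap between the bound and [A] is itself nondecreasing, so the bound on increments becomes
     an identity of Stieltjes measures, W = A + H, and domination on every measurable set follows
     from the nonnegativity of H. *)
  have nH : nondecreasing (fun x => K * x + T x - A x).
    move=> x y; rewrite (le_eqVlt x) => /predU1P[->//|xy].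
    by have := AT x y xy; lra.
  have cH : forall x, K * t + T t - A t @[t --> x^'+] --> K * x + T x - A x.
    by move=> x; apply: cvgB; [exact: cW|exact: cA].
  pose cHH := to_cumulative nH cH.
  have mSD : measurable (S `&` D) by exact: measurableI.
  have e1 : stieltjes cWW (S `&` D) = (stieltjes cAA (S `&` D) + stieltjes cHH (S `&` D))%E.
    by apply: stieltjes_add => // x /=; ring.
  have e2 : stieltjes cWW (S `&` D) = (stieltjes cCC (S `&` D) + stieltjes cTT (S `&` D))%E.
    exact: stieltjes_add.
  have e3 : stieltjes cCC (S `&` D) = 0%E.
    rewrite (@stieltjes_scale _ (NngNum K0))//.
    have -> : mu (S `&` D) = 0%E by apply: subset_measure0 muS => //; exact: subIsetl.
    by rewrite mule0.
  apply: (@le_trans _ _ (stieltjes cWW (S `&` D))).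
    by rewrite e1 leeDl// measure_ge0.
  rewrite e2 e3 add0e; apply: (@le_trans _ _ (stieltjes cTT D)).
    by apply: le_measure; rewrite ?inE//; exact: subIsetr.
  rewrite stieltjes_itv// lee_fin /=.
  by have /andP[_ h1] := Te N; have /andP[h2 _] := Te (- N); lra.
have [f [f0 ffin intf fE]] := radon_nikodym_sigma_finite dom.
have fineE : (EFin \o (fine \o f)) = f by apply/funext => x /=; rewrite fineK.
exists (fine \o f); split; first by rewrite fineE.
move=> x y Nx xy yN.
have -> : (\int[mu]_(z in `]x, y]) ((fine \o f) z)%:E = \int[mu]_(z in `]x, y]) f z)%E.
  by apply: eq_integral => z _; rewrite /= fineK.
rewrite -fE; last exact: measurable_itv.
rewrite /nu /= /mfrestr /mrestr (_ : _ `&` _ = `]x, y]%classic) ?stieltjes_itv//.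
apply/seteqP; split => z; rewrite /D /= ?in_itv /=; first by case.
by move=> /andP[xz zy]; split; rewrite ?in_itv /=; lra.
Qed.

End StieltjesDensity.

(** * Functions whose excess energies become small *)

Section Excess.
Context {R : realType}.
Implicit Types (x y a : R) (l : seq R) (F : R -> R).
Local Notation mu := (@lebesgue_measure R).

Definition excess (K r : R) := Num.max (`|r| - K) 0.
Definition excess_sub (K r : R) : R := if K < r then 1 else if r < - K then -1 else 0.

Lemma excess_ge0 K r : 0 <= excess K r.
Proof. by rewrite /excess le_max lexx orbT. Qed.

Lemma excess_ge K r : `|r| - K <= excess K r.
Proof. by rewrite /excess le_max lexx. Qed.

Lemma gauge_excess K : 0 <= K -> gauge (excess K) (excess_sub K).
Proof.
move=> K0; split.
- move=> r r'; rewrite /excess /excess_sub.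
  have h1 := ler_norm r'; have h2 := ler_norm (- r'); rewrite normrN in h2.
  case: ltP => [Kr|rK]; [|case: ltP => [rK'|rK']].
  + rewrite (@gtr0_norm _ r); last lra.
    rewrite le_max; apply/orP; left.
    by rewrite (_ : Num.max _ _ = r - K); [lra|apply/max_idPl; lra].
  + rewrite (@ltr0_norm _ r); last lra.
    rewrite le_max; apply/orP; left.
    by rewrite (_ : Num.max _ _ = - r - K); [lra|apply/max_idPl; lra].
  + rewrite mul0r addr0 (_ : Num.max (`|r| - K) 0 = 0); first by rewrite le_max lexx orbT.
    by apply/max_idPr; rewrite subr_le0 ler_norml rK'.
- by rewrite /excess normr0 sub0r; apply/max_idPr; rewrite oppr_le0.
- move=> r r' rr'; rewrite /excess ge_max !le_max lexx orbT andbT.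
  by apply/orP; left; rewrite lerD2r.
- by rewrite /excess_sub ltNge K0 /= oppr_gt0 ltNge K0.
Qed.

Lemma excess_le K K' r : K <= K' -> excess K r <= excess K' r + (K' - K).
Proof.
move=> KK'; rewrite {1}/excess ge_max addr_ge0 ?excess_ge0 ?subr_ge0// andbT.
by have := excess_ge K' r; lra.
Qed.

Lemma excess_anti K K' r : K <= K' -> excess K' r <= excess K r.
Proof.
by move=> KK'; rewrite {1}/excess ge_max excess_ge0 andbT; have := excess_ge K r; lra.
Qed.

Lemma energy_excess_anti F K K' e : K <= K' ->
  energy_le (excess K) F e -> energy_le (excess K') F e.
Proof.
move=> KK' h x l pl; apply: le_trans (h x l pl).
apply: ler_psum pl => a b ab; rewrite /energy_term ler_wpM2r ?excess_anti//.
by rewrite subr_ge0 ltW.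
Qed.

Lemma excess_term_norm F K x y : x < y ->
  `|F y - F x| <= K * (y - x) + energy_term (excess K) F x y.
Proof.
move=> xy; have yx0 : 0 < y - x by rewrite subr_gt0.
have := excess_ge K ((F y - F x) / (y - x)).
move=> /(ler_wpM2r (ltW yx0)); rewrite -/(energy_term _ _ _ _) normrM normfV (gtr0_norm yx0).
by rewrite mulrBl divfK ?gt_eqF//; lra.
Qed.

Section comparison.
Variables (F : R -> R) (K K' e e' : R).
Hypotheses (K0 : 0 <= K) (KK' : K <= K').
Hypotheses (hK : energy_le (excess K) F e) (hK' : energy_le (excess K') F e').
Local Notation T := (cumulative_energy (excess K) F).
Local Notation T' := (cumulative_energy (excess K') F).
Let K'0 : 0 <= K'. Proof. exact: le_trans KK'. Qed.

Lemma energy_excess_le x l : path <%R x l ->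
  energy (excess K) F x l <= energy (excess K') F x l + (K' - K) * (last x l - x).
Proof.
move=> pl; rewrite -psum_linear /energy -psumD; apply: ler_psum pl => a b ab.
by rewrite /energy_term -mulrDl ler_wpM2r ?excess_le// subr_ge0 ltW.
Qed.

(** Pointwise [excess K <= excess K' + (K' - K)]; the work is to localize this to the interval from
    [x] to [y], since [T y] involves partitions starting anywhere. A partition is cut at [x]: the
    part before is absorbed by [T x], and only the part after is compared. As [T'] is small for
    large [K'], this gives both the continuity and the absolute continuity of [T]. *)
Lemma cumulative_excess_le x y : x < y ->
  T y - T x <= (K' - K) * (y - x) + (T' y - T' x).
Proof.
move=> xy.
have gK := gauge_excess K0; have gK' := gauge_excess K'0.
have after l : path <%R x l -> last x l <= y ->
    energy (excess K) F x l <= (K' - K) * (y - x) + (T' y - T' x).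
  move=> pl ly; apply: le_trans (energy_excess_le pl) _.
  have h1 := cumulative_energy_path gK' hK' pl.
  have h2 := cumulative_energy_homo gK' hK' ly.
  have : (K' - K) * (last x l - x) <= (K' - K) * (y - x).
    by rewrite ler_wpM2l ?subr_ge0// lerD2r.
  lra.
have step l a : a <= x -> path <%R a l -> last a l <= y ->
    T a + energy (excess K) F a l <= T x + ((K' - K) * (y - x) + (T' y - T' x)).
  elim: l a => [|z l IH] a ax.
    move=> _ _; rewrite /energy /= addr0; apply: ler_wpDr.
      by have := after [::] isT (ltW xy); rewrite /energy /=.
    exact: (cumulative_energy_homo gK hK).
  move=> /= /andP[az zl] ly; rewrite /energy /= addrA.
  have [zx|xz] := leP z x.
    apply: le_trans (IH z zx zl ly); rewrite lerD2r.
    exact: (cumulative_energyD gK hK).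
  have h := after (z :: l); rewrite /= xz zl in h; have {}h := h isT ly.
  rewrite /energy /= in h.
  move: ax; rewrite (le_eqVlt a) => /predU1P[->|ax]; first by rewrite -addrA lerD2l.
  have h1 := energy_termD gK F ax xz.
  have h2 := cumulative_energyD gK hK ax.
  lra.
rewrite lerBlDl; apply: (cumulative_energy_le hK) => a l pl ly.
have [ax|xa] := leP a x.
  have := step l a ax pl ly.
  by have /andP[h0 _] := cumulative_energy_bounded hK a; lra.
have := after (a :: l); rewrite /= xa pl => /(_ isT ly); rewrite /energy /= => h.
have := energy_term_ge0 gK F xa.
by have /andP[h0 _] := cumulative_energy_bounded hK x; lra.
Qed.

End comparison.

(* The counterpart, on difference quotients, of the uniform integrability of F'. *)
Definition energy_ac F := forall e : R, 0 < e ->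
  exists2 K, 0 <= K & energy_le (excess K) F e.

Section density.
Variable F : R -> R.
Hypothesis acF : energy_ac F.

Lemma cumulative_excess_right_continuous K e : 0 <= K -> energy_le (excess K) F e ->
  forall x, cumulative_energy (excess K) F t @[t --> x^'+] -->
    cumulative_energy (excess K) F x.
Proof.
move=> K0 hK x; apply/cvgrPdist_le => d d0.
have d20 : 0 < d / 2 by rewrite divr_gt0.
have [K1 K10 hK1] := acF d20.
pose K' := Num.max K K1.
have KK' : K <= K' by rewrite le_max lexx.
have hK' : energy_le (excess K') F (d / 2).
  by apply: energy_excess_anti hK1; rewrite le_max lexx orbT.
have c0 : 0 < 2 * (K' - K + 1) by rewrite mulr_gt0// ltr_wpDl// subr_ge0.
near=> y.
have xy : x < y by near: y; exact: nbhs_right_gt.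
have yd : y < x + d / (2 * (K' - K + 1)).
  by near: y; apply: nbhs_right_lt; rewrite ltrDl divr_gt0.
have h := cumulative_excess_le K0 KK' hK hK' xy.
have /andP[h1 _] := cumulative_energy_bounded hK' x.
have /andP[_ h2] := cumulative_energy_bounded hK' y.
have h3 := cumulative_energy_homo (gauge_excess K0) hK (ltW xy).
rewrite distrC ger0_norm ?subr_ge0//.
have : (K' - K) * (y - x) <= d / 2.
  move: yd; rewrite -ltrBlDl ltr_pdivlMr// => yd.
  have : 0 < y - x by rewrite subr_gt0.
  nra.
lra.
Unshelve. all: by end_near. Qed.

Lemma energy_ac_continuous : continuous F.
Proof.
move=> x; apply/cvgrPdist_le => d d0.
have d20 : 0 < d / 2 by rewrite divr_gt0.
have [K K0 hK] := acF d20.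
have c0 : 0 < 2 * (K + 1) by rewrite mulr_gt0// ltr_wpDl.
have key a b : a < b -> b - a <= d / (2 * (K + 1)) -> `|F b - F a| <= d.
  move=> ab; rewrite ler_pdivlMr// => h.
  apply: le_trans (excess_term_norm F K ab) _.
  have := hK a [:: b]; rewrite /= ab /energy /= addr0 => /(_ isT).
  have : 0 < b - a by rewrite subr_gt0.
  nra.
near=> y.
have : `|x - y| < d / (2 * (K + 1)).
  by near: y; apply: cvgr_dist_lt => //; rewrite divr_gt0.
have [xy|xy|<-] := ltgtP x y; last by rewrite !subrr normr0 ltW.
  by rewrite distrC gtr0_norm ?subr_gt0// => /ltW/(key _ _ xy); rewrite distrC.
by rewrite gtr0_norm ?subr_gt0// => /ltW/(key _ _ xy).
Unshelve. all: by end_near. Qed.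

(** [F] is the difference of the nondecreasing functions [A1 = F + A2] and [A2]. The cumulative
    excess [T] only sees slopes beyond [K0]; the linear term in [A2] accounts for the others. The
    density depends on [N] here because the theorem of Radon and Nikodym is applied to a finite
    measure on a bounded interval. *)
Lemma energy_ac_density (N : R) : 0 <= N -> exists g : R -> R,
  mu.-integrable setT (EFin \o g) /\
  forall x y, - N <= x -> x <= y -> y <= N -> F y - F x = \int[mu]_(z in `]x, y]) g z.
Proof.
move=> N0; have [K0 K00 hK0] := acF (@ltr01 R).
pose T := cumulative_energy (excess K0) F.
have nT := cumulative_energy_homo (gauge_excess K00) hK0.
have cT := cumulative_excess_right_continuous K00 hK0.
pose A2 x := K0 * x + T x.
pose A1 x := F x + A2 x.
have FT x y : x < y -> `|F y - F x| <= K0 * (y - x) + (T y - T x).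
  move=> xy; apply: le_trans (excess_term_norm F K0 xy) _.
  by have := cumulative_energyD (gauge_excess K00) hK0 xy; rewrite -/T; lra.
have n2 : nondecreasing A2.
  by move=> x y xy; rewrite /A2 lerD ?nT// ler_wpM2l.
have n1 : nondecreasing A1.
  move=> x y; rewrite (le_eqVlt x) => /predU1P[->//|xy].
  by have := FT x y xy; rewrite /A1 /A2 ler_norml; lra.
have c2 x : A2 t @[t --> x^'+] --> A2 x.
  apply: cvgD; last exact: cT.
  apply: (right_continuousW (f := fun t => K0 * t)) => t.
  by apply: cvgM; [exact: cvg_cst|exact: cvg_id].
have c1 x : A1 t @[t --> x^'+] --> A1 x.
  by apply: cvgD; [exact: (right_continuousW energy_ac_continuous)|exact: c2].
have dom e : 0 < e -> exists (K : R) (T' : R -> R),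
  [/\ 0 <= K, nondecreasing T', (forall x, T' t @[t --> x^'+] --> T' x),
      (forall x, 0 <= T' x <= e) &
      forall x y, x < y -> A1 y - A1 x <= K * (y - x) + (T' y - T' x) /\
         A2 y - A2 x <= K * (y - x) + (T' y - T' x)].
  move=> e0; have e20 : 0 < e / 2 by rewrite divr_gt0.
  have [K1 K10 hK1] := acF e20.
  pose K := Num.max K0 K1.
  have KK : K0 <= K by rewrite le_max lexx.
  have KK0 : 0 <= K by exact: le_trans KK.
  have hK : energy_le (excess K) F (e / 2).
    by apply: energy_excess_anti hK1; rewrite le_max lexx orbT.
  pose T' := cumulative_energy (excess K) F.
  have nT' := cumulative_energy_homo (gauge_excess KK0) hK.
  (* The increments of [F] and of [A2] are each at most [K * (y - x) + (T' y - T' x)], so their sum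
     [A1] needs the factor 2; this is why the excess was made smaller than [e / 2]. *)
  exists (2 * K), (fun x => 2 * T' x); split.
  - by rewrite mulr_ge0.
  - by move=> x y xy; rewrite ler_wpM2l// nT'.
  - move=> x; apply: cvgM; first exact: cvg_cst.
    exact: cumulative_excess_right_continuous KK0 hK x.
  - by move=> x; have := cumulative_energy_bounded hK x; rewrite -/T'; lra.
  - move=> x y xy.
    have h1 := cumulative_excess_le K00 KK hK0 hK xy.
    have h2 := excess_term_norm F K xy.
    have h3 := cumulative_energyD (gauge_excess KK0) hK xy.
    have h4 := ler_norm (F y - F x).
    have h5 := nT' _ _ (ltW xy).
    have h6 : 0 <= K * (y - x) by rewrite mulr_ge0// subr_ge0 ltW.
    rewrite -/T -/T' in h1 h3 h5; rewrite /A1 /A2.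
    have h7 : K * (y - x) = K * y - K * x by ring.
    rewrite h7 in h2 h6; split; lra.
have ac1 : absolutely_continuous A1.
  move=> e /dom[K [T' [? ? ? ? h]]]; exists K, T'; split => // x y xy.
  by have [] := h x y xy.
have ac2 : absolutely_continuous A2.
  move=> e /dom[K [T' [? ? ? ? h]]]; exists K, T'; split => // x y xy.
  by have [] := h x y xy.
have [f1 [i1 E1]] := density_nondecreasing N0 n1 c1 ac1.
have [f2 [i2 E2]] := density_nondecreasing N0 n2 c2 ac2.
exists (fun x => f1 x - f2 x); split; first exact: integrableB_EFin.
move=> x y Nx xy yN.
rewrite RintegralB//; try by apply: integrableS i1 || apply: integrableS i2.
by rewrite /Rintegral -E1// -E2//= /A1; ring.
Qed.

End density.
End Excess.

(** * Recovering the derivative from difference quotients *)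

Section GlobalDensity.
Context {R : realType}.
Local Notation mu := (@lebesgue_measure R).
Implicit Types (F g : R -> R) (x y : R).

Definition diff_quotient F n x := n.+1%:R * (F (x + n.+1%:R^-1) - F x).

(** An upper limit is defined everywhere and measurable, and it refers to [F] alone. It therefore
    glues the local densities of [energy_ac_density], with which it agrees almost everywhere; an
    infinite upper limit is read as 0. *)
Definition density F x := fine (limn_esup (fun n => (diff_quotient F n x)%:E)).

Lemma density_cvg F x l : diff_quotient F ^~ x @ \oo --> l -> density F x = l.
Proof.
move=> h; have hE : (fun n => (diff_quotient F n x)%:E) @ \oo --> l%:E.
  by apply: cvg_EFin => //; exact: nearW.
rewrite /density is_cvg_limn_esupE; last by apply/cvg_ex; exists l%:E.
by rewrite (cvg_lim _ hE).
Qed.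

Lemma measurable_shift F h : measurable_fun setT F ->
  measurable_fun setT (fun x => F (x + h)).
Proof.
move=> mF; apply: (measurableT_comp mF).
by apply: measurable_funD; [exact: measurable_id|exact: measurable_cst].
Qed.

Lemma measurable_diff_quotient F n : measurable_fun setT F ->
  measurable_fun setT (diff_quotient F n).
Proof.
move=> mF; apply: measurable_funM; first exact: measurable_cst.
by apply: measurable_funB => //; exact: measurable_shift.
Qed.

Lemma measurable_density F : measurable_fun setT F -> measurable_fun setT (density F).
Proof.
move=> mF; apply: measurableT_comp => //.
apply: measurable_fun_limn_esup => n; apply/measurable_EFinP.
exact: measurable_diff_quotient.
Qed.

Lemma harmonic_dnbhs : (fun n => n.+1%:R^-1 : R) @ \oo --> (0 : R)^'.
Proof.
move=> P hP; have h := @cvg_harmonic R _ hP.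
suff : \forall n \near \oo, P (harmonic n) by [].
near=> n; have : harmonic n != 0 :> R -> P (harmonic n) by near: n; exact: h.
by apply; rewrite gt_eqF// harmonic_gt0.
Unshelve. all: by end_near. Qed.

Lemma is_derive_diff_quotient F x : derivable F x 1 ->
  diff_quotient F ^~ x @ \oo --> derive1 F x.
Proof.
move=> /cvg_ex[l hl]; rewrite derive1E (_ : 'D_1 F x = l); last exact: cvg_lim.
have := cvg_comp _ _ harmonic_dnbhs hl.
apply: cvg_trans; apply: near_eq_cvg; apply: nearW => n /=.
by rewrite invrK [n.+1%:R^-1%:A]mulr1 (addrC _ x).
Qed.

Lemma Rintegral_Ny_sub g x y : mu.-integrable setT (EFin \o g) -> x <= y ->
  \int[mu]_(z in `]-oo, y]) g z - \int[mu]_(z in `]-oo, x]) g z = \int[mu]_(z in `]x, y]) g z.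
Proof.
move=> ig xy; apply: Rintegral_itvB => //.
by apply: integrableS ig.
Qed.

Section local_density.
Variables (F g : R -> R) (N : R).
Hypothesis ig : mu.-integrable setT (EFin \o g).
Hypothesis gE : forall x y, - N <= x -> x <= y -> y <= N ->
  F y - F x = \int[mu]_(z in `]x, y]) g z.

(** On the interval, [F] differs by a constant from the primitive of [g] that starts at minus
    infinity, and that primitive is differentiable almost everywhere with derivative [g]. Strictness
    in [x < N] leaves room for [x + h]. *)
Lemma ae_diff_quotient_cvg :
  {ae mu, forall x, - N < x < N -> diff_quotient F ^~ x @ \oo --> g x}.
Proof.
have intf y : mu.-integrable `]-oo, y] (EFin \o g) by exact: integrableS ig.
have := FTC1Ny intf (open_integrable_locally openT ig).
apply: filterS; first exact: (ae_filter_ringOfSetsType mu).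
move=> x [dF dFE] /andP[Nx xN].
have := is_derive_diff_quotient dF; rewrite dFE.
apply: cvg_trans; apply: near_eq_cvg.
have xN0 : 0 < N - x by lra.
near=> n; rewrite /diff_quotient.
have hn : n.+1%:R^-1 < N - x.
  near: n; have /cvgrPdist_lt /(_ _ xN0) := @cvg_harmonic R.
  by apply: filterS => n; rewrite /harmonic /= sub0r normrN ger0_norm.
have h0 : 0 < n.+1%:R^-1 :> R by rewrite invr_gt0.
set h := n.+1%:R^-1 in hn h0 *.
have xh : x <= x + h by rewrite lerDl ltW.
by rewrite gE ?Rintegral_Ny_sub//; lra.
Unshelve. all: by end_near. Qed.

Lemma ae_density : {ae mu, forall x, - N < x < N -> density F x = g x}.
Proof.
apply: filterS ae_diff_quotient_cvg; first exact: (ae_filter_ringOfSetsType mu).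
by move=> x h /h /density_cvg.
Qed.

Lemma ae_diff_quotient_density :
  {ae mu, forall x, - N < x < N -> diff_quotient F ^~ x @ \oo --> density F x}.
Proof.
apply: filterS ae_diff_quotient_cvg; first exact: (ae_filter_ringOfSetsType mu).
by move=> x h /h hx; rewrite (density_cvg hx).
Qed.

End local_density.

Section absolutely_continuous_density.
Variable F : R -> R.
Hypothesis acF : energy_ac F.

Let cF : continuous F. Proof. exact: energy_ac_continuous. Qed.
Let mF : measurable_fun setT F. Proof. exact: continuous_measurable_fun. Qed.

Lemma density_integrable_itv (a b : R) :
  mu.-integrable `[a, b] (EFin \o density F).
Proof.
pose N := `|a| + `|b| + 1.
have N0 : 0 <= N by rewrite addr_ge0// addr_ge0.
have [g [ig gE]] := energy_ac_density acF N0.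
have igab : mu.-integrable `[a, b] (EFin \o g) by exact: integrableS ig.
have mab : measurable_fun `[a, b] (density F).
  by apply: measurable_funS (measurable_density mF).
apply/integrableP; split; first exact/measurable_EFinP.
have /integrableP[mg] := igab; apply: le_lt_trans.
rewrite le_eqVlt; apply/orP; left; apply/eqP.
apply: ge0_ae_eq_integral => //.
- by apply: measurableT_comp => //; exact/measurable_EFinP.
- exact: measurableT_comp.
- have := ae_density ig gE; apply: filterS; first exact: (ae_filter_ringOfSetsType mu).
  move=> x h; rewrite /= in_itv /= => /andP[ax xb]; rewrite h//.
  have := ler_norm a; have := ler_norm (- a); have := ler_norm b; have := ler_norm (- b).
  by rewrite !normrN /N => *; have := normr_ge0 a; have := normr_ge0 b; lra.
Qed.

Lemma density_integral x y : x <= y -> F y - F x = \int[mu]_(z in `]x, y]) density F z.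
Proof.
move=> xy; pose N := `|x| + `|y| + 1.
have N0 : 0 <= N by rewrite addr_ge0// addr_ge0.
have [g [ig gE]] := energy_ac_density acF N0.
have nx := ler_norm x; have nx' := ler_norm (- x).
have ny := ler_norm y; have ny' := ler_norm (- y).
rewrite !normrN in nx' ny'.
have nx0 := normr_ge0 x; have ny0 := normr_ge0 y.
rewrite gE; rewrite /N; try lra.
congr fine; apply: ae_eq_integral => //.
- by apply/measurable_EFinP; have /integrableP[/measurable_EFinP + _] := ig; apply: measurable_funS.
- by apply/measurable_EFinP; apply: measurable_funS (measurable_density mF).
- have := ae_density ig gE; apply: filterS; first exact: (ae_filter_ringOfSetsType mu).
  by move=> z h; rewrite /= in_itv /= => /andP[ax xb]; rewrite h// /N; lra.
Qed.

Lemma gauge_measurable (Phi s : R -> R) : gauge Phi s -> measurable_fun setT Phi.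
Proof.
case=> _ _ Pm _.
have nd : nondecreasing (fun r => Phi (Num.max r 0)).
  have m0 (r : R) : 0 <= Num.max r 0 by rewrite le_max lexx orbT.
  move=> r r' rr'; apply: Pm; rewrite !ger0_norm//.
  by rewrite ge_max m0 andbT le_max rr'.
have -> : Phi = (fun r => Phi (Num.max r 0)) \o (fun r => `|r|).
  apply/funext => r /=; rewrite (_ : Num.max `|r| 0 = `|r|); last by apply/max_idPl.
  by apply: le_anti; rewrite !Pm// normr_id.
by apply: measurableT_comp => //; exact: nondecreasing_measurable.
Qed.

Section energy_bound.
Variables (Phi s : R -> R) (E : R).
Hypothesis gPhi : gauge Phi s.
Hypothesis hE : energy_le Phi F E.

Let mPhi := gauge_measurable gPhi.

(* The difference quotient is dominated by that of the cumulative energy T, and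
   the integral of T (x + h) - T x over an interval telescopes. *)
Lemma diff_quotient_energy_le (N : R) n : 0 <= N ->
  (\int[mu]_(x in `](- N)%R, N]) (Phi (diff_quotient F n x))%:E <= E%:E)%E.
Proof.
move=> N0; set D := `]- N, N]%classic.
pose T := cumulative_energy Phi F.
have nT := cumulative_energy_homo gPhi hE.
have mT : measurable_fun setT T by apply: nondecreasing_measurable.
have T0 x : 0 <= T x by have /andP[] := cumulative_energy_bounded hE x.
have TE x : T x <= E by have /andP[] := cumulative_energy_bounded hE x.
pose h : R := n.+1%:R^-1.
have h0 : 0 < h by rewrite invr_gt0.
have mQ : measurable_fun setT (fun x => Phi (diff_quotient F n x)).
  by apply: measurableT_comp => //; exact: measurable_diff_quotient.
have key x : h * Phi (diff_quotient F n x) + T x <= T (x + h).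
  have xh : x < x + h by rewrite ltrDl.
  have := cumulative_energyD gPhi hE xh; rewrite -/T /energy_term.
  rewrite (_ : x + h - x = h); last ring.
  have -> : diff_quotient F n x = (F (x + h) - F x) / h by rewrite /diff_quotient /h invrK mulrC.
  lra.
have NN : - N <= N by lra.
have muD : (mu D < +oo)%E.
  by rewrite /D lebesgue_measure_itv /= lte_fin; case: ifP => _; rewrite -?EFinD ltry.
have iT : (\int[mu]_(x in D) (T x)%:E \is a fin_num)%E.
  apply/integrable_fin_num => //; first exact: measurable_itv.
  apply: (@measurable_bounded_integrable _ _ _ mu T D) => //; first exact: measurable_itv.
  - exact: measurable_funS mT.
  - by exists E; split; [exact: num_real|move=> x Ex y _ /=; rewrite ger0_norm// (le_trans (TE y))// ltW].
have mD : measurable D by exact: measurable_itv.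
have hQ0 x : 0 <= h * Phi (diff_quotient F n x) by rewrite mulr_ge0 ?(gauge_ge0 gPhi)// ltW.
suff : (h%:E * \int[mu]_(x in D) (Phi (diff_quotient F n x))%:E <= h%:E * E%:E)%E.
  by rewrite lee_pmul2l// lte_fin.
rewrite -ge0_integralZl//; first last.
- by rewrite lee_fin ltW.
- by move=> x _; rewrite lee_fin (gauge_ge0 gPhi).
- by apply/measurable_EFinP; exact: measurable_funS mQ.
suff : (\int[mu]_(x in D) (h%:E * (Phi (diff_quotient F n x))%:E) + \int[mu]_(x in D) (T x)%:E
    <= h%:E * E%:E + \int[mu]_(x in D) (T x)%:E)%E by rewrite leeD2rE.
rewrite -ge0_integralD//; first last.
- by apply/measurable_EFinP; exact: measurable_funS mT.
- by move=> x _; rewrite lee_fin.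
- apply/measurable_EFinP; apply: (measurable_funM (f := cst h)); first exact: measurable_cst.
  exact: measurable_funS mQ.
- by move=> x _; rewrite -EFinM lee_fin.
apply: (@le_trans _ _ (\int[mu]_(x in D) (T (x + h))%:E)%E).
  apply: ge0_le_integral => //.
  - by move=> x _; rewrite adde_ge0// lee_fin.
  - apply: emeasurable_funD.
      apply/measurable_EFinP; apply: (measurable_funM (f := cst h)); first exact: measurable_cst.
      exact: measurable_funS mQ.
    by apply/measurable_EFinP; exact: measurable_funS mT.
  - by apply/measurable_EFinP; apply: measurable_funS (measurable_shift h mT).
  - by move=> x _; rewrite -EFinM -EFinD lee_fin.
pose D' := `]- N + h, N + h]%classic.
have -> : (\int[mu]_(x in D) (T (x + h))%:E = \int[mu]_(x in D') (T x)%:E)%E.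
  rewrite -(@ge0_integral_shift _ h D' (fun x => (T x)%:E)); first last.
  - by move=> x; rewrite lee_fin.
  - by apply/measurable_EFinP; exact: measurable_funS mT.
  - exact: measurable_itv.
  congr (integral _ _ _); apply/seteqP.
  by split => z; rewrite /D /D' /= !in_itv /=; lra.
have DU : (\int[mu]_(x in D') (T x)%:E <= \int[mu]_(x in D `|` `]N, (N + h)%R]%classic) (T x)%:E)%E.
  apply: ge0_subset_integral => //.
  - exact: measurable_itv.
  - by apply: measurableU; exact: measurable_itv.
  - by apply/measurable_EFinP; exact: measurable_funS mT.
  - by move=> x _; rewrite lee_fin.
  - move=> z; rewrite /D /D' /= !in_itv /= => hz.
    by have [zN|Nz] := leP z N; [left|right]; lra.
apply: le_trans DU _.
rewrite ge0_integral_setU//; first last.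
- rewrite disj_set2E; apply/eqP; rewrite -subset0 => z [].
  by rewrite /D /= !in_itv /=; lra.
- by move=> x _; rewrite lee_fin.
- by apply/measurable_EFinP; exact: measurable_funS mT.
rewrite addeC leeD2r//.
have TC : (\int[mu]_(x in `]N, (N + h)%R]) (T x)%:E <= \int[mu]_(x in `]N, (N + h)%R]) (cst E%:E) x)%E.
  apply: ge0_le_integral => //.
  - by move=> x _; rewrite lee_fin.
  - by apply/measurable_EFinP; exact: measurable_funS mT.
  - by move=> x _; rewrite lee_fin.
apply: le_trans TC _.
rewrite integral_cst//= lebesgue_measure_itv /= lte_fin ltrDl h0 -EFinD -!EFinM lee_fin.
by rewrite (_ : N + h - N = h) 1?mulrC//; ring.
Qed.

(** Lower semicontinuity from the tangent at [r]: it lies below [Phi], and along [u] it converges to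
    [Phi r]. *)
Lemma gauge_le_liminf (u : nat -> R) r : u @ \oo --> r ->
  ((Phi r)%:E <= limn_einf (fun n => (Phi (u n))%:E))%E.
Proof.
move=> ur; case: (gPhi) => Ps _ _ _.
pose w n := (Phi r + s r * (u n - r))%:E.
have wr : w @ \oo --> (Phi r)%:E.
  apply: cvg_EFin; first exact: nearW.
  rewrite -[X in _ --> X]addr0; apply: cvgD; first exact: cvg_cst.
  rewrite -(mulr0 (s r)); apply: cvgM; first exact: cvg_cst.
  by rewrite -(subrr r); apply: cvgB => //; exact: cvg_cst.
have <- : limn_einf w = (Phi r)%:E.
  by rewrite is_cvg_limn_einfE ?(cvg_lim _ wr)//; apply/cvg_ex; exists (Phi r)%:E.
rewrite !limn_einf_lim; apply: lee_lim.
- exact: is_cvg_einfs.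
- exact: is_cvg_einfs.
apply: nearW => n; apply: le_ereal_inf_tmp => _ [m /= nm <-].
apply: (@le_trans _ _ (w m)); last by rewrite lee_fin.
by apply: ereal_inf_lbound; exists m.
Qed.

(** Fatou's lemma on each bounded window, where the difference quotients converge almost everywhere
    and obey the bound [E]; then the windows exhaust the line by monotone convergence. *)
Lemma density_energy_le : (\int[mu]_x (Phi (density F x))%:E <= E%:E)%E.
Proof.
have mQ n : measurable_fun setT (fun x => (Phi (diff_quotient F n x))%:E).
  apply/measurable_EFinP; apply: measurableT_comp => //.
  exact: measurable_diff_quotient.
have md : measurable_fun setT (fun x => (Phi (density F x))%:E).
  by apply/measurable_EFinP; apply: measurableT_comp => //; exact: measurable_density.
have bound (N : nat) : (\int[mu]_(x in `](- N%:R)%R, N%:R%R]) (Phi (density F x))%:E <= E%:E)%E.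
  (* The local density is taken on a window larger by one, so that the endpoint [N] is interior to
     the region of almost everywhere convergence. *)
  have N0 : 0 <= N.+1%:R :> R by [].
  have [g [ig gE]] := energy_ac_density acF N0.
  apply: (@le_trans _ _ (\int[mu]_(x in `](- N%:R)%R, N%:R%R])
      limn_einf (fun n => (Phi (diff_quotient F n x))%:E))%E).
    apply: ae_ge0_le_integral => //.
    - by move=> x _; rewrite lee_fin (gauge_ge0 gPhi).
    - exact: measurable_funS md.
    - move=> x _; rewrite limn_einf_lim; apply: lime_ge; first exact: is_cvg_einfs.
      apply: nearW => n; apply: le_ereal_inf_tmp => _ [m /= nm <-].
      by rewrite lee_fin (gauge_ge0 gPhi).
    - apply: (measurable_funS (E := setT)) => //.
      rewrite (_ : (fun x => _) = (fun x => - limn_esup (fun n => - (Phi (diff_quotient F n x))%:E))%E); last first.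
        apply/funext => x; rewrite -limn_einfN; congr limn_einf.
        by apply/funext => n; rewrite /= ?opprK ?oppeK.
      apply: measurableT_comp => //; apply: measurable_fun_limn_esup => n.
      apply/(measurable_EFinP _ (fun x => - Phi (diff_quotient F n x))).
      by apply: measurable_funN; apply/measurable_EFinP; exact: mQ.
    - have := ae_diff_quotient_density ig gE; apply: filterS; first exact: (ae_filter_ringOfSetsType mu).
      move=> x h; rewrite /= in_itv /= => /andP[ax xb]; apply: gauge_le_liminf; apply: h.
      by rewrite -natr1; lra.
  apply: (le_trans (@fatou _ _ _ mu `](- N%:R)%R, N%:R%R]%classic _
    (fun n x => (Phi (diff_quotient F n x))%:E) _ _)) => //.
  - by move=> n; exact: measurable_funS (mQ n).
  - by move=> n x _; rewrite lee_fin (gauge_ge0 gPhi).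
  rewrite limn_einf_lim; apply: lime_le; first exact: is_cvg_einfs.
  apply: nearW => n; apply: ereal_inf_le;
    exists (\int[mu]_(x in `](- N%:R)%R, N%:R%R]) (Phi (diff_quotient F n x))%:E)%E.
    by exists n => /=.
  exact: diff_quotient_energy_le.
have := @ge0_nondecreasing_set_cvg_integral _ (measurableTypeR R) _
  (fun N : nat => `](- N%:R), N%:R]%classic)
  (fun x => (Phi (density F x))%:E) mu.
rewrite bigcup_itvT => /(_ _ _ _ _)/(cvg_lim _) <- //.
- apply: lime_le; last by apply: nearW.
  apply: ereal_nondecreasing_is_cvgn.
  apply: ge0_nondecreasing_set_nondecreasing_integral => //.
  + by move=> m n mn; rewrite subsetEset; apply: subset_itv; rewrite bnd_simp ?lerN2 ler_nat.
  + by move=> n; exact: measurable_funS md.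
  + by move=> n x _; rewrite lee_fin (gauge_ge0 gPhi).
- by move=> m n mn; rewrite subsetEset; apply: subset_itv; rewrite bnd_simp ?lerN2 ler_nat.
- by move=> n; exact: measurable_funS md.
- by move=> n x _; rewrite lee_fin (gauge_ge0 gPhi).
Qed.

End energy_bound.
End absolutely_continuous_density.
End GlobalDensity.

Section TestFunctions.
Context {R : realType}.
Implicit Types (phi : R -> R) (x y a b : R).

Lemma derivable_continuous (f : R -> R) : (forall x, derivable f x 1) -> continuous f.
Proof. by move=> df x; apply: differentiable_continuous; apply/derivable1_diffP. Qed.

Lemma test_function_derivable phi : test_function phi ->
  forall x, derivable phi x 1.
Proof. by move=> [h _] x; exact: (h 0%N x). Qed.

Lemma test_function_continuous phi : test_function phi -> continuous phi.
Proof. by move=> h; apply: derivable_continuous; exact: test_function_derivable. Qed.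

Lemma test_function_derive1_continuous phi : test_function phi -> continuous (derive1 phi).
Proof. by move=> [h _]; apply: derivable_continuous => x; exact: (h 1%N x). Qed.

Lemma derive1_compact_support phi a b : (forall x, x < a \/ b < x -> phi x = 0) ->
  forall x, x < a \/ b < x -> derive1 phi x = 0.
Proof.
move=> h x hx; rewrite derive1E (@near_eq_derive _ _ _ _ (cst 0)) ?derive_cst//.
case: hx => hx.
  by near=> y; apply: h; left; near: y; exact: lt_nbhsl.
by near=> y; apply: h; right; near: y; exact: lt_nbhsr.
Unshelve. all: by end_near. Qed.

Lemma continuous_compact_support_bounded (f : R -> R) a b : continuous f ->
  (forall x, x < a \/ b < x -> f x = 0) -> exists2 C, 0 <= C & forall x, `|f x| <= C.
Proof.
move=> cf h; have [ab|ba] := leP a b; last first.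
  exists 0 => // x; rewrite h ?normr0//.
  by have [xa|ax] := ltP x a; [left|right; apply: lt_le_trans ax].
have cn : {within `[a, b], continuous (fun x => `|f x|)}.
  by apply: continuous_subspaceT => x; apply: cvg_norm; exact: cf.
have [c _ hc] := EVT_max ab cn; exists `|f c| => // x.
have [xa|ax] := ltP x a; first by rewrite h ?normr0//; left.
have [bx|xb] := ltP b x; first by rewrite h ?normr0//; right.
by apply: hc; rewrite in_itv /= ax.
Qed.

Lemma bounded_derive1_lipschitz (f : R -> R) C : (forall x, derivable f x 1) ->
  (forall x, `|derive1 f x| <= C) -> forall x y, `|f x - f y| <= C * `|x - y|.
Proof.
move=> df hC x y; wlog xy : x y / y <= x.
  by move=> h; have [/h//|/ltW/h] := leP y x; rewrite distrC (distrC y).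
have [||c _ ->] := @MVT_segment _ f (derive1 f) y x xy.
- by move=> z _; rewrite derive1E; apply: DeriveDef.
- by apply: continuous_subspaceT; exact: derivable_continuous.
by rewrite normrM ler_wpM2r.
Qed.

End TestFunctions.

(** * The density as a weak derivative *)

Section WeakDerivativeOfDensity.
Context {R : realType}.
Local Notation mu := (@lebesgue_measure R).
Implicit Types (F phi : R -> R) (x y a b : R).

Lemma bounded_integrable_itv (f : R -> R) (B a b : R) (l r : bool) : measurable_fun setT f ->
  (forall x, `|f x| <= B) ->
  mu.-integrable [set` Interval (BSide l a) (BSide r b)] (EFin \o f).
Proof.
move=> mf fB.
have muD : (mu [set` Interval (BSide l a) (BSide r b)] < +oo)%E.
  by rewrite lebesgue_measure_itv /= lte_fin; case: ifP => _; rewrite -?EFinD ltry.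
apply: measurable_bounded_integrable => //.
- exact: measurable_funS mf.
- by exists B; split; [exact: num_real|move=> x Bx y _ /=; rewrite (le_trans (fB y))// ltW].
Qed.

(** A slope of the product is at most [B * C1] plus [C0] times the slope of [F], so its excess over
    [B * C1 + C0 * K] is at most [C0] times the excess of the slope of [F] over [K]. This is what
    permits integration by parts against a test function. *)
Lemma energy_acM F phi (B C0 C1 : R) : energy_ac F -> 0 <= B -> (forall x, `|F x| <= B) ->
  0 <= C0 -> (forall x, `|phi x| <= C0) -> 0 <= C1 ->
  (forall x y, `|phi x - phi y| <= C1 * `|x - y|) ->
  energy_ac (fun x => F x * phi x).
Proof.
move=> acF B0 hB C00 hC0 C10 hC1 e e0.
have C0' : 0 < C0 + 1 by rewrite ltr_wpDl.
have eC : 0 < e / (C0 + 1) by rewrite divr_gt0.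
have [K K0 hK] := acF _ eC.
exists (B * C1 + C0 * K); first by rewrite addr_ge0 ?mulr_ge0.
move=> x l pl.
apply: (@le_trans _ _ (C0 * (e / (C0 + 1)))); last first.
  rewrite mulrA ler_pdivrMr// mulrC ler_wpM2l ?(ltW e0)//; lra.
apply: (@le_trans _ _ (C0 * energy (excess K) F x l)); last first.
  by rewrite ler_wpM2l// hK.
elim: l x pl => [|y l IH] x /=; first by rewrite /energy /= mulr0.
move=> /andP[xy /IH h]; rewrite /energy /= in h *; rewrite mulrDr lerD//.
have yx0 : 0 < y - x by rewrite subr_gt0.
rewrite /energy_term mulrA ler_wpM2r ?(ltW yx0)//.
have hex := excess_ge K ((F y - F x) / (y - x)).
rewrite {1}/excess ge_max; apply/andP; split; last by rewrite mulr_ge0// excess_ge0.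
suff : `|(F y * phi y - F x * phi x) / (y - x)| <= B * C1 + C0 * `|(F y - F x) / (y - x)|.
  by have := ler_wpM2l C00 hex; lra.
rewrite !normrM !normfV !(gtr0_norm yx0) mulrA -(ler_pM2r yx0) mulrDl !divfK ?gt_eqF//.
have -> : F y * phi y - F x * phi x = F y * (phi y - phi x) + phi x * (F y - F x) by ring.
apply: le_trans (ler_normD _ _) _; rewrite !normrM; apply: lerD; last by rewrite ler_wpM2r.
by rewrite -mulrA; apply: ler_pM => //; have := hC1 y x; rewrite (gtr0_norm yx0).
Qed.

(** The increment of [F * phi] across the support of [phi] vanishes, and it is also the integral of
    the density of [F * phi], which almost everywhere is given by the product rule for difference
    quotients. *)
Lemma weak_derivative_density F (B : R) : energy_ac F -> (forall x, `|F x| <= B) ->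
  weak_derivative F (density F).
Proof.
move=> acF FB.
have B0 : 0 <= B by exact: le_trans (FB 0).
have cF := energy_ac_continuous acF.
have mF : measurable_fun setT F by exact: continuous_measurable_fun.
have mg := measurable_density mF.
split; first by split => // a b; exact: bounded_integrable_itv FB.
split; first by split => // a b; exact: density_integrable_itv.
move=> phi tphi; have [_ [a0 [b0 sphi]]] := tphi.
have dphi := test_function_derivable tphi.
have cphi := test_function_continuous tphi.
have cphi' := test_function_derive1_continuous tphi.
have sphi' := derive1_compact_support sphi.
have [C0 C00 hC0] := continuous_compact_support_bounded cphi sphi.
have [C1 C10 hC1] := continuous_compact_support_bounded cphi' sphi'.
have lphi := bounded_derive1_lipschitz dphi hC1.
pose G x := F x * phi x.
have acG : energy_ac G by exact: (energy_acM acF B0 FB C00 hC0 C10 lphi).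
pose N := `|a0| + `|b0| + 1.
have N0 : 0 <= N by rewrite addr_ge0// addr_ge0.
have na := ler_norm a0; have na' := ler_norm (- a0).
have nb := ler_norm b0; have nb' := ler_norm (- b0).
rewrite !normrN in na' nb'.
have na0 := normr_ge0 a0; have nb0 := normr_ge0 b0.
pose D := (`](- N), N]%classic : set (measurableTypeR R)).
have mD : measurable D by exact: measurable_itv.
have out x : ~ D x -> x < a0 \/ b0 < x.
  rewrite /D /= in_itv /= => /negP; rewrite negb_and -leNgt -ltNge => /orP[h|h]; [left|right].
    by apply: le_lt_trans h _; rewrite /N; lra.
  by apply: lt_trans h; rewrite /N; lra.
have phiN : phi (- N) = 0 by apply: sphi; left; rewrite /N; lra.
have phiN' : phi N = 0 by apply: sphi; right; rewrite /N; lra.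
have NN : - N <= N by lra.
have iF : mu.-integrable D (EFin \o (fun x => F x * derive1 phi x)).
  apply: (@bounded_integrable_itv _ (B * C1)).
    by apply: measurable_funM => //; exact: continuous_measurable_fun.
  by move=> x; rewrite normrM ler_pM.
have ig : mu.-integrable D (EFin \o (fun x => density F x * phi x)).
  have i0 : mu.-integrable D (EFin \o density F).
    by apply: integrableS (density_integrable_itv acF (- N) N) => //; exact: subset_itv_oc_cc.
  have iC := integrableZl_EFin C0 mD i0.
  apply: le_integrable iC => //.
    apply/measurable_EFinP; apply: measurable_funM; first exact: measurable_funS mg.
    by apply: measurable_funTS; exact: continuous_measurable_fun.
  move=> x _ /=; rewrite lee_fin !normrM mulrC (ger0_norm C00).
  by rewrite ler_wpM2r.
have key : \int[mu]_(x in D) (F x * derive1 phi x) + \int[mu]_(x in D) (density F x * phi x) = 0.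
  rewrite -RintegralD//.
  have : G N - G (- N) = 0 by rewrite /G phiN phiN' !mulr0 subr0.
  rewrite (density_integral acG NN) => <-.
  congr fine; apply: ae_eq_integral => //.
  - by apply/measurable_EFinP; have /integrableP[/measurable_EFinP + _] := integrableD_EFin mD iF ig.
  - apply/measurable_EFinP; apply: measurable_funTS; apply: measurable_density.
    apply: continuous_measurable_fun; exact: energy_ac_continuous acG.
  have N10 : 0 <= N + 1 by lra.
  have [g [ig' gE]] := energy_ac_density acF N10.
  have := ae_diff_quotient_density ig' gE.
  apply: filterS; first exact: (ae_filter_ringOfSetsType mu).
  move=> x h; rewrite /D /= in_itv /= => /andP[Nx xN]; congr EFin; apply/esym.
  have {}h : diff_quotient F ^~ x @ \oo --> density F x by apply: h; lra.
  apply: density_cvg.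
  have -> : diff_quotient G ^~ x = (fun n => F (x + n.+1%:R^-1) * diff_quotient phi n x +
      diff_quotient F n x * phi x).
    by apply/funext => n; rewrite /diff_quotient /G; ring.
  apply: cvgD; last by apply: cvgM => //; exact: cvg_cst.
  apply: cvgM; last exact: is_derive_diff_quotient.
  have hx : (fun n : nat => x + n.+1%:R^-1) @ \oo --> x.
    by rewrite -[X in _ --> X]addr0; apply: cvgD; [exact: cvg_cst|exact: cvg_harmonic].
  exact: (cvg_comp _ _ hx (cF x)).
have restr (f : R -> R) : (forall x, ~ D x -> f x = 0) -> mu.-integrable D (EFin \o f) ->
    (\int[mu]_x (f x)%:E = (\int[mu]_(x in D) f x)%:E)%E.
  move=> f0 iDf; rewrite /Rintegral fineK; last exact: integrable_fin_num.
  rewrite [RHS]integral_mkcond.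
  apply: eq_integral => x _; rewrite patchE; case: ifPn => // xD.
  by rewrite f0//; apply: contraNnot xD => ?; rewrite inE.
rewrite (restr _ _ iF); last by move=> x /out/sphi' ->; rewrite mulr0.
rewrite (restr _ _ ig); last by move=> x /out/sphi ->; rewrite mulr0.
by rewrite -EFinN; congr EFin; apply/eqP; rewrite -addr_eq0 key.
Qed.

End WeakDerivativeOfDensity.

(** * The L^p bound *)

Section StrongType.
Context {R : realType}.
Local Notation mu := (@lebesgue_measure R).
Implicit Types (x y z t r : R).

Lemma nneseries_le_partial (u : nat -> \bar R) (M : \bar R) : (forall k, 0 <= u k)%E ->
  (forall n, \sum_(0 <= k < n) u k <= M)%E -> (\sum_(0 <= k <oo) u k <= M)%E.
Proof.
move=> u0 hM; apply: lime_le; first by apply: is_cvg_nneseries => k _ _; exact: u0.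
by apply: nearW => n; exact: hM.
Qed.

Lemma term_le_nneseries (u : nat -> \bar R) k : (forall k, 0 <= u k)%E ->
  (u k <= \sum_(0 <= k <oo) u k)%E.
Proof.
move=> u0; apply: le_trans (nneseries_lim_ge k.+1 _); last by move=> n _ _; exact: u0.
by rewrite big_nat_recr//= leeDr// sume_ge0.
Qed.

Lemma sum_half_le (a : R) n : 0 <= a -> \sum_(0 <= k < n) a * 2^-1 ^+ k <= 2 * a.
Proof.
move=> a0; suff -> : \sum_(0 <= k < n) a * 2^-1 ^+ k = 2 * a - 2 * a * 2^-1 ^+ n.
  by rewrite gerBl !mulr_ge0// exprn_ge0.
elim: n => [|n IH]; first by rewrite big_nil expr0; ring.
by rewrite big_nat_recr//= IH exprS; field.
Qed.

Lemma ge0_integral_indicM (v : R -> R) (A : set R) :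
  (\int[mu]_z (\1_A z * v z)%:E = \int[mu]_(z in A) (v z)%:E)%E.
Proof.
rewrite [RHS]integral_mkcond; apply: eq_integral => z _.
by rewrite patchE indicE; case: ifPn => _; rewrite ?mul1r// mul0r.
Qed.

Variables (v : R -> R) (B alpha : R).
Hypothesis mv : measurable_fun setT v.
Hypothesis v0 : forall x, 0 <= v x.
Hypothesis vB : forall x, v x <= B.
Hypothesis alpha0 : 0 <= alpha.

Local Notation C0 := (16 * (1 + alpha) / pi).

Let pi0 : 0 < pi :> R. Proof. exact: pi_gt0. Qed.

(** The least [k] with [|w| < 2 ^+ k * t] is taken. Minimality bounds [|w|] from below by
    [2 ^+ (k - 1) * t] when [k > 0], hence the factor 4; for [k = 0] the maximum of the kernel, 1 /
    (pi t), suffices. *)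
Lemma dyadic_scale (w t : R) : 0 < t -> exists k : nat,
  `|w| < 2 ^+ k * t /\ poisson w t <= 4 / (pi * t * 4 ^+ k).
Proof.
move=> t0; have hex : exists k : nat, `|w| < 2 ^+ k * t.
  exists (Num.truncn (`|w| / t)).+1; rewrite -ltr_pdivrMr//.
  apply: lt_le_trans (truncnS_gt _) _; rewrite -natrX ler_nat ltnW//.
  exact: ltn_expl.
case: (ex_minnP hex) => k hk kmin; exists k; split => //.
have w2 : 0 <= w ^+ 2 by exact: sqr_ge0.
have key (q : R) : 0 < q -> q * t ^+ 2 <= w ^+ 2 + t ^+ 2 -> poisson w t <= (pi * t * q)^-1.
  move=> q0 hq; rewrite /poisson.
  have -> : (pi * t * q)^-1 = pi^-1 * (t / (q * t ^+ 2)) by move: (pi : R) pi0 => p p0; field; rewrite !gt_eqF.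
  rewrite ler_wpM2l ?invr_ge0 ?(ltW pi0)// ler_wpM2l ?(ltW t0)// lef_pV2 ?posrE//.
    by rewrite ltr_wpDl// exprn_gt0.
  by rewrite mulr_gt0// exprn_gt0.
case: k hk kmin => [|k] hk kmin.
  apply: le_trans (key 1 ltr01 _) _; first by rewrite mul1r lerDr.
  rewrite expr0 !mulr1 ler_peMl ?invr_ge0 ?mulr_ge0 ?(ltW t0) ?(ltW pi0)//; lra.
have wk : 2 ^+ k * t <= `|w|.
  by rewrite leNgt; apply/negP => /kmin; rewrite ltnn.
have -> : 4 / (pi * t * 4 ^+ k.+1) = (pi * t * 4 ^+ k)^-1.
  by rewrite exprS; move: (pi : R) pi0 => p p0; field; rewrite !gt_eqF// exprn_gt0.
apply: key; first by rewrite exprn_gt0.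
apply: (@le_trans _ _ (w ^+ 2)); last by rewrite lerDl sqr_ge0.
rewrite -(real_normK (num_real w)) (_ : 4 ^+ k * t ^+ 2 = (2 ^+ k * t) ^+ 2); last first.
  by rewrite exprMn -exprM mulnC exprM (_ : 2 ^+ 2 = 4 :> R)//; ring.
by rewrite ler_pXn2r ?nnegrE// mulr_ge0 ?exprn_ge0// ltW.
Qed.

(** The kernel is dominated by multiples of indicators of balls. They are centred at [x], not at
    [y], at the price of the radii [(2 ^+ k + alpha) * t]. The k-th ball contributes at most
    [8 * (1 + alpha) / pi * lam * 2^-1 ^+ k], and the geometric sum gives the constant 16 in
    [C0]. *)
Lemma nontangential_le_averages x lam : 0 <= lam ->
  (forall r, 0 < r -> (\int[mu]_(z in ball x r) (v z)%:E <= (lam * (2 * r))%:E)%E) ->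
  nontangential v alpha x <= C0 * lam.
Proof.
move=> lam0 hav; apply: (nontangential_le mv v0 vB alpha0) => t y t0 yx.
pose r k : R := (2 ^+ k + alpha) * t.
pose c k : R := 4 / (pi * t * 4 ^+ k).
have r0 k : 0 < r k by rewrite mulr_gt0// ltr_wpDr// exprn_gt0.
have c0 k : 0 <= c k by rewrite divr_ge0// !mulr_ge0 ?exprn_ge0// ltW.
rewrite -lee_fin (pext_EFin mv v0 vB)//.
pose g k z := ((c k)%:E * (\1_(ball x (r k)) z * v z)%:E)%E.
have mg k : measurable_fun setT (fun z => (\1_(ball x (r k)) z * v z)%:E).
  by apply/measurable_EFinP; apply: measurable_funM => //; apply: measurable_indic; exact: measurable_ball.
have i0 k z : 0 <= \1_(ball x (r k)) z * v z by rewrite mulr_ge0// indicE.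
have g0 k z : (0 <= g k z)%E by rewrite mule_ge0// lee_fin.
have mg' k : measurable_fun setT (g k) by apply: measurable_funeM.
have h1 : (\int[mu]_z (poisson (y - z) t * v z)%:E <= \int[mu]_z \sum_(0 <= k <oo) g k z)%E.
  apply: ge0_le_integral => //.
  - by move=> z _; rewrite lee_fin mulr_ge0 ?poisson_ge0.
  - apply/measurable_EFinP; apply: measurable_funM => //.
    by apply: (@measurable_reflect _ (fun w => poisson w t)); exact: measurable_poisson.
  - exact: (@ge0_emeasurable_sum _ _ _ _ g xpredT).
  move=> z _; have [k [hk hP]] := dyadic_scale (y - z) t0.
  apply: le_trans (term_le_nneseries k _) => //.
  rewrite /g -EFinM lee_fin indicE mem_set ?mul1r.
    by rewrite ler_wpM2r.
  rewrite /ball /= /r mulrDl.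
  have -> : x - z = (y - z) - (y - x) by ring.
  by apply: le_lt_trans (ler_normB _ _) _; apply: ltr_leD.
apply: le_trans h1 _; rewrite integral_nneseries//.
apply: nneseries_le_partial => [k|n]; first by apply: integral_ge0.
apply: (@le_trans _ _ (\sum_(0 <= k < n) (8 * (1 + alpha) / pi * lam * 2^-1 ^+ k)%:E)%E).
  apply: lee_sum => k _; rewrite /g ge0_integralZl//; last 3 first.
  - exact: mg.
  - by move=> z _; rewrite lee_fin.
  - by rewrite lee_fin.
  rewrite ge0_integral_indicM.
  apply: le_trans (lee_wpmul2l _ (hav _ (r0 k))) _; first by rewrite lee_fin.
  rewrite -EFinM lee_fin /c /r.
  have -> : 4 / (pi * t * 4 ^+ k) * (lam * (2 * ((2 ^+ k + alpha) * t))) =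
      8 * ((2 ^+ k + alpha) / 4 ^+ k) / pi * lam.
    by move: (pi : R) pi0 => p p0; field; rewrite !gt_eqF// exprn_gt0.
  have -> : 8 * (1 + alpha) / pi * lam * 2^-1 ^+ k = 8 * ((1 + alpha) / 2 ^+ k) / pi * lam.
    by rewrite exprVn; move: (pi : R) pi0 => p p0; field; rewrite !gt_eqF// exprn_gt0.
  rewrite ler_wpM2r// ler_wpM2r ?invr_ge0 ?(ltW pi0)// ler_wpM2l//.
  have k0 : 0 < 2 ^+ k :> R by rewrite exprn_gt0.
  have k1 : 1 <= 2 ^+ k :> R by rewrite exprn_ege1// ler1n.
  have -> : 4 ^+ k = 2 ^+ k * 2 ^+ k :> R by rewrite -exprMn (_ : 2 * 2 = 4 :> R)//; ring.
  have ha : alpha <= alpha * 2 ^+ k by rewrite ler_peMr.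
  rewrite ler_pdivrMr ?mulr_gt0// mulrA divfK ?gt_eqF//; lra.
rewrite sumEFin lee_fin; apply: le_trans (sum_half_le _ _) _.
  by rewrite !mulr_ge0// ?invr_ge0 ?(ltW pi0)// addr_ge0.
by move: (pi : R) pi0 => p p0; rewrite le_eqVlt; apply/orP; left; apply/eqP; field; rewrite gt_eqF.
Qed.

Lemma average_ball_gt x c : 0 <= c -> C0 * c < nontangential v alpha x ->
  exists2 r, 0 < r & ((c * (2 * r))%:E < \int[mu]_(z in ball x r) (v z)%:E)%E.
Proof.
move=> c0 hc; apply: contrapT => hn.
move: hc; rewrite ltNge => /negP; apply; apply: nontangential_le_averages => // r r0.
by rewrite leNgt; apply/negP => h; apply: hn; exists r.
Qed.

(** The maximal inequality is applied to [v] truncated to the set where it exceeds [c / 2]: the rest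
    contributes at most [c / 2] to any average, so an average of [v] above [c] leaves more than
    [c / 2] to the truncation. The integral over this set, instead of the whole line, is what can be
    summed over the levels when p > 1. *)
Lemma weak_type (c : R) : 0 < c -> measurable_fun setT (nontangential v alpha) ->
  (mu [set x | (C0 * c < nontangential v alpha x)%R] <=
   (6 / c)%:E * \int[mu]_(z in [set z | (c / 2 < v z)%R]) (v z)%:E)%E.
Proof.
move=> c0 mN; set S := [set z | (c / 2 < v z)%R].
have c20 : 0 < c / 2 by rewrite divr_gt0.
have mS : measurable S.
  by rewrite /S -[X in measurable X]setTI; apply: measurable_fun_ltr => //; exact: measurable_cst.
pose v1 z := \1_S z * v z.
have mv1 : measurable_fun setT v1 by apply: measurable_funM => //; exact: measurable_indic.
have v10 z : 0 <= v1 z by rewrite /v1 mulr_ge0// indicE.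
have v1v z : v1 z <= v z by rewrite /v1 indicE; case: (_ \in _); rewrite ?mul1r// mul0r.
have l1 : locally_integrable setT v1.
  split => //; first exact: openT.
  move=> K _ cK; have mK := compact_measurable cK.
  apply: (@le_lt_trans _ _ (\int[mu]_(x in K) (cst B%:E) x)%E).
    apply: ge0_le_integral => //.
    - by apply/measurable_EFinP; apply: measurableT_comp => //; exact: measurable_funS mv1.
    - by move=> z _; rewrite lee_fin ger0_norm// (le_trans (v1v z)).
  rewrite integral_cst// lte_mul_pinfty//; first by rewrite lee_fin (le_trans (v0 0)).
  exact: compact_finite_measure.
have sub : [set x | (C0 * c < nontangential v alpha x)%R] `<=`
    [set x | ((c / 2)%:E < HL_maximal v1 x)%E].
  move=> x /= /(average_ball_gt (ltW c0))[r r0 hr].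
  apply: (@lt_le_trans _ _ (iavg v1 (ball x r))); last first.
    by apply: ereal_sup_ubound; exists r => //=; rewrite in_itv /= r0.
  rewrite /iavg.
  have mb : measurable (ball x r) by exact: measurable_ball.
  have mub : mu (ball x r) = (r *+ 2)%:E by rewrite lebesgue_measure_ball// ltW.
  rewrite mub inver; case: ifPn => [|_]; first by rewrite mulrn_eq0 /= gt_eqF.
  have hle : (\int[mu]_(z in ball x r) (v z)%:E <=
      \int[mu]_(z in ball x r) `|(v1 z)%:E| + (c / 2 * (2 * r))%:E)%E.
    have -> : (c / 2 * (2 * r))%:E = (\int[mu]_(z in ball x r) (cst (c / 2)%:E) z)%E.
      by rewrite integral_cst//= lebesgue_measure_ball ?(ltW r0)// -EFinM mulr2n; congr EFin; ring.
    rewrite -ge0_integralD//; last 2 first.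
    - by apply/measurable_EFinP; apply: measurableT_comp => //; exact: measurable_funS mv1.
    - by move=> z _; rewrite lee_fin ltW.
    apply: ge0_le_integral => //.
    - by move=> z _; rewrite lee_fin.
    - by apply/measurable_EFinP; exact: measurable_funS mv.
    - apply: emeasurable_funD => //.
      by apply/measurable_EFinP; apply: measurableT_comp => //; exact: measurable_funS mv1.
    move=> z _; rewrite /= -EFinD lee_fin ger0_norm// /v1 indicE.
    have [zS|zS] := boolP (z \in S); first by rewrite mul1r lerDl ltW.
    rewrite mul0r add0r leNgt; apply: contra zS => h.
    by rewrite inE.
  have := lt_le_trans hr hle.
  set I := (\int[mu]_(z in _) _)%E.
  have I0 : (0 <= I)%E by apply: integral_ge0.
  move: I I0 => [i|_|//] _; last by rewrite mulry gtr0_sg ?mul1e ?ltry// invr_gt0 mulrn_wgt0.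
  rewrite -EFinD -EFinM !lte_fin => h.
  by rewrite (mulrC _ i) ltr_pdivlMr ?mulrn_wgt0//
    (_ : c / 2 * (r *+ 2) = c * (2 * r) - c / 2 * (2 * r)) ?ltrBlDr//; field.
apply: (@le_trans _ _ (mu [set x | ((c / 2)%:E < HL_maximal v1 x)%E])).
  apply: le_measure => //; rewrite inE.
  - by rewrite -[X in measurable X]setTI; apply: measurable_fun_ltr => //; exact: measurable_cst.
  - rewrite -[X in measurable X]setTI; apply: emeasurable_fun_o_infty => //.
    exact: measurable_HL_maximal.
apply: le_trans (maximal_inequality l1 c20) _.
rewrite (_ : 3 / (c / 2) = 6 / c); last by field; rewrite gt_eqF.
rewrite le_eqVlt; apply/orP; left; apply/eqP; congr (_ * _)%E.
rewrite -ge0_integral_indicM; apply: eq_integral => z _.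
by rewrite /= ger0_norm.
Qed.

End StrongType.

(** * Strong type bound by summing over dyadic levels *)

Section LpBound.
Context {R : realType}.
Local Notation mu := (@lebesgue_measure R).
Implicit Types (x y z t r : R).

(** The bound is independent of [n] and of the size of [b]: terms above [beta] are discarded, and
    from the first one below it the sum is geometric. *)
Lemma truncated_geometric_le (q beta : R) n (b : R) : 0 <= q -> q < 1 -> 0 <= beta -> 0 <= b ->
  \sum_(0 <= k < n) (if b * q ^+ k <= beta then b * q ^+ k else 0) <= beta / (1 - q).
Proof.
move=> q0 q1 beta0; have q1' : 0 < 1 - q by rewrite subr_gt0.
elim: n b => [|n IH] b b0; first by rewrite big_nil divr_ge0// ltW.
have [bb|bb] := leP b beta; last first.
  rewrite big_nat_recl// expr0 mulr1 ifN -?ltNge// add0r.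
  apply: le_trans (IH (b * q) (mulr_ge0 b0 q0)).
  by rewrite le_eqVlt; apply/orP; left; apply/eqP; apply: eq_bigr => k _; rewrite exprS mulrA.
apply: (@le_trans _ _ (\sum_(0 <= k < n.+1) b * q ^+ k)).
  by apply: ler_sum => k _; case: ifP => // _; rewrite mulr_ge0// exprn_ge0.
rewrite -mulr_sumr; apply: ler_pM => //.
  by apply: sumr_ge0 => k _; rewrite exprn_ge0.
have := subrX1 q n.+1; rewrite -(big_mkord xpredT (fun i => q ^+ i)) => h.
rewrite -div1r ler_pdivlMr//.
have : 0 <= q ^+ n.+1 by rewrite exprn_ge0.
move: h; set S := \sum_(_ <= _ < _) _ => h h2.
have -> : S * (1 - q) = - ((q - 1) * S) by ring.
by rewrite -h; lra.
Qed.

Variables (v : R -> R) (B alpha p : R).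
Hypothesis mv : measurable_fun setT v.
Hypothesis v0 : forall x, 0 <= v x.
Hypothesis vB : forall x, v x <= B.
Hypothesis alpha0 : 0 <= alpha.
Hypothesis p1 : 1 < p.

Local Notation C0 := (16 * (1 + alpha) / pi).

Lemma nontangential_powR_integrable :
  measurable_fun setT (nontangential v alpha) ->
  (\int[mu]_z (v z `^ p)%:E < +oo)%E ->
  (\int[mu]_x (nontangential v alpha x `^ p)%:E < +oo)%E.
Proof.
move=> mN hv; set N := nontangential v alpha.
have B0 : 0 <= B := le_trans (v0 0) (vB 0).
have N0B x : 0 <= N x <= B by exact: (nontangential_bounded mv v0 vB alpha0).
have C00 : 0 < C0 by rewrite divr_gt0 ?pi_gt0// mulr_gt0// ltr_pwDl.
have p0 : 0 < p by rewrite (lt_trans ltr01).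
have q0 : 0 < p - 1 by rewrite subr_gt0.
(* The levels start above the bound [B] of the maximal function and decrease to 0, so every positive
   value lies between two consecutive ones. *)
pose a k : R := (B + 1) * 2^-1 ^+ k.
have a0 k : 0 < a k by rewrite mulr_gt0 ?exprn_gt0// ltr_pwDr.
have aS k : a k.+1 = a k / 2 by rewrite /a exprS; field.
pose A k : set R := [set x | a k.+1 < N x].
have mA k : measurable (A k).
  by rewrite /A -[X in measurable X]setTI; apply: measurable_fun_ltr => //; exact: measurable_cst.
pose g k x : \bar R := ((a k `^ p)%:E * (\1_(A k) x)%:E)%E.
have g0 k x : (0 <= g k x)%E by rewrite mule_ge0// lee_fin ?powR_ge0// indicE.
have mg k : measurable_fun setT (g k).
  by apply: measurable_funeM; apply/measurable_EFinP; exact: measurable_indic.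
have h1 : (\int[mu]_x (N x `^ p)%:E <= \int[mu]_x \sum_(0 <= k <oo) g k x)%E.
  apply: ge0_le_integral => //.
  - by move=> x _; rewrite lee_fin powR_ge0.
  - by apply/measurable_EFinP; apply: (measurableT_comp (measurable_powR p)).
  - exact: (@ge0_emeasurable_sum _ _ _ _ g xpredT).
  move=> x _; have /andP[Nx0 NxB] := N0B x.
  have [->|Nx] := eqVneq (N x) 0.
    by rewrite powR0 ?gt_eqF//; apply: nneseries_ge0 => k _ _; exact: g0.
  have {Nx}Nx0' : 0 < N x by rewrite lt_neqAle eq_sym Nx.
  have hex : exists k, a k.+1 < N x.
    exists (Num.truncn ((B + 1) / N x)).+1.
    rewrite /a exprVn ltr_pdivrMr ?exprn_gt0// mulrC -ltr_pdivrMr//.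
    apply: lt_le_trans (truncnS_gt _) _; rewrite -natrX ler_nat ltnW//.
    by apply: ltn_trans (ltn_expl _ _) => //; rewrite ltnS.
  case: (ex_minnP hex) => k hk kmin.
  apply: le_trans (term_le_nneseries k _) => //.
  rewrite /g -EFinM lee_fin indicE mem_set// mulr1.
  rewrite ge0_ler_powR ?nnegrE// ?(ltW p0)// ?(ltW (a0 _))//.
  case: k hk kmin => [|k] hk kmin; first by rewrite /a expr0 mulr1; lra.
  by rewrite leNgt; apply/negP => /kmin; rewrite ltnn.
apply: le_lt_trans h1 _; rewrite integral_nneseries//.
pose c k := a k.+1 / C0.
have c0 k : 0 < c k by rewrite divr_gt0.
pose S k : set R := [set z | c k / 2 < v z].
have mS k : measurable (S k).
  by rewrite /S -[X in measurable X]setTI; apply: measurable_fun_ltr => //; exact: measurable_cst.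
pose h k z : \bar R := ((a k `^ p * (6 / c k))%:E * (\1_(S k) z * v z)%:E)%E.
have d0 k : 0 <= a k `^ p * (6 / c k) by rewrite mulr_ge0 ?powR_ge0// divr_ge0// ltW.
have h0 k z : (0 <= h k z)%E by rewrite mule_ge0// lee_fin// mulr_ge0// indicE.
have mh' k : measurable_fun setT (fun z => (\1_(S k) z * v z)%:E).
  by apply/measurable_EFinP; apply: measurable_funM => //; exact: measurable_indic.
have mh k : measurable_fun setT (h k) by apply: measurable_funeM.
have gh k : (\int[mu]_x g k x <= \int[mu]_x h k x)%E.
  rewrite /g /h ge0_integralZl//; last 2 first.
  - by have /measurable_EFinP : measurable_fun setT (\1_(A k) : R -> R) by exact: measurable_indic.
  - by rewrite lee_fin powR_ge0.
  rewrite ge0_integralZl//; last 3 first.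
  - exact: mh'.
  - by move=> z _; rewrite lee_fin mulr_ge0// indicE.
  - by rewrite lee_fin.
  have -> : (\int[mu]_x (\1_(A k) x)%:E = mu (A k))%E.
    by rewrite integral_indic => [|//|]; [exact: (congr1 mu (setIT (A k)))|exact: mA].
  rewrite EFinM -muleA; apply: lee_wpmul2l; first by rewrite lee_fin powR_ge0.
  have := weak_type mv v0 vB alpha0 (c0 k) mN.
  by rewrite -ge0_integral_indicM /c mulrCA divff ?gt_eqF// mulr1.
have h2 : (\sum_(0 <= k <oo) \int[mu]_x g k x <= \int[mu]_x \sum_(0 <= k <oo) h k x)%E.
  by rewrite integral_nneseries//; apply: lee_nneseries => // k _ _; apply: integral_ge0.
apply: le_lt_trans h2 _.
pose q : R := 2^-1 `^ (p - 1).
have q1 : q < 1.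
  have := @gt0_ltr_powR _ _ q0 2^-1 1; rewrite powR1; apply; rewrite ?nnegrE//; lra.
have q00 : 0 <= q by exact: powR_ge0.
(* The weight of the k-th level is [a k]^ p * (6 / c k) = 12 * C0 * a k [^ (p - 1)], and [z] belongs
   to [S k] exactly when [a k < 4 * C0 * v z]. *)
pose D := 12 * C0 * (4 * C0) `^ (p - 1) / (1 - q).
have C01 : 0 <= C0 by exact: ltW.
have D0 : 0 <= D.
  apply: divr_ge0; last by rewrite subr_ge0 ltW.
  by apply: mulr_ge0; [exact: mulr_ge0|exact: powR_ge0].
have hD z : (\sum_(0 <= k <oo) h k z <= D%:E * (v z `^ p)%:E)%E.
  apply: nneseries_le_partial => // n.
  pose beta := (4 * C0 * v z) `^ (p - 1); pose b := (B + 1) `^ (p - 1).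
  have aq k : a k `^ (p - 1) = b * q ^+ k.
    by rewrite /a powRM ?exprn_ge0 ?ltr_wpDr ?addr_ge0// -powR_mulrn// powRAC -powR_mulrn.
  have le1 : (\sum_(0 <= k < n) h k z <= (12 * C0 * v z *
      \sum_(0 <= k < n) (if b * q ^+ k <= beta then b * q ^+ k else 0))%:E)%E.
    rewrite mulr_sumr -sumEFin; apply: lee_sum => k _.
    rewrite /h -EFinM lee_fin.
    have -> : a k `^ p * (6 / c k) = 12 * C0 * (b * q ^+ k).
      rewrite -(@mulr_powRB1 _ (a k) p) ?(ltW (a0 k))// aq /c aS.
      have := a0 k; have := C00; move: (C0) (a k) => C1 a1 C10 a10.
      by field; rewrite !gt_eqF.
    rewrite indicE; have [zS|zS] := boolP (z \in S k); last first.
      rewrite mul0r mulr0; apply: mulr_ge0; first by apply: mulr_ge0; [exact: mulr_ge0|].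
      by case: ifP => // _; apply: mulr_ge0; [exact: powR_ge0|exact: exprn_ge0].
    rewrite ifT; first by rewrite mul1r mulrAC.
    rewrite -aq ge0_ler_powR ?nnegrE ?(ltW q0) ?(ltW (a0 k))//.
      by apply: mulr_ge0; [exact: mulr_ge0|].
    move: zS; rewrite inE /S /= /c aS ltr_pdivrMr// ltr_pdivrMr// => /ltW; lra.
  apply: le_trans le1 _; rewrite -EFinM lee_fin.
  apply: le_trans (ler_wpM2l _ (truncated_geometric_le n q00 q1 (powR_ge0 _ _) (powR_ge0 _ _))) _.
    by apply: mulr_ge0; [exact: mulr_ge0|].
  rewrite /beta powRM; [|exact: mulr_ge0|exact: v0]; rewrite -(mulr_powRB1 (v0 z) p0) /D.
  by rewrite le_eqVlt; apply/orP; left; apply/eqP; ring.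
have h3 : (\int[mu]_x \sum_(0 <= k <oo) h k x <= \int[mu]_x (D%:E * (v x `^ p)%:E))%E.
  apply: ge0_le_integral => //.
  - by move=> z _; apply: nneseries_ge0 => k _ _; exact: h0.
  - exact: (@ge0_emeasurable_sum _ _ _ _ h xpredT).
  - apply: measurable_funeM; apply/measurable_EFinP.
    exact: (measurableT_comp (measurable_powR p)).
apply: le_lt_trans h3 _; rewrite ge0_integralZl//.
- by rewrite lte_mul_pinfty.
- by apply/measurable_EFinP; exact: (measurableT_comp (measurable_powR p)).
- by move=> z _; rewrite lee_fin powR_ge0.
Qed.

End LpBound.

(** * Weak derivatives and primitives *)

Section SmoothStep.
Context {R : realType}.
Implicit Types (f g : R -> R) (x y a b : R).

(** The powers of [x^-1] are included so that differentiation stays in the span of these functions: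
    the derivative of index [n] combines the indices [n + 2] and [n + 1]. *)
Definition flat_exp n x : R := if 0 < x then x^-1 ^+ n * expR (- x^-1) else 0.

Lemma flat_exp_ge0 n x : 0 <= flat_exp n x.
Proof. by rewrite /flat_exp; case: ifPn => // x0; rewrite mulr_ge0 ?expR_ge0// exprn_ge0// invr_ge0 ltW. Qed.

(** One term of the exponential series, of order [n + 2] at [x^-1], is enough. Quadratic decay makes
    [flat_exp n z / z] tend to 0, which is the derivative at 0. *)
Lemma flat_exp_le n x : flat_exp n x <= n.+2`!%:R * x ^+ 2.
Proof.
rewrite /flat_exp; case: ifPn => [x0|_]; last by rewrite mulr_ge0 ?sqr_ge0.
have y0 : 0 < x^-1 by rewrite invr_gt0.
have -> : x ^+ 2 = (x^-1 ^+ 2)^-1 by rewrite exprVn invrK.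
move: (x^-1) y0 => y y0; rewrite ler_pdivlMr ?exprn_gt0// expRN mulrAC ler_pdivrMr ?expR_gt0//.
rewrite -exprD addn2 mulrC -ler_pdivrMr ?ltr0n ?fact_gt0//.
by apply: le_trans (expR_ge1Dxn n.+1 (ltW y0)); rewrite lerDr.
Qed.

Lemma is_derive_flat_exp n x :
  is_derive x 1 (flat_exp n) (flat_exp n.+2 x - n%:R * flat_exp n.+1 x).
Proof.
have [x0|x0|->] := ltgtP x 0.
- have f0 m : flat_exp m x = 0 by rewrite /flat_exp ltNge (ltW x0).
  rewrite !f0 mulr0 subr0.
  apply: (@near_eq_is_derive _ _ _ (cst 0)).
  near=> y; rewrite /flat_exp ifN// -leNgt ltW//; near: y; exact: lt_nbhsl.
- have fE m : flat_exp m x = x^-1 ^+ m * expR (- x^-1) by rewrite /flat_exp x0.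
  rewrite !fE.
  apply: (@near_eq_is_derive _ _ _ (fun y => y^-1 ^+ n * expR (- y^-1))).
    by near=> y; rewrite /flat_exp ifT//; near: y; exact: lt_nbhsr.
  have x00 : x != 0 by rewrite gt_eqF.
  have hi : is_derive x 1 (fun y => y^-1) (- x^-1 ^+ 2).
    have := is_deriveV x00 (is_derive_id x 1).
    by rewrite exprVn /GRing.scale /= mulr1.
  have h1 : is_derive x 1 (fun y => y^-1 ^+ n) (n%:R * x^-1 ^+ n.-1 * (- x^-1 ^+ 2)).
    have -> : (fun y : R => y^-1 ^+ n) = (fun y => y^-1) ^+ n by rewrite exprfctE.
    exact: is_deriveX.
  have hn : is_derive x 1 (fun y => - y^-1) (x^-1 ^+ 2).
    by have := is_deriveN hi; rewrite opprK.
  have h2 : is_derive x 1 (fun y => expR (- y^-1)) (expR (- x^-1) * x^-1 ^+ 2).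
    exact: (@is_derive1_comp _ expR (fun y => - y^-1) x _ _ (is_derive_expR _) hn).
  apply: (is_derive_eq (is_deriveM h1 h2)); rewrite /GRing.scale /=.
  case: n {h1} => [|n]; first by rewrite !mul0r !mulr0 !expr0; ring.
  by rewrite /= !exprS; ring.
- have f0 m : flat_exp m 0 = 0 by rewrite /flat_exp ltxx.
  rewrite !f0 mulr0 subr0; apply/is_derive1_caratheodory.
  exists (fun z => flat_exp n z / z); split; last by rewrite invr0 mulr0.
    by move=> z; rewrite f0 !subr0; have [->|z0] := eqVneq z 0; rewrite ?f0 ?mulr0// divfK.
  apply/cvgrPdist_le => e e0; rewrite invr0 mulr0.
  near=> z; rewrite sub0r normrN normrM ger0_norm ?flat_exp_ge0//.
  have [->|z0] := eqVneq z 0; first by rewrite f0 mul0r ltW.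
  rewrite normfV ler_pdivrMr ?normr_gt0//.
  apply: le_trans (flat_exp_le n z) _.
  rewrite -(real_normK (num_real z)) expr2 mulrA ler_wpM2r//.
  rewrite mulrC -ler_pdivlMr ?ltr0n ?fact_gt0//; near: z.
  have := @nbhs0_le R R (e / n.+2`!%:R); apply.
  by rewrite divr_gt0// ltr0n fact_gt0.
Unshelve. all: by end_near. Qed.

(* A family of functions containing the smooth step and closed under derivation,
   which is how the step is shown to be infinitely differentiable. *)
Inductive step_family : (R -> R) -> Prop :=
| step_flat n : step_family (flat_exp n)
| step_add f g : step_family f -> step_family g -> step_family (fun x => f x + g x)
| step_mul f g : step_family f -> step_family g -> step_family (fun x => f x * g x)
| step_scale k f : step_family f -> step_family (fun x => k * f x)
| step_affine a b f : step_family f -> step_family (fun x => f (a * x + b))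
| step_inv f : (forall x, 0 < f x) -> step_family f -> step_family (fun x => (f x)^-1).

Lemma step_family_derive f : step_family f ->
  exists2 g, step_family g & forall x, is_derive x 1 f (g x).
Proof.
elim=> {f}.
- move=> n; exists (fun x => flat_exp n.+2 x + (- n%:R) * flat_exp n.+1 x).
    by apply: step_add; [exact: step_flat|apply: step_scale; exact: step_flat].
  by move=> x; rewrite mulNr; exact: is_derive_flat_exp.
- move=> f1 f2 _ [g1 c1 d1] _ [g2 c2 d2]; exists (fun x => g1 x + g2 x); first exact: step_add.
  by move=> x; exact: is_deriveD.
- move=> f1 f2 c1' [g1 c1 d1] c2' [g2 c2 d2].
  exists (fun x => f1 x * g2 x + f2 x * g1 x); first by apply: step_add; exact: step_mul.
  by move=> x; exact: is_deriveM.
- move=> k f _ [g c d]; exists (fun x => k * g x); first exact: step_scale.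
  by move=> x; exact: (@is_deriveZ _ _ _ f k x 1 _ (d x)).
- move=> a b f _ [g c d]; exists (fun x => a * g (a * x + b)).
    by apply: step_scale; exact: step_affine.
  move=> x; rewrite mulrC.
  apply: (@is_derive1_comp _ f (fun x => a * x + b) x) => //.
  have := is_deriveD (is_deriveZ a (is_derive_id x 1)) (is_derive_cst b x 1).
  by rewrite addr0 /GRing.scale /= mulr1.
- move=> f f0 c' [g c d].
  exists (fun x => (-1) * (((f x)^-1 * (f x)^-1) * g x)).
    by apply: step_scale; apply: step_mul => //; apply: step_mul; exact: step_inv.
  move=> x; have := is_deriveV (lt0r_neq0 (f0 x)) (d x).
  by rewrite /GRing.scale /= mulN1r -expr2 exprVn mulNr.
Qed.

Lemma step_family_smooth f n x : step_family f -> derivable (derive1n n f) x 1.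
Proof.
elim: n f => [|n IH] f /[dup] hf /step_family_derive[g hg dg].
  by case: (dg x).
rewrite derive1Sn (_ : derive1 f = g); first exact: IH.
by apply/funext => y; rewrite derive1E; case: (dg y).
Qed.

Definition smooth_step x : R := flat_exp 0 x * (flat_exp 0 x + flat_exp 0 ((-1) * x + 1))^-1.

Let den_gt0 x : 0 < flat_exp 0 x + flat_exp 0 ((-1) * x + 1).
Proof.
have pos y : 0 < y -> 0 < flat_exp 0 y by move=> y0; rewrite /flat_exp y0 mulr_gt0 ?expr0 ?expR_gt0.
have [x0|x0] := ltP 0 x; first by rewrite ltr_pwDl ?pos ?flat_exp_ge0.
by rewrite ltr_wpDl ?flat_exp_ge0// pos//; lra.
Qed.

Lemma smooth_step_family : step_family smooth_step.
Proof.
apply: step_mul; first exact: step_flat.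
apply: step_inv; first exact: den_gt0.
by apply: step_add; [|apply: step_affine]; exact: step_flat.
Qed.

Lemma smooth_step_ge0 x : 0 <= smooth_step x.
Proof. by rewrite mulr_ge0 ?invr_ge0 ?flat_exp_ge0 ?(ltW (den_gt0 x)). Qed.

Lemma smooth_step_le1 x : smooth_step x <= 1.
Proof. by rewrite ler_pdivrMr// mul1r lerDl flat_exp_ge0. Qed.

Lemma smooth_step_eq0 x : x <= 0 -> smooth_step x = 0.
Proof. by move=> x0; rewrite /smooth_step {1}/flat_exp ltNge x0 mul0r. Qed.

Lemma smooth_step_eq1 x : 1 <= x -> smooth_step x = 1.
Proof.
move=> x1; rewrite /smooth_step [X in _ + X]/flat_exp ifN; last by rewrite -leNgt; lra.
rewrite addr0 divff// gt_eqF//; have := den_gt0 x.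
by rewrite {2}/flat_exp ifN ?addr0//; rewrite -leNgt; lra.
Qed.

End SmoothStep.

(** * Weak derivatives tested on smooth steps *)

Section DuBoisReymond.
Context {R : realType}.
Local Notation mu := (@lebesgue_measure R).
Implicit Types (f g k : R -> R) (x y a b C : R).

Lemma compact_support_dominated f k a b C x : 0 <= C ->
  (forall x, `|k x| <= C) -> (forall x, x < a \/ b < x -> k x = 0) ->
  (`|(f x * k x)%:E| <= C%:E * `|((EFin \o f) \_ `[a, b]) x|)%E.
Proof.
move=> C0 kC k0; rewrite patchE; case: ifPn => [_|].
  by rewrite /= -EFinM lee_fin normrM mulrC ler_wpM2r.
rewrite notin_setE /= in_itv /= => /negP; rewrite negb_and -!ltNge => /orP h.
by rewrite k0// mulr0 normr0 mule0.
Qed.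

Lemma integrable_compact_support f k a b C : measurable_fun setT f ->
  mu.-integrable `[a, b] (EFin \o f) -> measurable_fun setT k -> 0 <= C ->
  (forall x, `|k x| <= C) -> (forall x, x < a \/ b < x -> k x = 0) ->
  mu.-integrable setT (fun x => (f x * k x)%:E).
Proof.
move=> mf intf mk C0 kC k0.
have /integrableZl : mu.-integrable setT (abse \o ((EFin \o f) \_ `[a, b])).
  have mI : measurable (`[a, b]%classic : set (measurableTypeR R)) by exact: measurable_itv.
  by apply: integrable_abse; exact: (proj1 (integrable_mkcond _ mI) intf).
move=> /(_ measurableT C); apply: le_integrable => //.
  by apply/measurable_EFinP; exact: measurable_funM.
move=> x _; apply: le_trans (compact_support_dominated f x C0 kC k0) _.
by rewrite abseM (@gee0_abs _ C%:E) ?lee_fin// /comp abse_id.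
Qed.

(** Rises from 0 to 1 just to the right of [a], over a length 1 / (n + 1). It converges pointwise to
    the indicator of []a, +oo[], and its derivative is a one-sided mollifier at [a]. *)
Definition scaled_step n a x : R := smooth_step (n.+1%:R * x + (- (n.+1%:R * a))).

Lemma scaled_step_family n a : step_family (scaled_step n a).
Proof. exact: (step_affine _ _ smooth_step_family). Qed.

Lemma scaled_step_ge0 n a x : 0 <= scaled_step n a x. Proof. exact: smooth_step_ge0. Qed.

Lemma scaled_step_le1 n a x : scaled_step n a x <= 1. Proof. exact: smooth_step_le1. Qed.

Lemma scaled_step_eq0 n a x : x <= a -> scaled_step n a x = 0.
Proof. by move=> xa; apply: smooth_step_eq0; rewrite subr_le0 ler_pM2l. Qed.

Lemma scaled_step_eq1 n a x : a + n.+1%:R^-1 <= x -> scaled_step n a x = 1.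
Proof.
move=> xa; apply: smooth_step_eq1; by rewrite -mulrBr -ler_pdivrMl// mulr1 lerBrDl.
Qed.

Lemma scaled_step_cvg a x : (fun n => scaled_step n a x) @ \oo --> (\1_`]a, +oo[ x : R).
Proof.
rewrite indicE; have [xa|ax] := leP x a.
  rewrite memNset /=; last by rewrite in_itv /= andbT ltNge xa.
  by under eq_fun do rewrite scaled_step_eq0//; exact: cvg_cst.
rewrite mem_set /=; last by rewrite in_itv /= andbT.
apply: cvg_near_cst; have xa0 : 0 < x - a by rewrite subr_gt0.
near=> n; apply: scaled_step_eq1.
rewrite -lerBrDl; apply: ltW; near: n; exact: (near_infty_natSinv_lt (PosNum xa0)).
Unshelve. all: by end_near. Qed.

Lemma scaled_step_derivable n a x : derivable (scaled_step n a) x 1.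
Proof. exact: (@step_family_smooth _ _ 0%N x (scaled_step_family n a)). Qed.

Lemma derive1_scaled_step_continuous n a : continuous (derive1 (scaled_step n a)).
Proof.
by apply: derivable_continuous => x; exact: (@step_family_smooth _ _ 1%N x (scaled_step_family n a)).
Qed.

Lemma derive1_scaled_step_eq0 n a x : x < a \/ a + n.+1%:R^-1 < x ->
  derive1 (scaled_step n a) x = 0.
Proof.
case=> hx; rewrite derive1E.
  rewrite (@near_eq_derive _ _ _ _ (cst 0)) ?derive_cst//.
  by near=> y; apply: scaled_step_eq0; apply: ltW; near: y; exact: lt_nbhsl.
rewrite (@near_eq_derive _ _ _ _ (cst (1 : R))) ?derive_cst//.
by near=> y; apply: scaled_step_eq1; apply: ltW; near: y; exact: lt_nbhsr.
Unshelve. all: by end_near. Qed.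

Lemma derive1_scaled_step_le : exists2 M, 0 <= M &
  forall n a x, `|derive1 (scaled_step n a) x| <= n.+1%:R * M.
Proof.
have step0 : (fun x => smooth_step x) = scaled_step 0%N 0.
  by apply/funext => x; rewrite /scaled_step mul1r mulr0 oppr0 addr0.
have [M M0 hM] := continuous_compact_support_bounded
  (@derive1_scaled_step_continuous 0%N 0) (@derive1_scaled_step_eq0 0%N 0).
exists M => // n a x; have dS y := @step_family_smooth _ _ 0%N y smooth_step_family.
have d2 : is_derive x 1 (fun x => n.+1%:R * x + (- (n.+1%:R * a))) (n.+1%:R : R).
  have := is_deriveD (is_deriveZ (n.+1%:R : R) (is_derive_id x 1))
    (is_derive_cst (- (n.+1%:R * a)) x 1).
  by rewrite addr0 /GRing.scale /= mulr1.
have := is_derive1_comp (DeriveDef (dS _) erefl) d2.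
move=> [_]; rewrite derive1E => ->.
rewrite normrM mulrC ger0_norm// ler_wpM2l//.
by have := hM (n.+1%:R * x + (- (n.+1%:R * a))); rewrite -step0 derive1E.
Qed.

Lemma integral_derive1_scaled_step n a :
  (\int[mu]_x (derive1 (scaled_step n a) x)%:E = 1)%E.
Proof.
set b := a + n.+1%:R^-1; have ab : a < b by rewrite ltrDl invr_gt0.
have -> : (\int[mu]_x (derive1 (scaled_step n a) x)%:E =
    \int[mu]_(x in `[a, b]) (derive1 (scaled_step n a) x)%:E)%E.
  rewrite [RHS]integral_mkcond; apply: eq_integral => x _; rewrite patchE.
  case: ifPn => //; rewrite notin_setE /= in_itv /= => /negP.
  rewrite negb_and -!ltNge => /orP h; by rewrite derive1_scaled_step_eq0.
have c : continuous (scaled_step n a).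
  by apply: derivable_continuous => x; exact: scaled_step_derivable.
rewrite (@continuous_FTC2 _ _ (scaled_step n a) _ _ ab).
- by rewrite scaled_step_eq1// scaled_step_eq0// sube0.
- by apply: continuous_subspaceT; exact: derive1_scaled_step_continuous.
- split; first by move=> x _; exact: scaled_step_derivable.
  + by apply: cvg_at_right_filter; exact: c.
  + by apply: cvg_at_left_filter; exact: c.
- by [].
Qed.

(** The mollifier has integral 1, size at most [n.+1%:R * M], and support in a ball of measure 4 /
    (n + 1). The error is therefore at most [4 * M] times the mean deviation of [f] from [f a] over
    that ball, which tends to 0 at a Lebesgue point. *)
Lemma scaled_step_mollifier f a : Defs.locally_integrable f -> lebesgue_pt f a ->
  (fun n => \int[mu]_x (f x * derive1 (scaled_step n a) x)%:E)%E @ \oo --> (f a)%:E.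
Proof.
move=> [mf intf] hpt.
have [M M0 hM] := derive1_scaled_step_le.
apply: (sube_cvg0 _ _).1 => //=; apply/cvg_abse0P.
have nz n : 0 < n.+1%:R^-1 :> R by rewrite invr_gt0.
have mk n : measurable_fun setT (derive1 (scaled_step n a)).
  by apply: continuous_measurable_fun; exact: derive1_scaled_step_continuous.
have int1 n : mu.-integrable setT (fun x => (f x * derive1 (scaled_step n a) x)%:E).
  apply: (integrable_compact_support mf (intf _ _) (mk n) _ (hM n a)
    (@derive1_scaled_step_eq0 n a)); exact: mulr_ge0.
have int2 c n : mu.-integrable setT (fun x => (cst c x * derive1 (scaled_step n a) x)%:E).
  apply: (integrable_compact_support _ _ (mk n) _ (hM n a)
    (@derive1_scaled_step_eq0 n a)); last exact: mulr_ge0.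
    exact: measurable_cst.
  by apply: (@bounded_integrable_itv _ _ `|c|) => //; exact: measurable_cst.
have eqn n : (\int[mu]_x (f x * derive1 (scaled_step n a) x)%:E - (f a)%:E =
    \int[mu]_x ((f x - f a) * derive1 (scaled_step n a) x)%:E)%E.
  have -> : (f a)%:E = (\int[mu]_x (cst (f a) x * derive1 (scaled_step n a) x)%:E)%E.
    under eq_integral do rewrite EFinM.
    rewrite integralZl ?integral_derive1_scaled_step ?mule1//.
    by have := int2 1 n; under eq_fun do rewrite mul1r.
  rewrite -(integralB_EFin _ (int1 n) (int2 (f a) n))//; apply: eq_integral => x _.
  by rewrite -EFinB mulrBl.
apply: (@squeeze_cvge _ _ _ _ (cst (0%E : \bar R)) _ (fun n => (4 * M)%:E * davg f a (2 / n.+1%:R))%E); last 2 first.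
- exact: cvg_cst.
- rewrite -[X in _ --> X](mule0 (4 * M)%:E); apply: cvgeZl => //.
  apply: (proj1 (cvge_at_rightP (davg f a) 0 0)) => //; split.
    by move=> n; rewrite mulr_gt0.
  rewrite -[X in _ --> X](mulr0 2); apply: cvgMr; exact: cvg_harmonic.
apply: nearW => n; rewrite abse_ge0 /= eqn.
(* Twice the length of the step, so that the open ball contains the closed interval outside which
   the derivative vanishes. *)
pose r : R := 2 / n.+1%:R.
have r0 : 0 < r by rewrite mulr_gt0.
have mfa : measurable_fun setT (fun x => f x - f a) by exact: measurable_funB.
have mfk : measurable_fun setT (fun x => ((f x - f a) * derive1 (scaled_step n a) x)%:E).
  by apply/measurable_EFinP; exact: measurable_funM.
have mb : measurable_fun setT (fun x => (\1_(ball a r) x * `|f x - f a|)%:E).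
  apply/measurable_EFinP; apply: measurable_funM.
    by apply: measurable_indic; exact: measurable_ball.
  exact: measurableT_comp.
have h0 : (`|\int[mu]_x ((f x - f a) * derive1 (scaled_step n a) x)%:E| <=
    \int[mu]_x `|((f x - f a) * derive1 (scaled_step n a) x)%:E|)%E.
  exact: le_abse_integral.
apply: le_trans h0 _.
pose c : R := n.+1%:R * M.
have c0 : 0 <= c by exact: mulr_ge0.
have h1 : (\int[mu]_x `|((f x - f a) * derive1 (scaled_step n a) x)%:E| <=
   \int[mu]_x (c%:E * (\1_(ball a r) x * `|f x - f a|)%:E))%E.
  apply: ge0_le_integral => //.
  - exact: measurableT_comp.
  - exact: measurable_funeM.
  move=> x _; rewrite /= -EFinM lee_fin normrM indicE.
  have [/set_mem|] := boolP (x \in (ball a r : set R)).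
    by move=> _; rewrite mul1r mulrC ler_wpM2r.
  rewrite notin_setE /ball /= => /negP; rewrite -leNgt mul0r mulr0 => ar.
  rewrite derive1_scaled_step_eq0 ?normr0 ?mulr0//.
  have [xa|ax] := ltP x a; first by left.
  right; move: ar; rewrite distrC ger0_norm ?subr_ge0//.
  by have := nz n; rewrite /r; set q := n.+1%:R^-1; lra.
apply: le_trans h1 _; rewrite ge0_integralZl//.
have hI : (\int[mu]_z (\1_(ball a r) z * `|f z - f a|)%:E =
  \int[mu]_(z in ball a r) `|f z - f a|%:E)%E by exact: ge0_integral_indicM.
rewrite /davg /iavg lebesgue_measure_ball ?(ltW r0)// inver.
rewrite mulrn_eq0 /= gt_eqF// muleA -EFinM -hI.
by rewrite le_eqVlt; apply/orP; left; apply/eqP; congr (_%:E * _)%E; rewrite /c /r; field.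
Qed.

(** The test functions are differences of smooth steps at [a] and at [b]: they converge boundedly to
    the indicator of []a, b]], while their derivatives mollify [f] at the two points. *)
Lemma weak_derivative_lebesgue_pt f g a b : weak_derivative f g ->
  lebesgue_pt f a -> lebesgue_pt f b -> a <= b ->
  ((f b - f a)%:E = \int[mu]_(x in `]a, b]) (g x)%:E)%E.
Proof.
move=> [lf [[mg ig] hw]] pa pb ab.
pose phi n x := scaled_step n a x - scaled_step n b x.
have inv1 n : n.+1%:R^-1 <= 1 :> R by rewrite invf_le1// ler1n.
have phi0 n x : x < a \/ b + 1 < x -> phi n x = 0.
  case=> hx; rewrite /phi.
    by rewrite !scaled_step_eq0 ?subrr//; lra.
  by rewrite !scaled_step_eq1 ?subrr//; move: (inv1 n); set q := n.+1%:R^-1; lra.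
have phi1 n x : `|phi n x| <= 1.
  have := scaled_step_ge0 n a x; have := scaled_step_le1 n a x.
  have := scaled_step_ge0 n b x; have := scaled_step_le1 n b x.
  by rewrite ler_norml /phi; lra.
have phiE n : phi n = (fun x => scaled_step n a x + (-1) * scaled_step n b x).
  by apply/funext => x; rewrite mulN1r.
have tphi n : test_function (phi n).
  split; last by exists a, (b + 1); exact: phi0.
  move=> m x; apply: step_family_smooth; rewrite phiE.
  by apply: step_add; [|apply: step_scale]; exact: scaled_step_family.
have mphi n : measurable_fun setT (phi n).
  by apply: continuous_measurable_fun; exact: test_function_continuous.
have [M M0 hM] := derive1_scaled_step_le.
have intk n c : mu.-integrable setT (fun x => (f x * derive1 (scaled_step n c) x)%:E).
  apply: (integrable_compact_support lf.1 (lf.2 _ _) _ _ (hM n c)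
    (@derive1_scaled_step_eq0 n c)); last exact: mulr_ge0.
  by apply: continuous_measurable_fun; exact: derive1_scaled_step_continuous.
have L1 : (fun n => \int[mu]_x (f x * derive1 (phi n) x)%:E)%E @ \oo --> ((f a)%:E - (f b)%:E)%E.
  have hc : (fun n => \int[mu]_x (f x * derive1 (scaled_step n a) x)%:E -
      \int[mu]_x (f x * derive1 (scaled_step n b) x)%:E)%E @ \oo --> ((f a)%:E - (f b)%:E)%E.
    by apply: cvgeB => //; exact: scaled_step_mollifier.
  move: hc.
  apply: cvg_trans; apply: near_eq_cvg; apply: nearW => n /=.
  rewrite -(integralB_EFin _ (intk n a) (intk n b))//; apply: eq_integral => x _.
  rewrite -EFinB -mulrBr !derive1E /phi deriveB//; exact: scaled_step_derivable.
have mgphi n : measurable_fun setT (fun x => (g x * phi n x)%:E).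
  by apply/measurable_EFinP; exact: measurable_funM.
have mgI : measurable_fun setT (fun x => (g x * \1_`]a, b] x)%:E).
  by apply/measurable_EFinP; apply: measurable_funM => //; exact: measurable_indic.
have L2 : (fun n => \int[mu]_x (g x * phi n x)%:E)%E @ \oo -->
    (\int[mu]_x (g x * \1_`]a, b] x)%:E)%E.
  have [] := @dominated_convergence _ _ R mu setT measurableT
    (fun n x => (g x * phi n x)%:E) (fun x => (g x * \1_`]a, b] x)%:E)
    (abse \o ((EFin \o g) \_ `[a, b + 1])).
  - exact: mgphi.
  - exact: mgI.
  - apply: aeW => x _; apply: cvg_EFin; first exact: nearW.
    apply: cvgMr.
    have -> : \1_`]a, b] x = \1_`]a, +oo[ x - \1_`]b, +oo[ x :> R; last first.
      by apply: cvgB; exact: scaled_step_cvg.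
    rewrite !indicE !mem_setE !in_itv /= !andbT.
    have [xb|bx] := leP x b; first by rewrite subr0 andbT.
    by rewrite andbF (le_lt_trans ab bx) subrr.
  - apply: integrable_abse.
    have mI : measurable (`[a, b + 1]%classic : set (measurableTypeR R)) by exact: measurable_itv.
    exact: (proj1 (integrable_mkcond _ mI) (ig _ _)).
  - apply: aeW => x n _.
    by have := compact_support_dominated g x ler01 (phi1 n) (phi0 n); rewrite mul1e.
  by move=> _ _.
have L3 : (fun n => \int[mu]_x (f x * derive1 (phi n) x)%:E)%E @ \oo -->
    (- \int[mu]_x (g x * \1_`]a, b] x)%:E)%E.
  by under eq_fun do rewrite hw//; exact: cvgeN.
have := cvg_lim (@ereal_hausdorff R) L1; rewrite (cvg_lim (@ereal_hausdorff R) L3) => hI.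
have -> : (\int[mu]_(x in `]a, b]) (g x)%:E = \int[mu]_x (g x * \1_`]a, b] x)%:E)%E.
  rewrite [LHS]integral_mkcond; apply: eq_integral => x _; rewrite patchE indicE.
  by case: ifPn; rewrite ?mulr1// mulr0.
by rewrite -[RHS]oppeK hI -EFinB -EFinN opprB.
Qed.

End DuBoisReymond.

(** * The primitive as a representative, its energies and its bounds *)

Section Representative.
Context {R : realType}.
Local Notation mu := (@lebesgue_measure R).
Implicit Types (f g u : R -> R) (x y z a b A : R).

Lemma ae_exists (P : R -> Prop) : {ae mu, forall x, P x} -> exists x, P x.
Proof.
move=> [N [mN N0 sub]]; apply: contrapT => hn.
have NT : N = setT by apply/seteqP; split => // x _; apply: sub => hx; apply: hn; exists x.
have : (mu (`[0%R, 1%R]%classic : set R) <= mu N)%E.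
  by apply: le_measure; rewrite ?inE// NT.
by rewrite N0 lebesgue_measure_itv /= lte_fin ltr01 -EFinB subr0 lee_fin ler10.
Qed.

Lemma Rintegral_itv_split g x y z : Defs.locally_integrable g -> x <= y -> y <= z ->
  \int[mu]_(t in `]x, z]) g t = \int[mu]_(t in `]x, y]) g t + \int[mu]_(t in `]y, z]) g t.
Proof.
move=> [_ ig] xy yz; rewrite -[X in _ + X](@Rintegral_itvB _ g (BRight x)) ?bnd_simp//.
  by rewrite addrC subrK.
by apply: integrableS (ig x z) => //; apply: subset_itvr; rewrite bnd_simp.
Qed.

(** The primitive of [g] is anchored at one Lebesgue point [a0] of [u]; by the increment formula
    between Lebesgue points it agrees with [u] at all the others. *)
Lemma weak_derivative_representative u g : weak_derivative u g -> exists f,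
  {ae mu, forall x, u x = f x} /\
  forall x y, x <= y -> f y - f x = \int[mu]_(z in `]x, y]) g z.
Proof.
move=> wd; have lg : Defs.locally_integrable g := wd.2.1.
have lu : locally_integrable setT u.
  have [mu' iu] := wd.1; split => //; first exact: openT.
  move=> K _ cK; have mK := compact_measurable cK.
  have [M [_ hM]] := compact_bounded cK.
  have KI : K `<=` `[- (M + 1), M + 1].
    by move=> x Kx; rewrite /= in_itv /= -ler_norml; apply: hM Kx; rewrite ltrDl.
  have mI : measurable (`[- (M + 1), M + 1]%classic : set (measurableTypeR R)) by exact: measurable_itv.
  by have /integrableP[] := integrableS mI mK KI (iu _ _).
have Leb := lebesgue_differentiation lu.
have [a0 pa0] := ae_exists Leb.
pose f x := u a0 + (if a0 <= x then \int[mu]_(z in `]a0, x]) g z else - \int[mu]_(z in `]x, a0]) g z).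
have hf x y : x <= y -> f y - f x = \int[mu]_(z in `]x, y]) g z.
  move=> xy; rewrite /f; have [ax|xa] := leP a0 x.
    by rewrite (le_trans ax xy) (Rintegral_itv_split lg ax xy); ring.
  have [ay|ya] := leP a0 y.
    by rewrite (Rintegral_itv_split lg (ltW xa) ay); ring.
  by rewrite (Rintegral_itv_split lg xy (ltW ya)); ring.
exists f; split => //; apply: filterS Leb; first exact: (ae_filter_ringOfSetsType mu).
move=> x px; rewrite /f; have [ax|xa] := leP a0 x.
  by rewrite /Rintegral -(weak_derivative_lebesgue_pt wd pa0 px ax) /=; ring.
by rewrite /Rintegral -(weak_derivative_lebesgue_pt wd px pa0 (ltW xa)) /=; ring.
Qed.

Section Primitive.
Variables (f g : R -> R).
Hypothesis lg : Defs.locally_integrable g.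
Hypothesis fE : forall x y, x <= y -> f y - f x = \int[mu]_(z in `]x, y]) g z.

Let mg : measurable_fun setT g. Proof. exact: lg.1. Qed.

Let ig x y : mu.-integrable `]x, y] (EFin \o g).
Proof. by apply: integrableS (lg.2 x y) => //; apply: subset_itvr; rewrite bnd_simp. Qed.

(** Jensen's inequality: the tangent to [Phi] at the mean [m] of [g] is integrated over the
    interval, and its linear part integrates to 0. *)
Lemma primitive_term_le (Phi s : R -> R) (x y : R) : gauge Phi s -> x < y ->
  (\int[mu]_(z in `]x, y]) (Phi (g z))%:E < +oo)%E ->
  ((energy_term Phi f x y)%:E <= \int[mu]_(z in `]x, y]) (Phi (g z))%:E)%E.
Proof.
move=> gPhi xy hoo; have yx : 0 < y - x by rewrite subr_gt0.
have mPhi : measurable_fun setT (fun z => Phi (g z)).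
  by apply: measurableT_comp mg; exact: gauge_measurable gPhi.
have iPhi : mu.-integrable `]x, y] (EFin \o (fun z => Phi (g z))).
  apply: ge0_integrable_EFin => //; first exact: measurable_funS mPhi.
  by move=> z; exact: gauge_ge0 gPhi _.
rewrite -[leRHS]fineK ?(integrable_fin_num _ iPhi)// lee_fin -[leRHS]/(Rintegral mu `]x, y] _).
rewrite /energy_term; set m := (f y - f x) / (y - x).
have hm : \int[mu]_(z in `]x, y]) g z = m * (y - x).
  by rewrite -fE ?(ltW xy)// /m divfK// gt_eqF.
have ic c : mu.-integrable `]x, y] (EFin \o cst c).
  by apply: (@bounded_integrable_itv _ _ `|c|) => //; exact: measurable_cst.
have Rc c : \int[mu]_(z in `]x, y]) cst c z = c * (y - x).
  by rewrite Rintegral_cst//= lebesgue_measure_itv /= lte_fin xy.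
have iZ : mu.-integrable `]x, y] (EFin \o (fun z => s m * g z)) by exact: integrableZl_EFin.
have -> : Phi m * (y - x) = \int[mu]_(z in `]x, y]) (cst (Phi m - s m * m) z + s m * g z).
  by rewrite RintegralD// RintegralZl// Rc hm; ring.
apply: le_Rintegral => //; first exact: integrableD_EFin.
move=> z _ /=; have [+ _ _ _] := gPhi.
by move=> /(_ m (g z)); lra.
Qed.

Lemma primitive_energy_le (Phi s : R -> R) (E : R) : gauge Phi s ->
  (\int[mu]_z (Phi (g z))%:E <= E%:E)%E -> energy_le Phi f E.
Proof.
move=> gPhi hE x l pl; rewrite -lee_fin.
have mPhi : measurable_fun setT (fun z => (Phi (g z))%:E).
  by apply/measurable_EFinP; apply: measurableT_comp mg; exact: gauge_measurable gPhi.
have Phi0 z : (0 <= (Phi (g z))%:E)%E by rewrite lee_fin; exact: gauge_ge0 gPhi _.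
have sub (A : set R) : measurable A ->
    (\int[mu]_(z in A) (Phi (g z))%:E <= \int[mu]_z (Phi (g z))%:E)%E.
  by move=> mA; apply: ge0_subset_integral.
suff h : ((energy Phi f x l)%:E <= \int[mu]_(z in `]x, +oo[) (Phi (g z))%:E)%E.
  apply: le_trans h _; apply: le_trans hE; exact: sub.
elim: l x pl => [|y l IH] x /=.
  by move=> _; rewrite /energy /=; exact: integral_ge0.
move=> /andP[xy /IH h]; rewrite /energy /= -/(energy Phi f y l) EFinD.
have -> : (`]x, +oo[ = `]x, y] `|` `]y, +oo[)%classic.
  by rewrite -itv_bndbnd_setU// bnd_simp// ltW.
rewrite ge0_integral_setU//=; last 2 first.
- exact: measurable_funS mPhi.
- apply/disj_setPS => z [] /=; rewrite !in_itv /= andbT => /andP[_ zy]; by rewrite ltNge zy.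
apply: leeD => //; apply: (@primitive_term_le Phi s) => //.
by apply: le_lt_trans (sub _ _) _ => //; exact: le_lt_trans hE (ltry _).
Qed.

Lemma primitive_oscillation_le A x y : (forall y, \int[mu]_(z in `]y, (y + 1)%R]) `|g z|%:E <= A%:E)%E ->
  x <= y -> y <= x + 1 -> `|f y - f x| <= A.
Proof.
move=> hA xy yx; rewrite fE//.
apply: le_trans (le_normr_Rintegral _ (ig _ _)) _ => //.
have hle : (\int[mu]_(z in `]x, y]) `|g z|%:E <= A%:E)%E.
  apply: le_trans (hA x); apply: ge0_subset_integral => //.
    by apply/measurable_EFinP; apply: measurableT_comp => //; exact: measurable_funS mg.
  by apply: subset_itvl; rewrite bnd_simp.
by rewrite /Rintegral -lee_fin fineK//; apply: integrable_fin_num => //; exact: (integrable_norm (ig _ _)).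
Qed.

(** On a unit interval [f] oscillates by at most [A'], so [|f x| - A'] is a lower bound for [|f|]
    there and hence at most the mean of [|u|]. Means over unit intervals are controlled alike for
    every p >= 1, and this makes the datum bounded for the Poisson extension. *)
Lemma primitive_bounded u A A' : measurable_fun setT u -> measurable_fun setT f ->
  {ae mu, forall x, u x = f x} ->
  (forall y, \int[mu]_(z in `]y, (y + 1)%R]) `|u z|%:E <= A%:E)%E ->
  (forall y, \int[mu]_(z in `]y, (y + 1)%R]) `|g z|%:E <= A'%:E)%E ->
  forall x, `|f x| <= A + A'.
Proof.
move=> mu' mf uf hu hg x; rewrite -lerBlDr.
have [h0|h0] := leP (`|f x| - A') 0.
  apply: le_trans h0 _; rewrite -lee_fin; apply: le_trans (hu x).
  by apply: integral_ge0.
rewrite -lee_fin; apply: le_trans (hu x).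
have -> : (\int[mu]_(z in `]x, (x + 1)%R]) `|u z|%:E = \int[mu]_(z in `]x, (x + 1)%R]) `|f z|%:E)%E.
  apply: ge0_ae_eq_integral => //.
  - by apply/measurable_EFinP; apply: measurableT_comp => //; exact: measurable_funS mu'.
  - by apply/measurable_EFinP; apply: measurableT_comp => //; exact: measurable_funS mf.
  - apply: filterS uf; first exact: (ae_filter_ringOfSetsType mu).
    by move=> z -> _.
have -> : (`|f x| - A')%:E = (\int[mu]_(z in `]x, (x + 1)%R]) (`|f x| - A')%:E)%E.
  by rewrite integral_cst//= lebesgue_measure_itv /= lte_fin ltrDl ltr01 -EFinB addrAC subrr add0r mule1.
apply: ge0_le_integral => //.
- by move=> z _; rewrite lee_fin ltW.
- by apply/measurable_EFinP; apply: measurableT_comp => //; exact: measurable_funS mf.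
move=> z; rewrite /= in_itv /= => /andP[xz zx]; rewrite lee_fin.
have := primitive_oscillation_le hg (ltW xz) zx.
have := ler_normB (f z) (f z - f x); rewrite (_ : f z - (f z - f x) = f x); last by ring.
lra.
Qed.

End Primitive.
End Representative.

(** * Conclusion *)

Section PowerGauge.
Context {R : realType}.
Local Notation mu := (@lebesgue_measure R).
Implicit Types (f g u : R -> R) (x y z a b A p K : R).

Lemma powR_young a b p : 1 <= p -> 0 <= a -> 0 <= b ->
  p * a `^ (p - 1) * b <= b `^ p + (p - 1) * a `^ p.
Proof.
rewrite le_eqVlt => /predU1P[<-|p1] a0 b0.
  by rewrite subrr powRr0 mul1r mul1r mul0r addr0 powRr1.
have p0 : 0 < p by rewrite (lt_trans ltr01).
have p10 : 0 < p - 1 by rewrite subr_gt0.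
have := @conjugate_powR _ b (a `^ (p - 1)) p (p / (p - 1)) b0 (powR_ge0 _ _) p0.
rewrite divr_gt0// invf_div => /(_ isT).
have -> : p^-1 + (p - 1) / p = 1 by field; rewrite gt_eqF.
move=> /(_ erefl); rewrite -powRrM (_ : (p - 1) * (p / (p - 1)) = p); last first.
  by field; rewrite gt_eqF.
rewrite -(ler_pM2l p0) => h.
have -> : p * a `^ (p - 1) * b = p * (b * a `^ (p - 1)) by ring.
apply: le_trans h _; rewrite le_eqVlt; apply/orP; left; apply/eqP.
by field; rewrite !gt_eqF.
Qed.

Lemma gauge_powR p : 1 <= p ->
  gauge (fun r => `|r| `^ p) (fun r => p * `|r| `^ (p - 1) * Num.sg r).
Proof.
move=> p1; have p0 : 0 < p by rewrite (lt_le_trans ltr01).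
split.
- move=> r r'; have := powR_young p1 (normr_ge0 r) (normr_ge0 r').
  have pa0 : 0 <= p * `|r| `^ (p - 1) by rewrite mulr_ge0 ?powR_ge0 ?(ltW p0).
  have h1 : Num.sg r * (r' - r) <= `|r'| - `|r|.
    rewrite mulrBr -normrEsg lerD2r.
    apply: le_trans (ler_norm _) _; rewrite normrM normr_sg.
    by case: (r != 0); rewrite ?mul1r// mul0r.
  have := ler_wpM2l pa0 h1; rewrite mulrA [X in _ <= X]mulrBr.
  have -> : p * `|r| `^ (p - 1) * `|r| = p * `|r| `^ p.
    by rewrite -mulrA (mulrC _ `|r|) mulr_powRB1.
  lra.
- by rewrite normr0 powR0// gt_eqF.
- by move=> r r' rr; rewrite ge0_ler_powR ?nnegrE ?(ltW p0).
- by rewrite sgr0 mulr0.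
Qed.

Lemma norm_le_powR p a : 1 <= p -> `|a| <= 1 + `|a| `^ p.
Proof.
move=> p1; have [a1|a1] := leP `|a| 1; first by apply: le_trans a1 _; rewrite lerDl powR_ge0.
by apply: le_trans (le1r_powR (ltW a1) p1) _; rewrite lerDr.
Qed.

Lemma excess_le_powR p K a : 1 <= p -> 1 <= K -> excess K a <= `|a| `^ p.
Proof.
move=> p1 K1; rewrite /excess ge_max powR_ge0 andbT.
have := norm_le_powR a p1; lra.
Qed.

Lemma powR_unit_mean p u (E : R) : 1 <= p -> measurable_fun setT u ->
  (\int[mu]_z (`|u z| `^ p)%:E <= E%:E)%E -> forall y,
  (\int[mu]_(z in `]y, (y + 1)%R]) `|u z|%:E <= (1 + E)%:E)%E.
Proof.
move=> p1 mu' hE y.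
have m1 : measurable_fun setT (fun z => (`|u z| `^ p)%:E).
  apply/measurable_EFinP; apply: (measurableT_comp (measurable_powR p)); exact: measurableT_comp.
have pos z : (0 <= (`|u z| `^ p)%:E)%E by rewrite lee_fin powR_ge0.
have h1 : (\int[mu]_(z in `]y, (y + 1)%R]) `|u z|%:E <=
    \int[mu]_(z in `]y, (y + 1)%R]) ((cst 1%E) z + (`|u z| `^ p)%:E))%E.
  apply: ge0_le_integral => //.
  - by apply/measurable_EFinP; apply: measurableT_comp => //; exact: measurable_funS mu'.
  - by apply: emeasurable_funD => //; exact: measurable_funS m1.
  by move=> z _; rewrite -EFinD lee_fin norm_le_powR.
apply: le_trans h1 _; rewrite ge0_integralD//; last by exact: measurable_funS m1.
rewrite integral_cst//= lebesgue_measure_itv /= lte_fin ltrDl ltr01 -EFinB addrAC subrr add0r mule1.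
by rewrite EFinD leeD2l//; apply: le_trans hE; apply: ge0_subset_integral.
Qed.

(** Dominated convergence: at each point the excess vanishes for large levels, and from level 1 on
    it is below the p-th power. This is why the levels are [n.+1]. *)
Lemma powR_excess_small p g (E : R) : 1 <= p -> measurable_fun setT g ->
  (\int[mu]_z (`|g z| `^ p)%:E <= E%:E)%E -> forall e, 0 < e ->
  exists2 K, 0 <= K & (\int[mu]_z (excess K (g z))%:E <= e%:E)%E.
Proof.
move=> p1 mg hE e e0.
have m1 : measurable_fun setT (fun z => (`|g z| `^ p)%:E).
  apply/measurable_EFinP; apply: (measurableT_comp (measurable_powR p)); exact: measurableT_comp.
have mex n : measurable_fun setT (fun z => (excess n.+1%:R (g z))%:E).
  apply/measurable_EFinP; apply: measurableT_comp mg.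
  by apply: (gauge_measurable (gauge_excess _)).
have [] := @dominated_convergence _ _ R mu setT measurableT
    (fun n z => (excess n.+1%:R (g z))%:E) (cst 0%E) (fun z => (`|g z| `^ p)%:E).
- exact: mex.
- exact: measurable_cst.
- apply: aeW => x _; apply: cvg_near_cst; near=> n.
  rewrite /excess max_r// subr_le0.
  apply: (@le_trans _ _ n%:R); last by rewrite ler_nat.
  by near: n; exact: nbhs_infty_ger.
- apply/integrableP; split => //.
  under eq_integral do rewrite gee0_abs ?lee_fin ?powR_ge0//.
  exact: le_lt_trans hE (ltry _).
- apply: aeW => x n _; rewrite gee0_abs ?lee_fin ?excess_ge0// ?lee_fin ?excess_le_powR ?ler1n//.
have pos k x : (0 <= (excess k.+1%:R (g x))%:E)%E by rewrite lee_fin excess_ge0.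
move=> _ _; rewrite integral0 => hc.
have [n hn] : exists n, (\int[mu]_z (excess n.+1%:R (g z))%:E < e%:E)%E.
  apply: contrapT => hn.
  have : (e%:E <= limn (fun n => \int[mu]_z (excess n.+1%:R (g z))%:E))%E.
    apply: lime_ge; first by apply/cvg_ex; exists 0%E.
    by apply: nearW => n; rewrite leNgt; apply/negP => h; apply: hn; exists n.
  by rewrite (cvg_lim (@ereal_hausdorff R) hc) lee_fin leNgt e0.
by exists n.+1%:R => //; exact: ltW.
Unshelve. all: by end_near. Qed.

Lemma Lnorm_powR p f : Lnorm mu p%:E (EFin \o f) =
  ((\int[mu]_x (`|f x| `^ p)%:E) `^ p^-1)%E.
Proof. by rewrite unlock; congr (_ `^ _)%E. Qed.

Lemma Lnorm_powR_lty p f : 0 < p ->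
  (Lnorm mu p%:E (EFin \o f) < +oo)%E <-> (\int[mu]_x (`|f x| `^ p)%:E < +oo)%E.
Proof.
move=> p0; rewrite Lnorm_powR; split; last exact: poweR_lty.
by apply: lty_poweRy; rewrite invr_eq0 gt_eqF.
Qed.

Lemma le_Lnorm_powR p f g : 0 < p ->
  (\int[mu]_x (`|f x| `^ p)%:E <= \int[mu]_x (`|g x| `^ p)%:E)%E ->
  (Lnorm mu p%:E (EFin \o f) <= Lnorm mu p%:E (EFin \o g))%E.
Proof.
move=> p0 h; rewrite !Lnorm_powR gt0_ler_poweR ?invr_ge0 ?(ltW p0)//.
- by rewrite in_itv /= leey andbT; apply: integral_ge0 => x _; rewrite lee_fin powR_ge0.
- by rewrite in_itv /= leey andbT; apply: integral_ge0 => x _; rewrite lee_fin powR_ge0.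
Qed.

Lemma Lnorm_infty f : Lnorm mu +oo (EFin \o f) = ess_sup mu (fun x => `|f x|%:E).
Proof.
rewrite unlock ifT//.
apply: lt_le_trans (_ : mu `[0%R, 1%R]%classic <= _)%E.
  by rewrite lebesgue_measure_itv /= lte_fin ltr01 -EFinB subr0 lte_fin ltr01.
by apply: le_measure; rewrite ?inE.
Qed.

Lemma Lnorm_infty_le f K : (Lnorm mu +oo (EFin \o f) <= K%:E)%E <->
  {ae mu, forall x, `|f x| <= K}.
Proof.
rewrite Lnorm_infty; split=> [/ess_supP h|h].
  by apply: filterS h => x; rewrite lee_fin.
apply/ess_supP; apply: filterS h; first exact: (ae_filter_ringOfSetsType mu).
by move=> x; rewrite lee_fin.
Qed.

Lemma Lnorm_infty_lty f : (Lnorm mu +oo (EFin \o f) < +oo)%E ->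
  exists2 K, 0 <= K & Lnorm mu +oo (EFin \o f) = K%:E.
Proof.
move=> h; have n0 : (0 <= Lnorm mu +oo (EFin \o f))%E by exact: Lnorm_ge0.
by exists (fine (Lnorm mu +oo (EFin \o f))); rewrite ?fine_ge0// fineK// ge0_fin_numE.
Qed.

Lemma ae_bounded_unit_mean u K : 0 <= K -> measurable_fun setT u -> {ae mu, forall x, `|u x| <= K} ->
  forall y, (\int[mu]_(z in `]y, (y + 1)%R]) `|u z|%:E <= K%:E)%E.
Proof.
move=> K0 mu' uK y.
have -> : K%:E = (\int[mu]_(z in `]y, (y + 1)%R]) cst K%:E z)%E.
  by rewrite integral_cst//= lebesgue_measure_itv /= lte_fin ltrDl ltr01 -EFinB addrAC subrr add0r mule1.
have muy : measurable_fun `]y, (y + 1)%R] (fun z => `|u z|%:E).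
  by apply/measurable_EFinP; apply: measurableT_comp => //; exact: measurable_funS mu'.
apply: (@ae_ge0_le_integral _ _ R mu _ _ (fun z => `|u z|%:E) (cst K%:E)) => //.
by apply: filterS uK; first exact: (ae_filter_ringOfSetsType mu).
Qed.

(** Translates an essential bound into an energy bound with [E = 0], so that p = oo goes through the
    same comparison as the finite exponents. *)
Lemma integral_excess_eq0 g K : measurable_fun setT g -> 0 <= K ->
  (\int[mu]_z (excess K (g z))%:E <= 0)%E <-> {ae mu, forall x, `|g x| <= K}.
Proof.
move=> mg K0.
have mex : measurable_fun setT (fun z => (excess K (g z))%:E).
  apply/measurable_EFinP; apply: measurableT_comp mg.
  by apply: (gauge_measurable (gauge_excess _)).
have ex0 z : (excess K (g z))%:E = 0%E <-> `|g z| <= K.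
  split=> [[]|h]; last by rewrite /excess max_r// subr_le0.
  by have := excess_ge K (g z) => + h; rewrite h subr_le0.
split=> [h|h].
  have h0 : (\int[mu]_z `|(excess K (g z))%:E| = 0)%E.
    apply/eqP; rewrite eq_le integral_ge0// andbT.
    by under eq_integral do rewrite gee0_abs ?lee_fin ?excess_ge0//.
  have /(proj1 (ae_eq_integral_abs _ _ _)) := h0.
  move=> /(_ measurableT mex); apply: filterS.
  by move=> z /(_ I)/ex0.
have -> : (\int[mu]_z (excess K (g z))%:E = \int[mu]_z (cst 0%E z))%E; last by rewrite integral0.
apply: ae_eq_integral => //.
by apply: filterS h; [exact: (ae_filter_ringOfSetsType mu)|move=> z /ex0].
Qed.

End PowerGauge.

Section MaximalSobolev.
Context {R : realType}.
Local Notation mu := (@lebesgue_measure R).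

(** The common core for all exponents. The unit means give a bounded representative, the small
    excess gives absolute continuity of the maximal function, and the last clause transfers any
    convex bound from [g] to its derivative. *)
Lemma maximal_sobolev (alpha A A' : R) (u g : R -> R) : 0 <= alpha -> weak_derivative u g ->
  (forall y, \int[mu]_(z in `]y, (y + 1)%R]) `|u z|%:E <= A%:E)%E ->
  (forall y, \int[mu]_(z in `]y, (y + 1)%R]) `|g z|%:E <= A'%:E)%E ->
  (forall e, 0 < e -> exists2 K, 0 <= K & (\int[mu]_z (excess K (g z))%:E <= e%:E)%E) ->
  exists v : R -> R, [/\ measurable_fun setT v, forall x, 0 <= v x, forall x, v x <= A + A',
    {ae mu, forall x, `|u x| = v x} &
    [/\ forall x, ustar alpha u x = (nontangential v alpha x)%:E,
      energy_ac (nontangential v alpha) &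
      forall (Phi s : R -> R) (E : R), gauge Phi s -> (\int[mu]_z (Phi (g z))%:E <= E%:E)%E ->
        (\int[mu]_z (Phi (density (nontangential v alpha) z))%:E <= E%:E)%E]].
Proof.
move=> alpha0 wd hu hg hex.
have [f [uf fE]] := weak_derivative_representative wd.
have lu := wd.1; have lg := wd.2.1.
have acf : energy_ac f.
  move=> e /hex[K K0 hK]; exists K => //.
  exact: (primitive_energy_le lg fE (gauge_excess K0) hK).
have mf : measurable_fun setT f.
  by apply: continuous_measurable_fun; exact: energy_ac_continuous.
have fB := primitive_bounded lg fE lu.1 mf uf hu hg.
pose v x := `|f x|.
have mv : measurable_fun setT v by exact: measurableT_comp.
have v0 x : 0 <= v x by exact: normr_ge0.
have uv : {ae mu, forall x, `|u x| = v x}.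
  by apply: filterS uf; [exact: (ae_filter_ringOfSetsType mu)|move=> x ->].
have usN : forall x, ustar alpha u x = (nontangential v alpha x)%:E.
  apply: (ustar_nontangential mv v0 fB alpha0) => t y t0.
  rewrite (pext_EFin mv v0 fB)// /poisson_abs.
  have mP : measurable_fun setT (fun z : R => poisson (y - z) t).
    by apply: (@measurable_reflect _ (fun w => poisson w t)); exact: measurable_poisson.
  apply: ge0_ae_eq_integral => //.
  - by apply/measurable_EFinP; apply: measurable_funM => //; apply: measurableT_comp => //; exact: lu.1.
  - by apply/measurable_EFinP; exact: measurable_funM.
  - by move=> z _; rewrite lee_fin mulr_ge0 ?poisson_ge0.
  - by move=> z _; rewrite lee_fin mulr_ge0 ?poisson_ge0.
  - by apply: filterS uv; [exact: (ae_filter_ringOfSetsType mu)|move=> z -> _].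
have hN (Phi s : R -> R) (E : R) : gauge Phi s -> (\int[mu]_z (Phi (g z))%:E <= E%:E)%E ->
    energy_le Phi (nontangential v alpha) E.
  move=> gPhi hE; apply: (nontangential_energy_le mv v0 fB alpha0 gPhi).
  by apply: (energy_le_norm gPhi); exact: (primitive_energy_le lg fE gPhi hE).
have acN : energy_ac (nontangential v alpha).
  by move=> e /hex[K K0 hK]; exists K => //; exact: (hN _ _ _ (gauge_excess K0) hK).
exists v; split => //; split => // Phi s E gPhi hE.
exact: (density_energy_le acN gPhi (hN _ _ _ gPhi hE)).
Qed.

End MaximalSobolev.

Section SobolevCases.
Context {R : realType}.
Local Notation mu := (@lebesgue_measure R).
Variables (alpha : R) (u g : R -> R).
Hypothesis alpha0 : 0 <= alpha.
Hypothesis wd : weak_derivative u g.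
Local Notation us := (fun x => fine (ustar alpha u x)).

Lemma bounded_inLp_infty (w : R -> R) (B : R) : measurable_fun setT w -> (forall x, 0 <= w x <= B) ->
  inLp +oo%E w.
Proof.
move=> mw wB; split => //; apply: le_lt_trans (ltry B); apply/Lnorm_infty_le.
by apply: aeW => x; have /andP[w0 wb] := wB x; rewrite ger0_norm.
Qed.

(** Covers finite p > 1 and p = 1 together: the derivative bound is uniform in p, and the condition
    [1 < p] guards only the membership that rests on the strong type inequality. *)
Lemma maximal_sobolev_powR (p : R) : 1 <= p -> inLp p%:E u -> inLp p%:E g ->
  [/\ forall x, (ustar alpha u x < +oo)%E, inLp +oo%E us,
    1 < p -> inLp p%:E us &
    exists h, [/\ weak_derivative us h, inLp p%:E h & (Lpnorm p%:E h <= Lpnorm p%:E g)%E]].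
Proof.
move=> p1 [mu' hu] [mg hg]; have p0 : 0 < p by rewrite (lt_le_trans ltr01).
have iu := proj1 (Lnorm_powR_lty u p0) hu.
have ig := proj1 (Lnorm_powR_lty g p0) hg.
have fin (w : R -> R) : (\int[mu]_x (`|w x| `^ p)%:E < +oo)%E ->
    exists E : R, (\int[mu]_x (`|w x| `^ p)%:E = E%:E)%E.
  move=> h; exists (fine (\int[mu]_x (`|w x| `^ p)%:E)); rewrite fineK// ge0_fin_numE//.
  by apply: integral_ge0 => x _; rewrite lee_fin powR_ge0.
have [Eu hEu] := fin u iu; have [Eg hEg] := fin g ig.
have leu : (\int[mu]_x (`|u x| `^ p)%:E <= Eu%:E)%E by rewrite hEu.
have leg : (\int[mu]_x (`|g x| `^ p)%:E <= Eg%:E)%E by rewrite hEg.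
have [v [mv v0 vB uv [usN acN hden]]] := maximal_sobolev alpha0 wd
  (powR_unit_mean p1 mu' leu) (powR_unit_mean p1 mg leg) (powR_excess_small p1 mg leg).
have -> : us = nontangential v alpha by apply/funext => x; rewrite usN.
have mN : measurable_fun setT (nontangential v alpha).
  by apply: continuous_measurable_fun; exact: energy_ac_continuous.
have NB := nontangential_bounded mv v0 vB alpha0.
have denp : (\int[mu]_x (`|density (nontangential v alpha) x| `^ p)%:E <= \int[mu]_x (`|g x| `^ p)%:E)%E.
  by rewrite hEg; exact: (hden _ _ _ (gauge_powR p1) leg).
have nden := le_Lnorm_powR p0 denp.
split.
- by move=> x; rewrite usN ltry.
- exact: bounded_inLp_infty NB.
- move=> lp1; split => //; apply/(Lnorm_powR_lty _ p0).
  have -> : (\int[mu]_x (`|nontangential v alpha x| `^ p)%:E =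
      \int[mu]_x (nontangential v alpha x `^ p)%:E)%E.
    by apply: eq_integral => x _; have /andP[n0 _] := NB x; rewrite ger0_norm.
  apply: (nontangential_powR_integrable mv v0 vB alpha0 lp1 mN).
  apply: le_lt_trans iu; rewrite le_eqVlt; apply/orP; left; apply/eqP.
  have mpow (w : R -> R) : measurable_fun setT w -> measurable_fun setT (fun x => (w x `^ p)%:E).
    by move=> mw; apply/measurable_EFinP; exact: (measurableT_comp (measurable_powR p)).
  apply: ge0_ae_eq_integral => //.
  - exact: mpow.
  - by apply: mpow; exact: measurableT_comp.
  - by move=> x _; rewrite lee_fin powR_ge0.
  - by apply: filterS uv; [exact: (ae_filter_ringOfSetsType mu)|move=> x -> _].
exists (density (nontangential v alpha)); split => //.
  apply: (weak_derivative_density acN) => x.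
  by have /andP[n0 nB] := NB x; rewrite ger0_norm//; exact: nB.
split; first exact: measurable_density.
exact: le_lt_trans nden hg.
Qed.

Lemma maximal_sobolev_infty : inLp +oo%E u -> inLp +oo%E g ->
  [/\ forall x, (ustar alpha u x < +oo)%E, inLp +oo%E us &
    exists h, [/\ weak_derivative us h, inLp +oo%E h & (Lpnorm +oo%E h <= Lpnorm +oo%E g)%E]].
Proof.
move=> [mu' /Lnorm_infty_lty[Ku Ku0 hu]] [mg /[dup] hg /Lnorm_infty_lty[K K0 hK]].
have aeu : {ae mu, forall x, `|u x| <= Ku} by apply/Lnorm_infty_le; rewrite hu.
have aeg : {ae mu, forall x, `|g x| <= K} by apply/Lnorm_infty_le; rewrite hK.
have ex0 := proj2 (integral_excess_eq0 mg K0) aeg.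
have [|v [mv v0 vB uv [usN acN hden]]] := maximal_sobolev alpha0 wd
  (ae_bounded_unit_mean Ku0 mu' aeu) (ae_bounded_unit_mean K0 mg aeg) _.
  (* One level serves every [e]: with [K] the essential bound of [g], the excess already vanishes
     almost everywhere. *)
  by move=> e e0; exists K => //; apply: le_trans ex0 _; rewrite lee_fin ltW.
have -> : us = nontangential v alpha by apply/funext => x; rewrite usN.
have cN := energy_ac_continuous acN.
have mN : measurable_fun setT (nontangential v alpha) by exact: continuous_measurable_fun.
have NB := nontangential_bounded mv v0 vB alpha0.
have mden : measurable_fun setT (density (nontangential v alpha)) by exact: measurable_density.
have nden : (Lpnorm +oo%E (density (nontangential v alpha)) <= Lpnorm +oo%E g)%E.
  rewrite /Lpnorm hK; apply/Lnorm_infty_le; apply/integral_excess_eq0 => //.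
  exact: (hden _ _ _ (gauge_excess K0) ex0).
split.
- by move=> x; rewrite usN ltry.
- exact: bounded_inLp_infty NB.
exists (density (nontangential v alpha)); split => //.
  apply: (weak_derivative_density acN) => x.
  by have /andP[n0 nB] := NB x; rewrite ger0_norm//; exact: nB.
split => //; exact: le_lt_trans nden hg.
Qed.

End SobolevCases.

Theorem theorem4 (R : realType) (alpha : R) (u0 : R -> R) :
  0 <= alpha ->
  let us := fun x => fine (ustar alpha u0 x) in
  (* (i) *)
  (forall (p : \bar R) (g0 : R -> R),
     (1 < p)%E -> inLp p u0 -> weak_derivative u0 g0 -> inLp p g0 ->
     (forall x, (ustar alpha u0 x < +oo)%E) /\ inLp p us /\
     exists g, weak_derivative us g /\ inLp p g /\
       (Lpnorm p g <= Lpnorm p g0)%E) /\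
  (* (ii) *)
  (forall g0 : R -> R,
     inLp 1%E u0 -> weak_derivative u0 g0 -> inLp 1%E g0 ->
     (forall x, (ustar alpha u0 x < +oo)%E) /\ inLp +oo%E us /\
     exists g, weak_derivative us g /\
       (Lpnorm 1%E g <= Lpnorm 1%E g0)%E) /\
  (* (iii) *)
  (bounded_variation_R u0 ->
     (forall x, (ustar alpha u0 x < +oo)%E) /\
     bounded_variation_R us /\ (TV us <= TV u0)%E).
Proof.
move=> alpha0 us; split; [|split].
- move=> p g0 p1 Lu wd Lg.
  case: p p1 Lu Lg => [p| |] // p1 Lu Lg.
    have [h1 _ h2 [h [h3 h4 h5]]] := maximal_sobolev_powR alpha0 wd (ltW p1) Lu Lg.
    by split => //; split; [exact: h2|exists h].
  have [h1 h2 [h [h3 h4 h5]]] := maximal_sobolev_infty alpha0 wd Lu Lg.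
  by split => //; split => //; exists h.
- move=> g0 Lu wd Lg.
  have [h1 h2 _ [h [h3 _ h5]]] := maximal_sobolev_powR alpha0 wd (lexx 1) Lu Lg.
  by split => //; split => //; exists h.
- by move=> bv; have [] := maximal_bounded_variation alpha0 bv.
Qed.
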